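(* Let $V$ be a finite-dimensional real normed space, $m\ge 1$ an integer, $p\ge 1$ a real number, and let $Y$ be a $G^{m}(V)$-valued path. Then $Y$ belongs to $C^{p\text{-}var}(G^{m}(V))$ if and only if there exists a sequence $(y(n))_{n}$ of infinitely differentiable $V$-valued paths such that (i) $\left\Vert S_{m}(y(n))\right\Vert _{p\text{-}var}$ is uniformly bounded in $n$, and (ii) $S_{m}(y(n))$ converges pointwise to $Y$. In particular, $S_{m}(y(n))$ converges in $q$-variation to $Y$ (that is, $d_{q\text{-}var}(S_{m}(y(n)),Y)\to 0$), whenever $q>p$.
   Context: $T^{(m)}(V)=\bigoplus_{n=0}^{m}V^{\otimes n}$ is the truncated tensor algebra with (truncated) product $\otimes$; $\mathcal{G}^{m}(V)$ is its Lie subalgebra generated by $V$ for the bracket $[a,b]=a\otimes b-b\otimes a$; $G^{m}(V)=\exp(\mathcal{G}^{m}(V))$ is the free nilpotent Lie group of step $m$ over $V$, with product $\otimes$ and neutral element $1$. The dilation is $\delta_{t}(1+v_{1}+\dots+v_{m})=1+tv_{1}+\dots+t^{m}v_{m}$, $v_i\in V^{\otimes i}$, $t\in\mathbb{R}$. $\|\cdot\|_{m}$ is a fixed symmetric subadditive homogeneous norm on $G^{m}(V)$, i.e. a function $G^m(V)\to[0,\infty)$ with $\|g\|_m=0$ iff $g=1$, $\|\delta_t g\|_m=|t|\,\|g\|_m$, $\|g\otimes h\|_m\le\|g\|_m+\|h\|_m$, $\|g^{-1}\|_m=\|g\|_m$ (for instance the Carnot–Caratheodory norm; all such norms are equivalent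 since $\dim V<\infty$). Set $d_{m}(g,h)=\|g^{-1}\otimes h\|_{m}$. A $G^m(V)$-valued path is a continuous map $[0,1]\to G^{m}(V)$ starting at $1$; for such a path $Y_{s,t}:=Y_{s}^{-1}\otimes Y_{t}$. For a smooth path $y:[0,1]\to V$, the signature is $S_{m}(y)_{s,t}=1+\sum_{k=1}^{m}\int_{s<u_{1}<\dots<u_{k}<t}dy_{u_{1}}\otimes\dots\otimes dy_{u_{k}}\in G^{m}(V)$, and $S_m(y)$ denotes the $G^m(V)$-valued path $t\mapsto S_m(y)_{0,t}$. For $r\ge 1$, $d_{r\text{-}var}(x,y)=\sup_{D=(0=t_{0}<\cdots<t_{n}=1)}\big(\sum_{i=0}^{n-1}d_{m}(x_{t_{i},t_{i+1}},y_{t_{i},t_{i+1}})^{r}\big)^{1/r}$, $\|x\|_{r\text{-}var}$ is $d_{r\text{-}var}$ between $x$ and the constant path $1$, and $C^{r\text{-}var}(G^{m}(V))$ is the set of $G^m(V)$-valued paths $x$ with $\|x\|_{r\text{-}var}<\infty$. *)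

(* Defs.v *)
From HB Require Import structures.
From mathcomp Require Import all_boot all_order all_algebra.
From mathcomp Require Import all_classical all_reals all_analysis.

Set Implicit Arguments.
Unset Strict Implicit.
Unset Printing Implicit Defensive.

Import Order.TTheory GRing.Theory Num.Theory.
Import numFieldNormedType.Exports.

Local Open Scope classical_set_scope.
Local Open Scope ring_scope.

(* Finite-dimensional normed spaces over K. *)
#[short(type="normedVectType")]
HB.structure Definition NormedVector (K : numFieldType) :=
  {T of NormedModule K T & Vector K T}.

Section TruncatedTensorAlgebra.
Variables (R : realType) (V : normedVectType R) (m : nat).

(* T^(m)(V), in coordinates: if e_i is the basis [vbasis {:V}] of V, the tensors
   e_{i_1} (x) ... (x) e_{i_k} with k <= m form a basis of T^(m)(V), and an
   element is given by its coefficients, indexed by the words i_1 ... i_k.  The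
   component in the k-th tensor power is the restriction to words of size k. *)
Definition word := m.-bseq 'I_(\dim {:V}).
Definition tensor := {ffun word -> R}.

Definition tone : tensor := [ffun w : word => (size w == 0)%:R].

(* (a b)_w is the sum of a_u b_v over the factorisations w = uv.  The prefixes
   and suffixes of w have size at most m, so [insub_bseq] is the identity here. *)
Definition tmul (a b : tensor) : tensor :=
  [ffun w : word => \sum_(k < (size w).+1)
     a (insub_bseq m (take k w)) * b (insub_bseq m (drop k w))].

Definition tpow (a : tensor) (k : nat) : tensor := iter k (tmul a) tone.

Definition tbracket (a b : tensor) : tensor := tmul a b - tmul b a.

Definition tvec (v : V) : tensor :=
  [ffun w : word =>
     (if bseqval w is [:: i] then coord (vbasis {:V}) i v else 0) : R].

Definition dilation (t : R) (a : tensor) : tensor :=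
  [ffun w : word => t ^+ size w * a w].

(* The inverse in T^(m)(V) of an element g with scalar component 1: the
   Neumann series stops because 1 - g has no scalar component. *)
Definition tinv (g : tensor) : tensor :=
  \sum_(k < m.+1) tpow (tone - g) k.

(* The exponential of an element without scalar component: all further terms
   of the exponential series vanish in T^(m)(V). *)
Definition texp (a : tensor) : tensor :=
  \sum_(k < m.+1) k`!%:R^-1 *: tpow a k.

Definition lie_subalgebra (L : set tensor) : Prop :=
  [/\ L 0,
      forall (c : R) a b, L a -> L b -> L (c *: a + b) &
      forall a b, L a -> L b -> L (tbracket a b)].

Definition free_nilpotent_lie_algebra : set tensor :=
  smallest lie_subalgebra (range tvec).

Definition free_nilpotent_group : set tensor :=
  texp @` free_nilpotent_lie_algebra.

(* Symmetric subadditive homogeneous norms on G^m(V); the values of N outside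
   of G^m(V) are irrelevant. *)
Record homogeneous_norm (N : tensor -> R) : Prop := HomogeneousNorm {
  hnorm_ge0 : forall g, free_nilpotent_group g -> 0 <= N g ;
  hnorm_eq0 : forall g, free_nilpotent_group g -> (N g = 0 <-> g = tone) ;
  hnorm_dilation : forall (t : R) g, free_nilpotent_group g ->
    N (dilation t g) = `|t| * N g ;
  hnorm_mul : forall g h, free_nilpotent_group g -> free_nilpotent_group h ->
    N (tmul g h) <= N g + N h ;
  hnorm_inv : forall g, free_nilpotent_group g -> N (tinv g) = N g
}.

Definition hdist (N : tensor -> R) (g h : tensor) : R := N (tmul (tinv g) h).

(* Paths on [0, 1] are functions on R of which only the restriction to [0, 1]
   matters.  The topology on T^(m)(V) is that of coordinatewise convergence. *)
Definition group_path (x : R -> tensor) : Prop :=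
  [/\ x 0 = tone,
      forall t : R, t \in `[0, 1] -> free_nilpotent_group (x t) &
      forall w : word, {within `[0, 1], continuous (fun t : R => x t w)}].

Definition incr (x : R -> tensor) (s t : R) : tensor := tmul (tinv (x s)) (x t).

(* A partition 0 = t_0 < t_1 < ... < t_n = 1 is given by s = [:: t_1; ...; t_n]. *)
Definition var_dist (N : tensor -> R) (r : R) (x y : R -> tensor) : \bar R :=
  ereal_sup
    [set (let t := nth 1 (0 :: s) in
          (\sum_(0 <= i < size s)
             hdist N (incr x (t i) (t i.+1)) (incr y (t i) (t i.+1)) `^ r)
          `^ r^-1)%:E | s in itv_partition (0 : R) 1].

Definition var_norm (N : tensor -> R) (r : R) (x : R -> tensor) : \bar R :=
  var_dist N r x (cst tone).

(* C^{r-var}(G^m(V)) *)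
Definition var_paths (N : tensor -> R) (r : R) : set (R -> tensor) :=
  [set x | group_path x /\ (var_norm N r x < +oo)%E].

(* y is infinitely differentiable on the closed interval [0, 1], with one-sided
   derivatives at 0 and 1: D k is the k-th derivative of y on [0, 1]. *)
Definition smooth_path (y : R -> V) : Prop :=
  exists D : nat -> R -> V, D 0%N = y /\
    forall (k : nat) (t : R), t \in `[0, 1] ->
      h^-1 *: (D k (t + h) - D k t)
        @[h --> within [set h | t + h \in `[0, 1]] 0^'] --> D k.+1 t.

(* For the reversed word [:: i_k; ...; i_1], the iterated integral of
   dy^{i_1}_{u_1} ... dy^{i_k}_{u_k} over s < u_1 < ... < u_k < t, where
   dy_u = y'(u) du; the outermost integration variable is u_k. *)
Fixpoint iterated_integral (y : R -> V) (rw : seq 'I_(\dim {:V})) (s t : R) : R :=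
  if rw is i :: rw' then
    \int[lebesgue_measure]_(u in `]s, t[)
      (iterated_integral y rw' s u * coord (vbasis {:V}) i (derive1 y u))
  else 1.

Definition signature (y : R -> V) (s t : R) : tensor :=
  [ffun w : word => iterated_integral y (rev w) s t].

Definition signature_path (y : R -> V) : R -> tensor := signature y 0.

End TruncatedTensorAlgebra.

(* Main.v *)
(* Elements of the group are recognized by two identities that need no logarithm:
   [g * D g = deg g], with [D] the Dynkin operator, and [g * (u <| g) = u * g], with
   [<|] the right adjoint action.  Both survive products, inverses, limits and
   equations [x' = x * l] with [l] in the Lie algebra.  Subtracting leading terms,
   read off from [D], shows that such a [g] is an exponential; dividing out nested
   group commutators instead shows that [g] is a product of exponentials of letters of
   total length at most [C * ||g||].

   Running through such products with a smooth clock that is flat at the junctions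
   gives a smooth path whose signature goes from [1] to [g] with running length at most
   [C * ||g||].  Concatenating these for the increments of [Y] along the grid [i / n]
   gives [y n], whose signature agrees with [Y] on the grid and whose [p]-variation is
   bounded by that of [Y].  Ultrafilter compactness yields uniform convergence, and
   interpolation between the uniform distance and the [p]-variation yields
   [q]-variation.  The converse is lower semicontinuity of the [p]-variation. *)

Require Import Defs.
From HB Require Import structures.
From mathcomp Require Import all_boot all_order all_algebra.
From mathcomp Require Import all_classical all_reals all_analysis.
From mathcomp Require Import ring lra.

Set Implicit Arguments.
Unset Strict Implicit.
Unset Printing Implicit Defensive.

Import Order.TTheory GRing.Theory Num.Theory.
Import numFieldNormedType.Exports.

Local Open Scope classical_set_scope.
Local Open Scope ring_scope.

(** The norm [N] is given only by its axioms: neither its continuity nor a link to lengths of curves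
    is among them, so geodesics are not at hand. The bridge is a coordinate gauge,
    [|g_w| <= r ^ |w|] for all words [w]. A nested commutator of [k] letters of size [t] has a
    leading term of size [t ^ k], so a coefficient of size at most [r ^ k] is removed at a cost
    proportional to [r]; this is why the length bound is linear in the norm, with a constant
    depending on [V], [m] and [N] alone. The bound on the [p]-variation of the approximations comes
    from cutting an interval at its extreme grid points. Between them the path has the same
    increment as [Y]. Inside a cell of length [l] the [p]-th power of an increment is at most
    [l ^ (p - 1)] times the running length, and the powers [l ^ p] sum up to a multiple of the
    control of [Y]. Signatures of the constructed paths are never integrated: they are identified by
    uniqueness for a linear equation that is triangular in the length of words. *)

Definition talg (R : realType) (V : normedVectType R) (m : nat) : Type := tensor V m.

(** Only the linear structure of [tensor] is inherited, so that [*] on [talg] can be given the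
    meaning of the truncated product [tmul]. *)
HB.instance Definition _ (R : realType) (V : normedVectType R) (m : nat) :=
  GRing.Lmodule.copy (talg V m) (tensor V m).

(** * The truncated tensor algebra as a ring *)

Section Coefficients.
Variables (R : realType) (V : normedVectType R) (m : nat).
Local Notation I := 'I_(\dim {:V}).
Local Notation T := (talg V m).
Implicit Types (a b c : T) (s : seq I) (w : word V m).

(** Coefficients at arbitrary sequences, extended by [0] beyond length [m]: words can then be cut
    and concatenated without carrying bounds in their types. *)
Definition tcoef a s : R := if (size s <= m)%N then a (insub_bseq m s) else 0.

Lemma insub_bseqK w : insub_bseq m w = w.
Proof. by apply: val_inj; rewrite /insub_bseq insubdK// [_ \in _]size_bseq. Qed.

Lemma val_insub_bseq s : (size s <= m)%N -> insub_bseq m s = s :> seq I.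
Proof. by move=> sm; rewrite /insub_bseq insubdK. Qed.

Lemma tcoefE a w : tcoef a w = a w.
Proof. by rewrite /tcoef size_bseq insub_bseqK. Qed.

Lemma tcoef_gt a s : (m < size s)%N -> tcoef a s = 0.
Proof. by rewrite /tcoef ltnNge => /negbTE->. Qed.

Lemma tcoefP a b : (forall s, (size s <= m)%N -> tcoef a s = tcoef b s) -> a = b.
Proof. by move=> ab; apply/ffunP => w; rewrite -!tcoefE ab// size_bseq. Qed.

Lemma tcoefD a b s : tcoef (a + b) s = tcoef a s + tcoef b s.
Proof. by rewrite /tcoef; case: ifP => _; rewrite ?ffunE ?addr0. Qed.

Lemma tcoefN a s : tcoef (- a) s = - tcoef a s.
Proof. by rewrite /tcoef; case: ifP => _; rewrite ?ffunE ?oppr0. Qed.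

Lemma tcoef0 s : tcoef (0 : T) s = 0.
Proof. by rewrite /tcoef; case: ifP => _; rewrite ?ffunE. Qed.

Lemma tcoefB a b s : tcoef (a - b) s = tcoef a s - tcoef b s.
Proof. by rewrite tcoefD tcoefN. Qed.

Lemma tcoefZ (k : R) a s : tcoef (k *: a) s = k * tcoef a s.
Proof. by rewrite /tcoef; case: ifP => _; rewrite ?ffunE ?mulr0. Qed.

Lemma tcoef_sum (J : Type) (r : seq J) (P : pred J) (F : J -> T) s :
  tcoef (\sum_(i <- r | P i) F i) s = \sum_(i <- r | P i) tcoef (F i) s.
Proof.
elim/big_rec2: _ => [|i x y _ <-]; [exact: tcoef0|exact: tcoefD].
Qed.

Lemma tcoef_one s : tcoef (tone V m : T) s = (size s == 0)%:R.
Proof.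
rewrite /tcoef; case: leqP => [sm|]; first by rewrite ffunE val_insub_bseq.
by case: s.
Qed.

Lemma tcoef_mul a b s : (size s <= m)%N ->
  tcoef (tmul a b : T) s =
  \sum_(k < (size s).+1) tcoef a (take k s) * tcoef b (drop k s).
Proof.
move=> sm; rewrite {1}/tcoef sm ffunE val_insub_bseq//; apply: eq_bigr => k _.
rewrite /tcoef size_drop (leq_trans (leq_subr _ _))//.
by rewrite size_take_min (leq_trans (geq_minr _ _)).
Qed.

End Coefficients.

Section RingStructure.
Variables (R : realType) (V : normedVectType R) (m : nat).
Local Notation I := 'I_(\dim {:V}).
Local Notation T := (talg V m).
Implicit Types (a b c : T).

Fact tmulA : associative (@tmul R V m : T -> T -> T).
Proof.
move=> a b c; apply: tcoefP => s sm; rewrite !tcoef_mul//.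
(* Both sides sum over the factorisations of [s] into three factors, with cuts at [k <= j]. *)
transitivity (\sum_(k < (size s).+1) \sum_(j < (size s).+1 | (k <= j)%N)
  tcoef a (take k s) * tcoef b (drop k (take j s)) * tcoef c (drop j s)).
  apply: eq_bigr => k _; have ks : (k <= size s)%N by rewrite -ltnS.
  rewrite tcoef_mul ?size_drop ?(leq_trans (leq_subr _ _))// mulr_sumr.
  rewrite (big_ord_widen_cond (size s).+1 xpredT
    (fun j => tcoef a (take k s) * (tcoef b (take j (drop k s)) *
      tcoef c (drop j (drop k s))))); last by rewrite ltnS leq_subr.
  rewrite /=.
  rewrite -(big_mkord (fun j => j < (size s - k).+1)%N
    (fun j => tcoef a (take k s) * (tcoef b (take j (drop k s)) *
      tcoef c (drop j (drop k s))))).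
  rewrite -(big_mkord (fun j => k <= j)%N
    (fun j => tcoef a (take k s) * tcoef b (drop k (take j s)) * tcoef c (drop j s))).
  rewrite -(big_nat_widen 0 (size s - k).+1 (size s).+1 xpredT) ?ltnS ?leq_subr//.
  rewrite -subSn//.
  rewrite [RHS](big_cat_nat (n := k)) ?(leq_trans ks)//=.
  rewrite [X in _ = X + _]big1_seq ?add0r; last first.
    by move=> j; rewrite mem_index_iota => /andP[kj /andP[_]]; rewrite ltnNge kj.
  rewrite -[X in _ = \sum_(X <= _ < _ | _) _]add0n big_addn.
  apply: congr_big_nat => // j; first by rewrite leq_addl.
  by rewrite take_drop drop_drop mulrA.
rewrite (exchange_big_dep xpredT)//=; apply: eq_bigr => j _.
have js : (j <= size s)%N by rewrite -ltnS.
rewrite tcoef_mul ?size_takel ?(leq_trans js)//.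
rewrite mulr_suml (big_ord_widen (size s).+1
    (fun k => tcoef a (take k (take j s)) * tcoef b (drop k (take j s)) * tcoef c (drop j s)))//.
apply: eq_big => // k /= kj.
by rewrite take_takel.
Qed.

Fact tmul1l : left_id (tone V m) (@tmul R V m : T -> T -> T).
Proof.
move=> a; apply: tcoefP => s sm; rewrite tcoef_mul// big_ord_recl.
rewrite take0 drop0 tcoef_one mul1r big1 ?addr0// => k _.
rewrite tcoef_one size_take_min /= /bump add1n.
by case: s sm k => [|i s] _ k; [case: k|rewrite minnSS mul0r].
Qed.

Fact tmul1r : right_id (tone V m) (@tmul R V m : T -> T -> T).
Proof.
move=> a; apply: tcoefP => s sm; rewrite tcoef_mul// big_ord_recr/=.
rewrite take_size drop_size tcoef_one mulr1 big1 ?add0r// => k _.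
by rewrite tcoef_one size_drop subn_eq0 leqNgt ltn_ord mulr0.
Qed.

Fact tmulDl : left_distributive (@tmul R V m : T -> T -> T) +%R.
Proof.
move=> a b c; apply: tcoefP => s sm; rewrite tcoefD !tcoef_mul// -big_split/=.
by apply: eq_bigr => k _; rewrite tcoefD mulrDl.
Qed.

Fact tmulDr : right_distributive (@tmul R V m : T -> T -> T) +%R.
Proof.
move=> a b c; apply: tcoefP => s sm; rewrite tcoefD !tcoef_mul// -big_split/=.
by apply: eq_bigr => k _; rewrite tcoefD mulrDr.
Qed.

Fact tone_neq0 : (tone V m : T) != 0.
Proof.
apply/eqP => /(congr1 (fun a : T => tcoef a [::])); rewrite tcoef_one tcoef0.
by move/eqP; rewrite oner_eq0.
Qed.

HB.instance Definition _ := GRing.Zmodule_isNzRing.Build T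
  tmulA tmul1l tmul1r tmulDl tmulDr tone_neq0.

Fact tscaleAl (k : R) a b : k *: (a * b) = (k *: a) * b.
Proof.
apply: tcoefP => s sm; rewrite tcoefZ !tcoef_mul// mulr_sumr.
by apply: eq_bigr => i _; rewrite tcoefZ mulrA.
Qed.

HB.instance Definition _ := GRing.Lmodule_isLalgebra.Build R T tscaleAl.

Fact tscaleAr (k : R) a b : k *: (a * b) = a * (k *: b).
Proof.
apply: tcoefP => s sm; rewrite tcoefZ !tcoef_mul// mulr_sumr.
by apply: eq_bigr => i _; rewrite tcoefZ mulrCA.
Qed.

HB.instance Definition _ := GRing.Lalgebra_isAlgebra.Build R T tscaleAr.

Lemma tcoefM a b (s : seq I) : (size s <= m)%N ->
  tcoef (a * b) s = \sum_(k < (size s).+1) tcoef a (take k s) * tcoef b (drop k s).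
Proof. exact: tcoef_mul. Qed.

Lemma tcoef1 (s : seq I) : tcoef (1 : T) s = (size s == 0)%:R.
Proof. exact: tcoef_one. Qed.

Lemma tpowE a k : tpow a k = a ^+ k.
Proof. by elim: k => [//|k IH]; rewrite /tpow iterS -/(tpow a k) IH exprS. Qed.

End RingStructure.

(** The algebra is not commutative, so [ring] cannot work in it directly. Once products are
    expanded, an identity is linear in its monomials and can be checked on coefficients. *)
Ltac tlinear := apply: tcoefP => ? _; rewrite !(tcoefD, tcoefN, tcoefZ, tcoef0); ring.

(** * The degree filtration, words, brackets and the degree derivation *)

Section Filtration.
Variables (R : realType) (V : normedVectType R) (m : nat).
Local Notation I := 'I_(\dim {:V}).
Local Notation T := (talg V m).
Implicit Types (a b c u x y : T) (s : seq I) (k l : nat).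

(** A decreasing filtration by ideals, multiplicative by [tordM] and zero beyond degree [m] by
    [tord_eq0]. Congruences modulo [tord] express all statements about leading terms. *)
Definition tord k a := forall s, (size s < k)%N -> tcoef a s = 0.

Lemma tord_ge0 a : tord 0 a. Proof. by []. Qed.

Lemma tord_zero k : tord k 0. Proof. by move=> s _; rewrite tcoef0. Qed.

Lemma tordW k l a : (k <= l)%N -> tord l a -> tord k a.
Proof. by move=> kl al s sk; rewrite al// (leq_trans sk). Qed.

Lemma tordD k a b : tord k a -> tord k b -> tord k (a + b).
Proof. by move=> ak bk s sk; rewrite tcoefD ak// bk// addr0. Qed.

Lemma tordN k a : tord k a -> tord k (- a).
Proof. by move=> ak s sk; rewrite tcoefN ak// oppr0. Qed.

Lemma tordB k a b : tord k a -> tord k b -> tord k (a - b).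
Proof. by move=> ak bk; apply: tordD => //; exact: tordN. Qed.

Lemma tordZ k (r : R) a : tord k a -> tord k (r *: a).
Proof. by move=> ak s sk; rewrite tcoefZ ak// mulr0. Qed.

Lemma tord_sum k (J : Type) (r : seq J) (P : pred J) (F : J -> T) :
  (forall i, P i -> tord k (F i)) -> tord k (\sum_(i <- r | P i) F i).
Proof. by move=> Fk s sk; rewrite tcoef_sum big1// => i Pi; rewrite (Fk i). Qed.

Lemma tordM k l a b : tord k a -> tord l b -> tord (k + l) (a * b).
Proof.
move=> ak bl s skl; have [sm|sm] := leqP (size s) m; last by rewrite tcoef_gt.
rewrite tcoefM// big1// => i _; have is_ : (i <= size s)%N by rewrite -ltnS.
have [ik|ki] := ltnP i k; first by rewrite ak ?mul0r// size_takel.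
by rewrite bl ?mulr0// size_drop ltn_subLR// (leq_trans skl)// leq_add2r.
Qed.

Lemma tordX k a : tord 1 a -> tord k (a ^+ k).
Proof. by move=> a1; elim: k => [//|k IH]; rewrite exprS -add1n; exact: tordM. Qed.

Lemma tord_eq0 k a : (m < k)%N -> tord k a -> a = 0.
Proof.
move=> mk ak; apply: tcoefP => s sm.
by rewrite tcoef0 ak// (leq_ltn_trans sm).
Qed.

Lemma tord1P a : tord 1 a <-> tcoef a [::] = 0.
Proof. by split=> [->//|a0 [|]]. Qed.

Lemma tcoefM_nil a b : tcoef (a * b) [::] = tcoef a [::] * tcoef b [::].
Proof. by rewrite tcoefM//= big_ord_recl big_ord0 addr0. Qed.

Lemma tcoef1_nil : tcoef (1 : T) [::] = 1.
Proof. by rewrite tcoef1. Qed.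

Lemma tord_subr1 a : tcoef a [::] = 1 -> tord 1 (a - 1).
Proof. by move=> a1; apply/tord1P; rewrite tcoefB a1 tcoef1_nil subrr. Qed.

Definition tdelta s : T := [ffun w : word V m => (bseqval w == s)%:R].

Lemma tcoef_delta s s' : tcoef (tdelta s) s' = ((size s' <= m)%N && (s' == s))%:R.
Proof.
by rewrite /tcoef; case: ifP => // sm; rewrite ffunE val_insub_bseq.
Qed.

Lemma tdelta_gt s : (m < size s)%N -> tdelta s = 0.
Proof.
move=> ms; apply: tcoefP => s' s'm; rewrite tcoef_delta tcoef0 s'm /=.
by case: eqP => // s'E; rewrite -s'E ltnNge s'm in ms.
Qed.

Lemma tdelta_nil : tdelta [::] = 1.
Proof. by apply: tcoefP => s sm; rewrite tcoef_delta sm tcoef1 size_eq0. Qed.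

Lemma tdeltaM s s' : tdelta s * tdelta s' = tdelta (s ++ s').
Proof.
apply: tcoefP => t tm; rewrite tcoefM// tcoef_delta tm/=.
have [tE|ne] := eqVneq t (s ++ s'); last first.
  rewrite big1// => k _; rewrite !tcoef_delta.
  have [tk|] := eqVneq (take k t) s; last by rewrite andbF mul0r.
  have [dk|] := eqVneq (drop k t) s'; last by rewrite andbF mulr0.
  by rewrite -tk -dk cat_take_drop eqxx in ne.
have sz : (size s < (size t).+1)%N by rewrite ltnS tE size_cat leq_addr.
rewrite (bigD1 (Ordinal sz))//= big1 ?addr0.
  rewrite tE take_size_cat// drop_size_cat// !tcoef_delta !eqxx !andbT.
  move: tm; rewrite tE size_cat => tm.
  by rewrite (leq_trans (leq_addr _ _) tm) (leq_trans (leq_addl _ _) tm) mulr1.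
move=> k; rewrite -val_eqE/= => ks; rewrite !tcoef_delta.
have [/(congr1 size)|] := eqVneq (take k t) s; last by rewrite andbF mul0r.
have kt : (k <= size t)%N by rewrite -ltnS.
by rewrite size_takel// => kE; rewrite kE eqxx in ks.
Qed.

Lemma tdelta_sum a : a = \sum_(w : word V m) a w *: tdelta w.
Proof.
apply/ffunP => w; rewrite sum_ffunE (bigD1 w)//= big1 ?addr0.
  by rewrite !ffunE eqxx [_ *: _]mulr1.
by move=> w' w'w; rewrite !ffunE val_eqE eq_sym (negbTE w'w) scaler0.
Qed.

Lemma tord_delta s : tord (size s) (tdelta s).
Proof.
by move=> s' ss'; rewrite tcoef_delta; case: eqP => [s'E|]; rewrite ?andbF// -s'E ltnn in ss' *.
Qed.

Definition tlin (f : seq I -> T) a : T := \sum_(w : word V m) a w *: f w.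

Fact tlin_is_linear f : linear (tlin f).
Proof.
move=> r a b; rewrite /tlin scaler_sumr -big_split/=; apply: eq_bigr => w _.
by rewrite !ffunE scalerDl scalerA.
Qed.

HB.instance Definition _ f := GRing.isLinear.Build R T T _ (tlin f) (tlin_is_linear f).

Lemma tlin_delta f s : (forall s, (m < size s)%N -> f s = 0) -> tlin f (tdelta s) = f s.
Proof.
move=> fm; have [sm|sm] := leqP (size s) m; last first.
  by rewrite (tdelta_gt sm) linear0 fm.
rewrite /tlin (bigD1 (insub_bseq m s))//= big1 ?addr0.
  by rewrite ffunE val_insub_bseq// eqxx scale1r.
move=> w; rewrite -val_eqE/= val_insub_bseq// ffunE => /negbTE->.
by rewrite scale0r.
Qed.

Lemma tord_tlin f k a : (forall s, tord (size s) (f s)) -> tord k a -> tord k (tlin f a).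
Proof.
move=> fs ak; apply: tord_sum => w _; have [wk|kw] := ltnP (size w) k.
  by rewrite -tcoefE ak// scale0r; exact: tord_zero.
by apply: tordZ; apply: tordW (fs w).
Qed.

Definition tbr a b : T := a * b - b * a.

Lemma tord_tbr k l a b : tord k a -> tord l b -> tord (k + l) (tbr a b).
Proof.
by move=> ak bl; apply: tordB; [exact: tordM|rewrite addnC; exact: tordM].
Qed.

Lemma tbrDl a b c : tbr (a + b) c = tbr a c + tbr b c.
Proof. by rewrite /tbr mulrDl mulrDr opprD addrACA. Qed.

Lemma tbrDr a b c : tbr a (b + c) = tbr a b + tbr a c.
Proof. by rewrite /tbr mulrDl mulrDr opprD addrACA. Qed.

Lemma tbr1l a : tbr 1 a = 0.
Proof. by rewrite /tbr mul1r mulr1 subrr. Qed.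

Lemma tbr1r a : tbr a 1 = 0.
Proof. by rewrite /tbr mul1r mulr1 subrr. Qed.

(** The Jacobi identity in the form used for right actions: the commutator of the actions of [b] and
    [c] is the action of their bracket. *)
Lemma tbr_jacobi a b c : tbr (tbr a b) c - tbr (tbr a c) b = tbr a (tbr b c).
Proof.
rewrite /tbr !(mulrBl, mulrBr) !mulrA; tlinear.
Qed.

(** The infinitesimal generator of the dilations, hence a derivation ([tdegM]). *)
Definition tdeg a : T := [ffun w : word V m => (size w)%:R * a w].

Lemma tcoef_deg a s : tcoef (tdeg a) s = (size s)%:R * tcoef a s.
Proof.
by rewrite /tcoef; case: ifP => sm; rewrite ?mulr0// ffunE val_insub_bseq.
Qed.

Fact tdeg_is_linear : linear tdeg.
Proof.
by move=> r a b; apply: tcoefP => s _; rewrite !(tcoefD,tcoefZ,tcoef_deg) mulrDr mulrCA.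
Qed.

HB.instance Definition _ := GRing.isLinear.Build R T T _ tdeg tdeg_is_linear.

Lemma tdegM a b : tdeg (a * b) = tdeg a * b + a * tdeg b.
Proof.
apply: tcoefP => s sm; rewrite tcoefD tcoef_deg !tcoefM// mulr_sumr -big_split/=.
apply: eq_bigr => k _; have ks : (k <= size s)%N by rewrite -ltnS.
by rewrite !tcoef_deg size_drop size_takel// natrB//; ring.
Qed.

Lemma tdeg1 : tdeg 1 = 0.
Proof.
apply: tcoefP => s _; rewrite tcoef_deg tcoef1 tcoef0.
by case: s => [|i s]; rewrite ?mul0r ?mulr0.
Qed.

End Filtration.

(** * Lie-like and group-like tensors *)

Section GroupLike.
Variables (R : realType) (V : normedVectType R) (m : nat).
Local Notation I := 'I_(\dim {:V}).
Local Notation T := (talg V m).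
Implicit Types (a b c u x y g h l : T) (s : seq I).

Definition tlet (i : I) : T := tdelta m [:: i].

Lemma tord_let i : tord 1 (tlet i).
Proof. exact: (@tord_delta _ _ _ [:: i]). Qed.

Fixpoint tbrs u s : T := if s is i :: s' then tbrs (tbr u (tlet i)) s' else u.

Lemma tbrs_cat u s s' : tbrs u (s ++ s') = tbrs (tbrs u s) s'.
Proof. by elim: s u => //= i s IH u; rewrite IH. Qed.

Lemma tbrs_linear (r : R) u v s : tbrs (r *: u + v) s = r *: tbrs u s + tbrs v s.
Proof.
elim: s u v => //= i s IH u v; rewrite -IH; congr (tbrs _ _).
by rewrite /tbr mulrDl mulrDr -scalerAl -scalerAr scalerBr opprD addrACA.
Qed.

Lemma tbrs0 s : tbrs 0 s = 0.
Proof. by have := tbrs_linear (-1) 0 0 s; rewrite scaler0 addr0 scaleN1r addNr. Qed.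

Lemma tbrsZ (r : R) u s : tbrs (r *: u) s = r *: tbrs u s.
Proof. by rewrite -[r *: u]addr0 tbrs_linear tbrs0 addr0. Qed.

Lemma tord_brs k u s : tord k u -> tord (k + size s) (tbrs u s).
Proof.
elim: s u k => [|i s IH] u k uk /=; first by rewrite addn0.
rewrite addnS -addSn; apply: IH; rewrite -addn1; apply: tord_tbr => //.
exact: tord_let.
Qed.

Definition dynkin_word s : T := if s is i :: s' then tbrs (tlet i) s' else 0.

Lemma tord_dynkin_word s : tord (size s) (dynkin_word s).
Proof.
by case: s => [//|i s]; rewrite /= -add1n; exact/tord_brs/tord_let.
Qed.

(* [dynkin] is the left-to-right Dynkin operator [i1 ... ik |-> [[i1, i2], ..., ik]];
   [x |-> tad ^~ x] is the anti-morphism of algebras sending a letter [i] to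
   [u |-> [u, i]]. *)
Definition dynkin x : T := tlin dynkin_word x.
HB.instance Definition _ := GRing.Linear.copy dynkin (tlin dynkin_word).

Definition tad u x : T := tlin (tbrs u) x.
HB.instance Definition _ u := GRing.Linear.copy (tad u) (tlin (tbrs u)).

Lemma tad_delta u s : tad u (tdelta m s) = tbrs u s.
Proof.
by apply: tlin_delta => {}s ms; apply: (tord_eq0 ms); exact: (@tord_brs 0).
Qed.

Lemma dynkin_delta s : dynkin (tdelta m s) = dynkin_word s.
Proof.
by apply: tlin_delta => {}s ms; apply: (tord_eq0 ms); exact: tord_dynkin_word.
Qed.

Lemma tad_linear_l (r : R) u v x : tad (r *: u + v) x = r *: tad u x + tad v x.
Proof.
rewrite /tad /tlin scaler_sumr -big_split/=; apply: eq_bigr => w _.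
by rewrite tbrs_linear scalerDr !scalerA mulrC.
Qed.

Lemma tad0l x : tad 0 x = 0.
Proof. by have := tad_linear_l (-1) 0 0 x; rewrite scaler0 addr0 scaleN1r addNr. Qed.

Lemma tadDl u v x : tad (u + v) x = tad u x + tad v x.
Proof. by have := tad_linear_l 1 u v x; rewrite !scale1r. Qed.

Lemma tadZl (r : R) u x : tad (r *: u) x = r *: tad u x.
Proof. by have := tad_linear_l r u 0 x; rewrite !addr0 tad0l addr0. Qed.

Lemma tad1 u : tad u 1 = u.
Proof. by rewrite -tdelta_nil tad_delta. Qed.

Lemma tad_sum_l (J : Type) (r : seq J) (F : J -> T) x :
  tad (\sum_(i <- r) F i) x = \sum_(i <- r) tad (F i) x.
Proof.
elim: r => [|i r IH]; first by rewrite !big_nil tad0l.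
by rewrite !big_cons tadDl IH.
Qed.

Lemma tadM u x y : tad u (x * y) = tad (tad u x) y.
Proof.
rewrite [x]tdelta_sum mulr_suml !linear_sum tad_sum_l; apply: eq_bigr => w _.
rewrite -scalerAl !linearZ/= tadZl; congr (_ *: _).
rewrite [y]tdelta_sum mulr_sumr !linear_sum; apply: eq_bigr => w' _.
by rewrite -scalerAr !linearZ/= tdeltaM !tad_delta tbrs_cat.
Qed.

Lemma tad_let u i : tad u (tlet i) = tbr u (tlet i).
Proof. exact: tad_delta. Qed.

Lemma dynkin1 : dynkin 1 = 0.
Proof. by rewrite -tdelta_nil dynkin_delta. Qed.

Lemma dynkin_let i : dynkin (tlet i) = tlet i.
Proof. exact: dynkin_delta. Qed.

(** The left-nested bracket of a concatenation starts with the bracket of the first word, on which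
    the letters of the second act through [tad]. The second term accounts for the empty word in [x],
    where [dynkin_word] is [0] by convention. *)
Lemma dynkinM x y : dynkin (x * y) = tad (dynkin x) y + tcoef x [::] *: dynkin y.
Proof.
have nilE : tcoef x [::] = \sum_(w : word V m) x w * tcoef (tdelta m w) [::].
  rewrite {1}[x]tdelta_sum tcoef_sum; apply: eq_bigr => w _; exact: tcoefZ.
rewrite nilE scaler_suml; clear nilE.
rewrite [in dynkin (x * y)](tdelta_sum x) [in tad _ _](tdelta_sum x).
rewrite mulr_suml !linear_sum tad_sum_l.
rewrite -big_split/=.
apply: eq_bigr => w _; rewrite -scalerAl !linearZ/= tadZl -scalerA -scalerDr.
congr (_ *: _); rewrite [in LHS](tdelta_sum y) mulr_sumr linear_sum/=.
rewrite [in X in _ + X]/dynkin /tad /tlin scaler_sumr -big_split/=.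
apply: eq_bigr => w' _; rewrite -scalerAr linearZ/= tdeltaM.
rewrite scalerA [_ * y w']mulrC -scalerA -scalerDr; congr (_ *: _).
rewrite !dynkin_delta tcoef_delta/= eq_sym.
case: (bseqval w) => [|i s] /=; last by rewrite tbrs_cat scale0r addr0.
by rewrite scale1r tbrs0 add0r.
Qed.

Lemma tord_dynkin k x : tord k x -> tord k (dynkin x).
Proof. by apply: tord_tlin => s; exact: tord_dynkin_word. Qed.

(* On Lie elements the Dynkin operator multiplies degree [k] by [k]
   (Dynkin-Specht-Wever); [g * dynkin g = tdeg g] is its exponentiated form. *)
Record lie_like l : Prop := LieLike {
  lie_like_ord : tord 1 l ;
  lie_like_ad : forall u, tad u l = tbr u l ;
  lie_like_dynkin : dynkin l = tdeg l }.

Record group_like g : Prop := GroupLike {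
  group_like_nil : tcoef g [::] = 1 ;
  group_like_ad : forall u, g * tad u g = u * g ;
  group_like_dynkin : g * dynkin g = tdeg g }.

Lemma lie_like_let i : lie_like (tlet i).
Proof.
split; [exact: tord_let|by move=> u; rewrite tad_let|rewrite dynkin_let].
apply: tcoefP => s _; rewrite tcoef_deg tcoef_delta.
by have [->|] := eqVneq s [:: i]; rewrite ?andbF ?mulr0// mul1r.
Qed.

Lemma lie_like_subalgebra : lie_subalgebra (lie_like : set (tensor V m)).
Proof.
split.
- split; [exact: tord_zero| |by rewrite !linear0].
  by move=> u; rewrite linear0 /tbr mulr0 mul0r subr0.
- move=> r a b [a1 aad aD] [b1 bad bD]; split.
  + by apply: tordD => //; exact: tordZ.
  + move=> u; rewrite linearP/= aad bad /tbr mulrDr mulrDl -scalerAl -scalerAr.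
    by rewrite scalerBr opprD addrACA.
  + by rewrite !linearP/= aD bD.
- move=> a b [a1 aad aD] [b1 bad bD]; split.
  + by apply: (@tordW _ _ _ _ 2); [|exact: (tord_tbr a1 b1)].
  + move=> u; rewrite linearB/= !tadM !aad !bad.
    by rewrite -[RHS](tbr_jacobi u a b).
  + rewrite !linearB/= !dynkinM bad aad aD bD.
    rewrite (a1 [::])// (b1 [::])// !scale0r !addr0 !tdegM /tbr; tlinear.
Qed.

Lemma tvecE v : tvec m v = \sum_(i : I) coord (vbasis {:V}) i v *: tlet i.
Proof.
apply/ffunP => w; rewrite ffunE sum_ffunE.
case wE : (bseqval w) => [|i [|j s]].
- by rewrite big1// => i _; rewrite !ffunE wE scaler0.
- rewrite (bigD1 i)//= big1 ?addr0 => [|j ji]; first by rewrite !ffunE wE eqxx [_ *: _]mulr1.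
  by rewrite !ffunE wE eqseq_cons andbT eq_sym (negbTE ji) scaler0.
- by rewrite big1// => k _; rewrite !ffunE wE eqseq_cons andbF scaler0.
Qed.

Local Notation lie := (@free_nilpotent_lie_algebra R V m).

Lemma lie_sub : lie_subalgebra lie.
Proof.
split.
- by move=> L [[L0 _ _] _].
- by move=> r a b la lb L LL; case: (LL) => -[_ LP _] _; apply: LP; [exact: la|exact: lb].
- by move=> a b la lb L LL; case: (LL) => -[_ _ LP] _; apply: LP; [exact: la|exact: lb].
Qed.

Lemma tvec_basis (i : I) : tvec m (vbasis {:V})`_i = tlet i.
Proof.
rewrite tvecE (bigD1 i)//= big1 ?addr0 => [|j ji].
  by rewrite coord_free ?eqxx ?scale1r//; exact: (basis_free (vbasisP _)).
by rewrite coord_free ?(basis_free (vbasisP _))// eq_sym (negbTE ji) scale0r.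
Qed.

Lemma lie_let i : lie (tlet i).
Proof.
by move=> L [_ Lv]; apply: Lv; exists (vbasis {:V})`_i => //; exact: tvec_basis.
Qed.

Lemma lie0 : lie 0.
Proof. by case: lie_sub. Qed.

Lemma lieP (r : R) a b : lie a -> lie b -> lie (r *: a + b).
Proof. by case: lie_sub => _ + _; exact. Qed.

Lemma lieD a b : lie a -> lie b -> lie (a + b).
Proof. by move=> la lb; rewrite -[a]scale1r; exact: lieP. Qed.

Lemma lieZ (r : R) a : lie a -> lie (r *: a).
Proof. by move=> la; rewrite -[_ *: _]addr0; apply: lieP => //; exact: lie0. Qed.

Lemma lie_br a b : lie a -> lie b -> lie (tbr a b).
Proof. by case: lie_sub => _ _; exact. Qed.

Lemma lie_sum (J : Type) (r : seq J) (P : pred J) (F : J -> T) :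
  (forall i, P i -> lie (F i)) -> lie (\sum_(i <- r | P i) F i).
Proof. by move=> LF; elim/big_ind: _ => //; [exact: lie0|exact: lieD]. Qed.

Lemma lie_tvec v : lie (tvec m v).
Proof. by rewrite tvecE; apply: lie_sum => i _; apply: lieZ; exact: lie_let. Qed.

Lemma lie_dynkin_word s : lie (dynkin_word s).
Proof.
case: s => [|i s] /=; first exact: lie0.
elim: s (tlet i) (lie_let i) => //= j s IH u lu; apply: IH.
by apply: lie_br => //; exact: lie_let.
Qed.

Lemma lie_lie_like l : lie l -> lie_like l.
Proof.
move=> ll; apply: ll; split; first exact: lie_like_subalgebra.
move=> _ [v _ <-]; rewrite tvecE; have [L0 LP _] := lie_like_subalgebra.
elim/big_ind: _ => //.
- by move=> a b La Lb; rewrite -[a]scale1r; exact: LP.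
- by move=> i _; rewrite -[_ *: _]addr0; apply: LP => //; exact: lie_like_let.
Qed.

Lemma tinvE g : tord 1 (g - 1) ->
  g * (tinv g : T) = 1 /\ (tinv g : T) * g = 1.
Proof.
move=> g1; pose z : T := 1 - g.
have z1 : tord 1 z by rewrite /z -opprB; exact: tordN.
have zm : z ^+ m.+1 = 0 by apply: (tord_eq0 (ltnSn m)); exact: tordX.
have iE : (tinv g : T) = \sum_(k < m.+1) z ^+ k.
  by apply: eq_bigr => k _; rewrite tpowE.
have gE : g = 1 - z by rewrite /z opprB addrC subrK.
have zC : GRing.comm z (\sum_(k < m.+1) z ^+ k).
  by apply: commr_sum => k _; exact: commrX.
have E : (1 - z) * (\sum_(k < m.+1) z ^+ k) = 1.
  by rewrite -[1 - z]opprB mulNr -subrX1 zm sub0r opprK.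
rewrite iE gE; split => //.
by rewrite -[RHS]E mulrBl mulrBr mul1r mulr1 zC.
Qed.

Lemma tmulV g : tcoef g [::] = 1 -> g * (tinv g : T) = 1.
Proof. by move/tord_subr1/tinvE => -[]. Qed.

Lemma tmulVl g : tcoef g [::] = 1 -> (tinv g : T) * g = 1.
Proof. by move/tord_subr1/tinvE => -[]. Qed.

Lemma tinv_unique g h : tcoef g [::] = 1 -> g * h = 1 -> tinv g = h.
Proof.
move=> g1 /(congr1 (fun x => (tinv g : T) * x)).
by rewrite mulrA tmulVl// mul1r mulr1.
Qed.

Lemma tcoef_inv_nil g : tcoef g [::] = 1 -> tcoef (tinv g : T) [::] = 1.
Proof.
move=> g1; have /(congr1 (fun x : T => tcoef x [::])) := tmulV g1.
by rewrite tcoefM_nil g1 mul1r tcoef1_nil.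
Qed.

Lemma group_like1 : group_like 1.
Proof.
split; first exact: tcoef1_nil.
- by move=> u; rewrite tad1 mul1r mulr1.
- by rewrite dynkin1 tdeg1 mulr0.
Qed.

Lemma group_likeM g h : group_like g -> group_like h -> group_like (g * h).
Proof.
move=> [g1 gad gD] [h1 had hD]; split.
- by rewrite tcoefM_nil g1 h1 mulr1.
- by move=> u; rewrite tadM -mulrA had mulrA gad mulrA.
- rewrite dynkinM g1 scale1r mulrDr -[g * h * _]mulrA had -[g * h * _]mulrA hD.
  by rewrite mulrA gD tdegM.
Qed.

(** The adjoint identity says that [tad u g] is the conjugate [g^-1 u g]; since [tad u] turns
    products into composites, [g^-1] acts by the inverse conjugation. The Dynkin identity follows by
    applying [dynkin] and [tdeg] to [g g^-1 = 1]. *)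
Lemma group_likeV g : group_like g -> group_like (tinv g).
Proof.
move=> [g1 gad gD]; set k : T := tinv g.
have gk : g * k = 1 := tmulV g1; have kg : k * g = 1 := tmulVl g1.
have adk u : tad u k = g * u * k.
  have E v : tad v g = k * v * g by rewrite -mulrA -gad mulrA kg mul1r.
  have Eu : tad (g * u * k) g = u by rewrite E !mulrA kg mul1r -mulrA kg mulr1.
  by rewrite -{1}Eu -tadM gk tad1.
split; first exact: tcoef_inv_nil.
- by move=> u; rewrite adk !mulrA kg mul1r.
- have : dynkin (g * k) = 0 by rewrite gk dynkin1.
  rewrite dynkinM g1 scale1r adk gD => /eqP; rewrite addrC addr_eq0 => /eqP ->.
  have : tdeg (g * k) = 0 by rewrite gk tdeg1.
  rewrite tdegM => /(congr1 (fun x => k * x)); rewrite mulr0 mulrDr !mulrA kg mul1r.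
  by move/eqP; rewrite addrC addr_eq0 => /eqP->; rewrite mulrN mulrA.
Qed.

(* The homogeneous component of degree [k] of [g] as a Lie polynomial, when
   [g - 1] starts in degree [k]. *)
Definition group_like_lead k g : T :=
  \sum_(w : word V m | size w == k) (k%:R^-1 * g w) *: dynkin_word w.

Lemma lie_lead k g : lie (group_like_lead k g).
Proof. by apply: lie_sum => w _; apply: lieZ; exact: lie_dynkin_word. Qed.

Lemma tord_lead k g : tord k (group_like_lead k g).
Proof.
by apply: tord_sum => w /eqP <-; apply: tordZ; exact: tord_dynkin_word.
Qed.

(** With [g = 1 + h] and [h] of order [k], the term [h * dynkin h] has order [2 k > k]. In degree
    [k] the Dynkin identity therefore reads [dynkin h = k h], which displays the leading term as a
    combination of nested brackets. *)
Lemma group_like_leadP k g : group_like g -> (0 < k)%N -> tord k (g - 1) ->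
  tord k.+1 (g - 1 - group_like_lead k g).
Proof.
move=> [g1 _ gD] k0 gk s; rewrite ltnS leq_eqVlt => /orP[/eqP sk|sk]; last first.
  by rewrite tcoefB gk// tord_lead// subr0.
have k0R : k%:R != 0 :> R by rewrite pnatr_eq0 -lt0n.
set h := g - 1 in gk *.
have Dh : dynkin g = dynkin h by rewrite linearB/= dynkin1 subr0.
have dh : tdeg g = tdeg h by rewrite linearB/= tdeg1 subr0.
have Dk : tord k (dynkin h) by exact: tord_dynkin.
have E : k%:R * tcoef h s = tcoef (dynkin h) s.
  have := congr1 (fun x : T => tcoef x s) gD; rewrite Dh dh tcoef_deg sk => <-.
  rewrite -[g in g * _](subrK 1) -/h mulrDl mul1r tcoefD.
  by rewrite (tordM gk Dk) ?add0r// sk -addn1 leq_add2l.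
apply/eqP; rewrite tcoefB subr_eq0; apply/eqP.
apply: (mulfI k0R); rewrite E /group_like_lead /dynkin /tlin !tcoef_sum mulr_sumr.
rewrite (bigID (fun w : word V m => size w == k))/= [X in _ + X]big1 ?addr0.
  apply: eq_bigr => w /eqP wk; rewrite !tcoefZ !mulrA divff// mul1r.
  congr (_ * _); rewrite -!tcoefE tcoefB tcoef1 wk.
  by rewrite -[k == 0]negbK -lt0n k0 subr0.
move=> w wk; rewrite tcoefZ; have [wlt|] := ltnP (size w) k.
  by rewrite -tcoefE gk// mul0r.
rewrite leq_eqVlt eq_sym (negbTE wk)/= => kw.
by rewrite tord_dynkin_word ?mulr0// sk.
Qed.

End GroupLike.

(** * Limits and linear differential equations in the tensor algebra *)

Lemma is_deriveXn (R : realType) (f : R -> R) (t df : R) (k : nat) : is_derive t 1 f df ->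
  is_derive t 1 (fun u => f u ^+ k) (k%:R * f t ^+ k.-1 * df).
Proof.
move=> fd; elim: k => [|k IH].
  by rewrite !mul0r; exact: is_derive_cst.
under eq_fun do rewrite exprS.
apply: (is_derive_eq (is_deriveM fd IH)).
rewrite -![_ *: _]/(_ * _) /=; case: k {IH} => [|k] /=; first by ring.
by rewrite exprS -[k.+2%:R]natr1; ring.
Qed.

Lemma cvg_bigsum (R : realType) (W : normedModType R) (S : Type) (F : set_system S)
    (J : Type) (r : seq J) (P : pred J)
    (f : J -> S -> W) (a : J -> W) : Filter F -> (forall i, P i -> f i @ F --> a i) ->
  \sum_(i <- r | P i) f i u @[u --> F] --> \sum_(i <- r | P i) a i.
Proof.
move=> FF fa; elim: r => [|i r IH].
  by rewrite big_nil; under eq_fun do rewrite big_nil; exact: cvg_cst.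
rewrite big_cons; under eq_fun do rewrite big_cons.
case: ifP => // Pi; exact: cvgD (fa _ Pi) IH.
Qed.

(* Limits along such a [U] replace the successive extractions of subsequences. *)
Lemma ultrafilter_nat (R : realType) : exists2 U : set_system nat, ProperFilter U &
  \oo `<=` U /\
  forall (a : nat -> R) (M : R), (forall n, `|a n| <= M) -> exists l : R, a n @[n --> U] --> l.
Proof.
have [U [UU oU]] := ultraFilterLemma eventually_filter.
exists U; first exact: ultra_proper.
split=> // a M aM.
have [|l [_ cl]] := @segment_compact R (- M) M (a n @[n --> U]) _.
  by apply: oU; exists 0%N => // n _ /=; rewrite in_itv/= -ler_norml.
exists l => A lA; have [//|UA] := in_ultra_setVsetC (a @^-1` A) UU.
have [x [nx x_]] := cl (~` A) A UA lA.
by case: nx.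
Qed.

Section LinearODE.
Variables (R : realType) (V : normedVectType R) (m : nat).
Local Notation I := 'I_(\dim {:V}).
Local Notation T := (talg V m).
Local Notation lie := (@free_nilpotent_lie_algebra R V m).
Implicit Types (x y l : R -> T) (A : set R) (t : R).

Lemma is_derive_bigsum (J : Type) (r : seq J) (P : pred J) (F : J -> R -> R)
    (dF : J -> R) t : (forall i, P i -> is_derive t 1 (F i) (dF i)) ->
  is_derive t 1 (fun u => \sum_(i <- r | P i) F i u) (\sum_(i <- r | P i) dF i).
Proof.
move=> FdF; elim: r => [|i r IH].
  rewrite big_nil (_ : (fun _ => _) = cst 0); first exact: is_derive_cst.
  by apply/funext => u; rewrite big_nil.
rewrite big_cons; under eq_fun do rewrite big_cons.
case: ifP => // Pi; exact: is_deriveD (FdF _ Pi) IH.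
Qed.

(** Stated for arbitrary filters: it serves for continuity, for sequences and for limits along
    ultrafilters. *)
Definition tcvg (S : Type) (F : set_system S) (x : S -> T) (a : T) :=
  forall s : seq I, tcoef (x u) s @[u --> F] --> tcoef a s.

Section Tcvg.
Context (S : Type) (F : set_system S) {FF : Filter F}.
Implicit Types (f g : S -> T) (a b : T).

Lemma tcvg_cst a : tcvg F (cst a) a.
Proof. by move=> s; exact: cvg_cst. Qed.

Lemma tcvgB f g a b : tcvg F f a -> tcvg F g b -> tcvg F (fun u => f u - g u) (a - b).
Proof.
move=> fa gb s; rewrite tcoefB; under eq_fun do rewrite tcoefB.
exact: cvgB (fa s) (gb s).
Qed.

Lemma tcvgM f g a b : tcvg F f a -> tcvg F g b -> tcvg F (fun u => f u * g u) (a * b).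
Proof.
move=> fa gb s; have [sm|sm] := leqP (size s) m; last first.
  rewrite tcoef_gt//; under eq_fun do rewrite tcoef_gt//.
  exact: cvg_cst.
rewrite tcoefM//; under eq_fun do rewrite tcoefM//.
by apply: cvg_bigsum => k _; exact: cvgM (fa _) (gb _).
Qed.

Lemma tcvg_lin (f : S -> T) a (h : {linear T -> T}) : tcvg F f a -> tcvg F (h \o f) (h a).
Proof.
move=> fa s; rewrite [a]tdelta_sum linear_sum tcoef_sum.
rewrite (_ : (fun u => _) =
    fun u => \sum_(w : word V m) tcoef (f u) w * tcoef (h (tdelta m w)) s).
  apply: cvg_bigsum => w _; rewrite linearZ tcoefZ -tcoefE.
  by apply: cvgM (fa _) _; exact: cvg_cst.
apply/funext => u; rewrite /= [f u in LHS]tdelta_sum linear_sum tcoef_sum.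
by apply: eq_bigr => w _; rewrite linearZ tcoefZ tcoefE.
Qed.

Lemma tcvg_tad u f a : tcvg F f a -> tcvg F (fun v => tad u (f v)) (tad u a).
Proof. exact: (@tcvg_lin f a (tad u)). Qed.

Lemma tcvg_sum (J : Type) (r : seq J) (P : pred J) (f : J -> S -> T) (a : J -> T) :
  (forall i, P i -> tcvg F (f i) (a i)) ->
  tcvg F (fun u => \sum_(i <- r | P i) f i u) (\sum_(i <- r | P i) a i).
Proof.
move=> fa s; rewrite tcoef_sum; under eq_fun do rewrite tcoef_sum.
by apply: cvg_bigsum => i Pi; exact: fa.
Qed.

Lemma tcvgX f a k : tcvg F f a -> tcvg F (fun u => f u ^+ k) (a ^+ k).
Proof.
move=> fa; elim: k => [|k IH]; first exact: tcvg_cst.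
by rewrite exprS; under eq_fun do rewrite exprS; exact: tcvgM.
Qed.

Lemma tcvg_inv f a : tcvg F f a -> tcvg F (fun u => tinv (f u) : T) (tinv a).
Proof.
move=> fa; rewrite /tinv; apply: tcvg_sum => k _.
rewrite tpowE; under eq_fun do rewrite tpowE.
by apply: tcvgX; apply: tcvgB => //; exact: tcvg_cst.
Qed.

End Tcvg.

Lemma tcvg_unique (S : Type) (F : set_system S) (f : S -> T) a b :
  ProperFilter F -> tcvg F f a -> tcvg F f b -> a = b.
Proof.
move=> FF fa fb; apply: tcoefP => s _; exact: cvg_unique (fa s) (fb s).
Qed.

Lemma group_like_cvg (S : Type) (F : set_system S) (f : S -> T) a :
  ProperFilter F -> tcvg F f a -> (\forall u \near F, group_like (f u)) -> group_like a.
Proof.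
move=> FF fa fG.
have near_tcvg (g h : S -> T) b : {near F, g =1 h} -> tcvg F g b -> tcvg F h b.
  move=> gh gb s; apply: cvg_trans (gb s); apply: near_eq_cvg.
  by apply: filterS gh => u /= ->.
split.
- have f1 : tcoef (f u) [::] @[u --> F] --> (1 : R).
    by apply: cvg_near_cst; apply: filterS fG => u [].
  exact: cvg_unique (fa [::]) f1.
- move=> u; apply: (@tcvg_unique S F (fun v => f v * tad u (f v))).
    exact: (tcvgM fa (tcvg_tad fa)).
  apply: (near_tcvg (fun v => u * f v)); last by apply: tcvgM => //; exact: tcvg_cst.
  by apply: filterS fG => v [].
- apply: (@tcvg_unique S F (fun v => f v * dynkin (f v))).
    exact: (tcvgM fa (tcvg_lin fa)).
  apply: (near_tcvg (fun v => tdeg (f v))); last exact: (tcvg_lin fa).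
  by apply: filterS fG => v [].
Qed.

Definition tcont A x := forall s : seq I, {within A, continuous (fun t => tcoef (x t) s)}.

Lemma tcontE A x : tcont A x <-> forall t : subspace A, tcvg (nbhs t) (x : subspace A -> T) (x t).
Proof. by split=> xc => [t s|s t]; exact: xc. Qed.

Definition tderive x t (dx : T) :=
  forall s : seq I, is_derive t 1 (fun u => tcoef (x u) s) (tcoef dx s).

Lemma tderiveB x y t dx dy : tderive x t dx -> tderive y t dy ->
  tderive (fun u => x u - y u) t (dx - dy).
Proof.
move=> xd yd s; rewrite tcoefB; under eq_fun do rewrite tcoefB.
exact: is_deriveB (xd s) (yd s).
Qed.

Lemma tderive_cst a t : tderive (cst a) t 0.
Proof. by move=> s; rewrite tcoef0; exact: (is_derive_cst (tcoef a s)). Qed.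

Lemma tderiveM x y t dx dy : tderive x t dx -> tderive y t dy ->
  tderive (fun u => x u * y u) t (dx * y t + x t * dy).
Proof.
move=> xd yd s; have [sm|sm] := leqP (size s) m; last first.
  rewrite tcoef_gt//; under eq_fun do rewrite tcoef_gt//.
  exact: is_derive_cst.
rewrite tcoefD !tcoefM// -big_split/=; under eq_fun do rewrite tcoefM//.
apply: is_derive_bigsum => k _; apply: is_derive_eq.
  exact: is_deriveM (xd _) (yd _).
by rewrite addrC; congr (_ + _); exact: mulrC.
Qed.

Lemma tderive_lin x t dx (h : {linear T -> T}) : tderive x t dx ->
  tderive (h \o x) t (h dx).
Proof.
move=> xd s; rewrite [dx]tdelta_sum linear_sum tcoef_sum.
rewrite (_ : (fun u => _) =
    fun u => \sum_(w : word V m) tcoef (h (tdelta m w)) s * tcoef (x u) w).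
  apply: is_derive_bigsum => w _; rewrite linearZ tcoefZ -tcoefE mulrC.
  exact: is_deriveZ (xd _).
apply/funext => u; rewrite /= [x u in LHS]tdelta_sum linear_sum tcoef_sum.
by apply: eq_bigr => w _; rewrite linearZ tcoefZ tcoefE mulrC.
Qed.

(** The equation is triangular: as [l] has no constant term, the derivative of the coefficient at
    [s] involves [x] only at proper prefixes of [s]. By induction on the length of [s] this
    derivative vanishes, and the mean value theorem concludes. *)
Lemma tode_eq0 x l : (forall t, t \in `]0, 1[ -> tord 1 (l t)) ->
  tcont `[0, 1] x -> (forall t, t \in `]0, 1[ -> tderive x t (x t * l t)) ->
  x 0 = 0 -> forall t, t \in `[0, 1] -> x t = 0.
Proof.
move=> l1 xc xd x0.
suff H n s t : (size s < n)%N -> t \in `[0, 1] -> tcoef (x t) s = 0.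
  by move=> t t01; apply: tcoefP => s _; rewrite tcoef0 (H (size s).+1).
elim: n s t => // n IH s t; rewrite ltnS => sn t01.
have [sm|/tcoef_gt->//] := leqP (size s) m.
have [t0 t1] : 0 <= t /\ t <= 1 by move: t01; rewrite in_itv/= => /andP[].
have [||c _] := @MVT_segment R (fun t => tcoef (x t) s) (cst 0) 0 t t0.
- move=> u /[!in_itv]/= /andP[u0 ut].
  have u01 : u \in `]0, 1[ by rewrite in_itv/= u0 (lt_le_trans ut).
  apply: is_derive_eq; first exact: (xd u u01 s).
  rewrite tcoefM// big_ord_recr/= drop_size (l1 _ u01)// mulr0 addr0 big1// => k _.
  rewrite IH ?mul0r//; last by rewrite in_itv/= !ltW// (lt_le_trans ut).
  by rewrite size_takel ?(ltnW (ltn_ord k))// (leq_trans (ltn_ord k)).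
- by apply: continuous_subspaceW (xc s); apply: subset_itvl; rewrite bnd_simp.
by rewrite /= mul0r x0 tcoef0 subr0.
Qed.

Definition tode x l := [/\ x 0 = 1, tcont `[0, 1] x &
  forall t, t \in `]0, 1[ -> tderive x t (x t * l t)].

Lemma tode_unique x y l : (forall t, t \in `]0, 1[ -> tord 1 (l t)) ->
  tode x l -> tode y l -> forall t, t \in `[0, 1] -> x t = y t.
Proof.
move=> l1 [x0 xc xd] [y0 yc yd] t t01; apply/eqP; rewrite -subr_eq0; apply/eqP.
apply: (@tode_eq0 (fun t => x t - y t) l) => //.
- by apply/tcontE => u; apply: tcvgB; [exact: (tcontE _ _).1|exact: (tcontE _ _).1].
- by move=> u u01; rewrite mulrBl; apply: tderiveB; [exact: xd|exact: yd].
- by rewrite x0 y0 subrr.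
Qed.

(* Along [x' = x l], both defects [x (tad u x) - u x] and
   [x (dynkin x) - tdeg x] solve the same linear equation [z' = z l]. *)
Lemma tode_group_like x l : (forall t, t \in `]0, 1[ -> lie (l t)) ->
  tode x l -> forall t, t \in `[0, 1] -> group_like (x t).
Proof.
move=> ll [x0 xc xd].
have lL t : t \in `]0, 1[ -> lie_like (l t) by move/ll/lie_lie_like.
have l1 t : t \in `]0, 1[ -> tord 1 (l t) by move/lL => -[].
have xcE := (tcontE _ _).1 xc.
have xnil t : t \in `[0, 1] -> tcoef (x t) [::] = 1.
  move=> /[!in_itv]/= /andP[t0 t1].
  have [||c _] := @MVT_segment R (fun t => tcoef (x t) [::]) (cst 0) 0 t t0.
  - move=> u /[!in_itv]/= /andP[u0 ut].
    have u01 : u \in `]0, 1[ by rewrite in_itv/= u0 (lt_le_trans ut).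
    apply: is_derive_eq; first exact: (xd u u01 [::]).
    by rewrite tcoefM_nil (l1 _ u01)// mulr0.
  - by apply: continuous_subspaceW (xc [::]); apply: subset_itvl; rewrite bnd_simp.
  by rewrite /= mul0r x0 tcoef1_nil => /eqP; rewrite subr_eq0 => /eqP.
move=> t t01; split; first exact: xnil.
- move=> u; apply/eqP; rewrite -subr_eq0; apply/eqP.
  apply: (@tode_eq0 (fun t => x t * tad u (x t) - u * x t) l) => //.
  + apply/tcontE => v; apply: tcvgB.
      exact: (tcvgM (xcE v) (tcvg_tad (xcE v))).
    by apply: tcvgM; [exact: tcvg_cst|exact: xcE].
  + move=> v v01; have [_ lad _] := lL v v01.
    (* Since [tad u (x l)] is the bracket of [tad u x] with [l], its term [- x l (tad u x)] cancels
       the derivative of the first factor, and [l] comes out on the right. *)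
    have -> : (x v * tad u (x v) - u * x v) * l v =
      (x v * l v * tad u (x v) + x v * tad u (x v * l v)) - (0 * x v + u * (x v * l v)).
      rewrite mul0r add0r tadM lad /tbr mulrBr !mulrA mulrBl.
      by rewrite [in RHS]addrCA subrr addr0.
    apply: tderiveB; apply: tderiveM.
    * exact: xd.
    * exact: tderive_lin (xd v v01).
    * exact: tderive_cst.
    * exact: xd.
  + by rewrite x0 tad1 mul1r mulr1 subrr.
- apply/eqP; rewrite -subr_eq0; apply/eqP.
  apply: (@tode_eq0 (fun t => x t * dynkin (x t) - tdeg (x t)) l) => //.
  + apply/tcontE => v; apply: tcvgB; last exact: (tcvg_lin (xcE v)).
    by apply: tcvgM; [exact: xcE|exact: (tcvg_lin (xcE v))].
  + move=> v v01; have [_ lad lD] := lL v v01.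
    (* The same cancellation; the extra term [x (dynkin l)] is matched by the term [x (tdeg l)] of
       [tdeg (x l)]. *)
    have -> : (x v * dynkin (x v) - tdeg (x v)) * l v =
      (x v * l v * dynkin (x v) + x v * dynkin (x v * l v)) - tdeg (x v * l v).
      rewrite dynkinM xnil; last exact: subset_itv_oo_cc v01.
      rewrite scale1r lad lD tdegM /tbr mulrDr !mulrBr !mulrA mulrBl; tlinear.
    apply: tderiveB; last exact: tderive_lin (xd v v01).
    by apply: tderiveM; [exact: xd|exact: tderive_lin (xd v v01)].
  + by rewrite x0 dynkin1 mulr0 tdeg1 subrr.
Qed.

End LinearODE.

(** * The free nilpotent group is the group of group-like tensors *)

Section Exponential.
Variables (R : realType) (V : normedVectType R) (m : nat).
Local Notation I := 'I_(\dim {:V}).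
Local Notation T := (talg V m).
Local Notation lie := (@free_nilpotent_lie_algebra R V m).
Local Notation group := (@free_nilpotent_group R V m).
Implicit Types (a b c g h l : T) (k : nat).

Definition texpT l : T := texp l.

Lemma texpE l : texpT l = \sum_(k < m.+1) k`!%:R^-1 *: l ^+ k.
Proof. by apply: eq_bigr => k _; rewrite tpowE. Qed.

Lemma texp0 : texpT 0 = 1.
Proof.
rewrite texpE big_ord_recl expr0 fact0 invr1 scale1r big1 ?addr0// => k _.
by rewrite expr0n/= scaler0.
Qed.

(** To leading order the exponential is additive: in a power of exponent at least [2], a factor [c]
    is accompanied by at least one other factor without constant term, which raises the order beyond
    [k]. *)
Lemma texp_add_ord k l c : (0 < k)%N -> tord 1 l -> tord k c ->
  tord k.+1 (texpT (l + c) - texpT l - c).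
Proof.
move=> k0 l1 ck; have c1 : tord 1 c by exact: tordW ck.
have X j : tord k ((l + c) ^+ j - l ^+ j) /\
    ((1 < j)%N -> tord k.+1 ((l + c) ^+ j - l ^+ j)).
  elim: j => [|j [IH _]]; first by rewrite subrr; split; [exact: tord_zero|].
  have -> : (l + c) ^+ j.+1 - l ^+ j.+1 =
      ((l + c) ^+ j - l ^+ j) * l + (l + c) ^+ j * c.
    by rewrite !exprSr mulrDr mulrBl addrAC.
  have lk : tord k.+1 (((l + c) ^+ j - l ^+ j) * l).
    by rewrite -addn1; exact: tordM.
  have lcj : tord j ((l + c) ^+ j) by apply: tordX; exact: tordD.
  split; first by apply: tordD; [exact: tordW lk|exact: (tordM (tord_ge0 _) ck)].
  rewrite ltnS => j0; apply: tordD => //; rewrite -add1n.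
  by apply: tordM ck; exact: tordW lcj.
rewrite !texpE -sumrB.
(* For [m = 0] the truncated series has no linear term, but then [c = 0]. *)
case: (posnP m) => [m0|m0].
  have mk : (m < k)%N by rewrite m0.
  rewrite (tord_eq0 mk ck) subr0 addr0; apply: tord_sum => j _.
  by rewrite subrr; exact: tord_zero.
rewrite big_ord_recl expr0 subrr add0r.
rewrite (bigD1 (Ordinal m0))//= /bump/= -[1`!]/1%N invr1 !scale1r !expr1.
rewrite [l + c]addrC addrK [c + _]addrC addrK; apply: tord_sum => j j0.
rewrite -scalerBr; apply: tordZ; rewrite [c + l]addrC; apply: (X _).2.
by rewrite /bump/= add1n ltnS lt0n.
Qed.

Lemma tcoef_texp_nil l : tord 1 l -> tcoef (texpT l) [::] = 1.
Proof.
move=> l1; have := @texp_add_ord 1 0 l isT (@tord_zero _ _ m 1) l1.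
rewrite add0r texp0 => /(_ [::] isT) /eqP.
by rewrite !tcoefB (l1 [::])// tcoef1_nil subr0 subr_eq0 => /eqP.
Qed.

Lemma tderive_texp (f : R -> R) (t df : R) l : tord 1 l -> is_derive t 1 f df ->
  tderive (fun u => texpT (f u *: l)) t (texpT (f t *: l) * (df *: l)).
Proof.
move=> l1 fd s; under eq_fun do rewrite texpE tcoef_sum.
have -> : texpT (f t *: l) * (df *: l) =
    \sum_(k < m.+1) (k%:R * f t ^+ k.-1 * df) *: (k`!%:R^-1 *: l ^+ k).
  rewrite texpE big_ord_recr/= exprZn mulrDl -!scalerAl -!scalerAr.
  (* The top term of the product is [l ^+ m.+1 = 0], so differentiating the truncated series loses
     nothing. *)
  rewrite -exprSr (tord_eq0 (ltnSn m) (tordX (k := m.+1) l1)) !scaler0 addr0.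
  rewrite [RHS]big_ord_recl/= !mul0r scale0r add0r mulr_suml scaler_sumr.
  apply: eq_bigr => k _; rewrite /bump add1n/= exprZn -!scalerAl -exprSr.
  rewrite !scalerA factS natrM invfM; congr (_ *: _).
  have k0 : k.+1%:R != 0 :> R by rewrite pnatr_eq0.
  by rewrite -![_ *: df]/(_ * df) add0n; set q := k`!%:R^-1; field.
rewrite tcoef_sum; apply: is_derive_bigsum => k _.
rewrite tcoefZ.
rewrite (_ : (fun u => _) = fun u => tcoef (k`!%:R^-1 *: l ^+ k) s * f u ^+ k).
  by rewrite mulrC; exact: is_deriveZ (is_deriveXn k fd).
by apply/funext => u; rewrite exprZn !tcoefZ; ring.
Qed.

Lemma tderive_tcont (x dx : R -> T) A : (forall t, tderive x t (dx t)) -> tcont A x.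
Proof.
move=> xd s; apply: continuous_subspaceT => t.
have := xd t s => -[d _]; apply: differentiable_continuous.
exact/derivable1_diffP.
Qed.

(** With [q] replaced by [t q], both sides solve [x' = x * (q l)] with the same value at [t = 0];
    their difference vanishes by [tode_eq0]. *)
Lemma texpD (r q : R) l : tord 1 l ->
  texpT ((r + q) *: l) = texpT (r *: l) * texpT (q *: l).
Proof.
move=> l1; apply/eqP; rewrite -subr_eq0; apply/eqP.
pose F (t : R) := texpT ((r + t * q) *: l) - texpT (r *: l) * texpT ((t * q) *: l).
have Fd t : tderive F t (F t * (q *: l)).
  have qd : is_derive t 1 (fun u => u * q) q.
    have -> : (fun u : R => u * q) = q \*: id by apply/funext => u; rewrite /= mulrC.
    by apply: is_derive_eq; rewrite [_ *: _]mulr1.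
  rewrite mulrBl -mulrA; apply: tderiveB.
    by apply: tderive_texp => //; have := is_deriveD (is_derive_cst r t 1) qd; rewrite add0r.
  rewrite -[X in tderive _ _ X]add0r -[X in X + _](mul0r (texpT ((t * q) *: l))).
  by apply: tderiveM; [exact: tderive_cst|exact: tderive_texp].
rewrite -[q]mul1r -/(F 1).
apply: (@tode_eq0 _ _ _ F (cst (q *: l))) => //.
- by move=> t _; exact: tordZ.
- exact: tderive_tcont Fd.
- by rewrite /F !mul0r addr0 scale0r texp0 mulr1 subrr.
- by rewrite in_itv/= ler01 lexx.
Qed.

Lemma lie_tord l : lie l -> tord 1 l.
Proof. by case/lie_lie_like. Qed.

Lemma texp_group_like l : lie l -> group_like (texpT l).
Proof.
move=> ll; rewrite -[l]scale1r.
apply: (@tode_group_like _ _ _ (fun t => texpT (t *: l)) (cst l)); last first.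
- by rewrite in_itv/= ler01 lexx.
- split; first by rewrite scale0r texp0.
    apply: (@tderive_tcont _ (fun t => texpT (t *: l) * (1 *: l))) => t.
    by apply: tderive_texp; exact: lie_tord.
  move=> t _; rewrite -[cst l t]scale1r.
  by apply: tderive_texp; exact: lie_tord.
- by [].
Qed.

Lemma texpN l : tord 1 l -> texpT l * texpT (- l) = 1.
Proof.
move=> l1; rewrite -[X in texpT X * _]scale1r -[- l]scaleN1r -texpD//.
by rewrite subrr scale0r texp0.
Qed.

Lemma texpNl l : tord 1 l -> texpT (- l) * texpT l = 1.
Proof. by move=> l1; rewrite -[l in X in _ * X]opprK texpN//; exact: tordN. Qed.

(** If [exp l] agrees with [g] below degree [k], then [g exp(-l)] is group-like and starts in degree
    [k]. Its leading Lie polynomial is added to [l]; [texp_add_ord] takes the place of the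
    Baker-Campbell-Hausdorff formula. *)
Lemma group_like_texp g k : group_like g -> (0 < k)%N ->
  exists2 l, lie l & tord k (g - texpT l).
Proof.
move=> gG; have [g1 _ _] := gG; case: k => // k _; elim: k => [|k [l ll lk]].
  by exists 0; [exact: lie0|rewrite texp0; exact: tord_subr1].
have l1 := lie_tord ll; have Nl : lie (- l) by rewrite -scaleN1r; exact: lieZ.
pose h := g * texpT (- l).
have hG : group_like h by apply: group_likeM => //; exact: texp_group_like.
have h1 : h - 1 = (g - texpT l) * texpT (- l) by rewrite mulrBl texpN.
have hk : tord k.+1 (h - 1).
  by rewrite h1 -[k.+1]addn0; apply: tordM => //; exact: tord_ge0.
have := group_like_leadP hG (ltn0Sn k) hk.
set c := group_like_lead _ _ => hc; have ck : tord k.+1 c by exact: tord_lead.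
exists (l + c); first by apply: lieD => //; exact: lie_lead.
have -> : g - texpT (l + c) = (h - 1 - c) * texpT l + c * (texpT l - 1)
    - (texpT (l + c) - texpT l - c).
  have -> : g = h * texpT l by rewrite -mulrA texpNl// mulr1.
  rewrite !mulrBl mulrBr mul1r mulr1; tlinear.
apply: tordB; last exact: texp_add_ord.
apply: tordD; first by rewrite -[k.+2]addn0; apply: tordM => //; exact: tord_ge0.
rewrite -[k.+2]addn1; apply: tordM => //.
exact/tord_subr1/tcoef_texp_nil.
Qed.

Lemma free_nilpotent_groupP g : group g <-> group_like g.
Proof.
split=> [[l ll <-]|gG]; first exact: texp_group_like.
have [l ll lm] := group_like_texp gG (ltn0Sn m).
exists l => //; apply/esym/eqP; rewrite -subr_eq0; apply/eqP.
exact: tord_eq0 lm.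
Qed.

End Exponential.

(** * Group elements as products of exponentials of letters *)

Section LetterProducts.
Variables (R : realType) (V : normedVectType R) (m : nat).
Local Notation I := 'I_(\dim {:V}).
Local Notation T := (talg V m).
Local Notation lie := (@free_nilpotent_lie_algebra R V m).
Local Notation group := (@free_nilpotent_group R V m).
Implicit Types (a b c g h l : T) (k : nat) (s : seq I) (e : seq (R * I)).

(** For [r >= 0] this says that [|g_s| ^ (1 / |s|) <= r] for every nonempty [s], and that the
    constant term is at most [1] in absolute value: a gauge that scales with dilations and stands in
    for the norm. *)
Definition tsize (r : R) g := forall s, `|tcoef g s| <= r ^+ size s.

Lemma tsize_le r r' g : 0 <= r -> r <= r' -> tsize r g -> tsize r' g.
Proof.
move=> r0 rr gr s; apply: le_trans (gr s) _.
by apply: lerXn2r => //; rewrite nnegrE// (le_trans r0).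
Qed.

Lemma tsize1 r : 0 <= r -> tsize r 1.
Proof.
move=> r0 s; rewrite tcoef1; case: s => [|i s]; first by rewrite expr0 normr1.
by rewrite normr0 exprn_ge0.
Qed.

(** Each cut of [s] gives one term of the binomial expansion of [(r + r') ^ |s|], whose binomial
    coefficient is at least [1]. *)
Lemma tsizeM r r' g h : 0 <= r -> 0 <= r' -> tsize r g -> tsize r' h -> tsize (r + r') (g * h).
Proof.
move=> r0 r'0 gr hr s; have [sm|/tcoef_gt ->] := leqP (size s) m; last first.
  by rewrite normr0 exprn_ge0// addr_ge0.
rewrite tcoefM// exprDn; apply: le_trans (ler_norm_sum _ _ _) _.
rewrite [leRHS](reindex_inj rev_ord_inj)/=; apply: ler_sum => k _.
rewrite subSS subKn -1?ltnS// -bin_sub -1?ltnS//.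
have ks : (k <= size s)%N by rewrite -ltnS.
rewrite normrM; apply: le_trans (_ : r ^+ k * r' ^+ (size s - k) <= _).
  apply: ler_pM => //; first by rewrite -{2}(size_takel ks).
  by rewrite -size_drop.
rewrite -mulr_natr ler_peMr ?mulr_ge0 ?exprn_ge0// ler1n bin_gt0.
  by rewrite leq_subr.
by rewrite ltnS leq_subr.
Qed.

Definition lexp (p : R * I) : T := texpT (p.1 *: tlet m p.2).

Lemma letX i k : tlet m i ^+ k = tdelta m (nseq k i) :> T.
Proof.
elim: k => [|k IH]; first by rewrite expr0 tdelta_nil.
by rewrite exprS IH tdeltaM.
Qed.

Lemma tsize_lexp p : tsize `|p.1| (lexp p).
Proof.
case: p => r i s /=; have [sm|/tcoef_gt->] := leqP (size s) m; last first.
  by rewrite normr0 exprn_ge0.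
rewrite /lexp texpE tcoef_sum/=.
have sm1 : (size s < m.+1)%N by [].
rewrite (bigD1 (Ordinal sm1))//= big1 ?addr0.
  rewrite exprZn !tcoefZ letX tcoef_delta !normrM normrX normfV normr_nat.
  rewrite mulrCA ler_piMr ?exprn_ge0//.
  have f1 : (size s)`!%:R^-1 <= 1 :> R by rewrite invf_le1 ?ler1n ?ltr0n fact_gt0.
  rewrite mulr_ile1 ?invr_ge0 ?ler0n//.
  by rewrite normr_nat lern1 leq_b1.
move=> k; rewrite -val_eqE/= => ks; rewrite exprZn !tcoefZ letX tcoef_delta.
have [sE|] := eqVneq s (nseq k i); last by rewrite andbF !mulr0.
by rewrite sE size_nseq eqxx in ks.
Qed.

Lemma lie_lexp p : group_like (lexp p).
Proof. by apply: texp_group_like; apply: lieZ; exact: lie_let. Qed.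

(** A list of pairs [(c, i)] describes a polygonal path with sides [c e_i]; [levl] is its endpoint
    in the group, [llen] its length and [linv] the same path run backwards. *)
Definition levl e : T := \prod_(p <- e) lexp p.
Definition llen e : R := \sum_(p <- e) `|p.1|.
Definition linv e : seq (R * I) := rev [seq (- p.1, p.2) | p <- e].

Lemma levl_nil : levl [::] = 1. Proof. exact: big_nil. Qed.

Lemma levl_cat e e' : levl (e ++ e') = levl e * levl e'.
Proof. exact: big_cat. Qed.

Lemma levl_seq1 p : levl [:: p] = lexp p.
Proof. exact: big_seq1. Qed.

Lemma llen_ge0 e : 0 <= llen e.
Proof. exact: sumr_ge0. Qed.

Lemma llen_cat e e' : llen (e ++ e') = llen e + llen e'.
Proof. exact: big_cat. Qed.

Lemma llen_inv e : llen (linv e) = llen e.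
Proof.
rewrite /llen /linv (perm_big _ (permEl (perm_rev _))) big_map.
by apply: eq_bigr => p _; rewrite normrN.
Qed.

Lemma levl_inv e : levl e * levl (linv e) = 1 /\ levl (linv e) * levl e = 1.
Proof.
elim: e => [|p e [IH1 IH2]]; first by rewrite levl_nil mulr1.
have -> : linv (p :: e) = linv e ++ [:: (- p.1, p.2)].
  by rewrite /linv /= rev_cons cats1.
rewrite -cat1s !levl_cat !levl_seq1.
have p1 : tord 1 (p.1 *: tlet m p.2) by exact/tordZ/tord_let.
have pN : lexp (- p.1, p.2) = texpT (- (p.1 *: tlet m p.2)) by rewrite /lexp scaleNr.
split.
  by rewrite -mulrA [levl e * _]mulrA IH1 mul1r pN texpN.
by rewrite -mulrA [lexp (- _, _) * _]mulrA pN texpNl// mul1r.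
Qed.

Lemma levl_group_like e : group_like (levl e).
Proof.
rewrite /levl; elim/big_ind: _ => //; [exact: group_like1|exact: group_likeM|].
by move=> p _; exact: lie_lexp.
Qed.

Lemma tsize_levl e : tsize (llen e) (levl e).
Proof.
elim: e => [|p e IH]; first by rewrite /llen big_nil levl_nil; exact: tsize1.
rewrite /llen /levl !big_cons; apply: tsizeM => //; last exact: tsize_lexp.
exact: llen_ge0.
Qed.

Definition lcomm e e' := e ++ e' ++ linv e ++ linv e'.

Lemma llen_comm e e' : llen (lcomm e e') = 2 * (llen e + llen e').
Proof. by rewrite /lcomm !llen_cat !llen_inv; ring. Qed.

(* [u h u^-1 h^-1 - 1 = (u h - h u) u^-1 h^-1] *)
Lemma tord_comm k n a b u h u' h' : (0 < k)%N -> (0 < n)%N ->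
  u * u' = 1 -> h * h' = 1 -> tcoef u [::] = 1 -> tcoef h [::] = 1 ->
  tord k a -> tord k.+1 (u - 1 - a) -> tord n b -> tord n.+1 (h - 1 - b) ->
  tord (k + n).+1 (u * h * u' * h' - 1 - tbr a b).
Proof.
move=> k0 n0 uu hh u1 h1 ak ua bn hb.
have u'1 : tcoef u' [::] = 1.
  by have := tcoefM_nil u u'; rewrite uu u1 mul1r tcoef1_nil.
have h'1 : tcoef h' [::] = 1.
  by have := tcoefM_nil h h'; rewrite hh h1 mul1r tcoef1_nil.
set al := u - 1 - a in ua; set be := h - 1 - b in hb.
have uE : u = 1 + (a + al) by rewrite /al; tlinear.
have hE : h = 1 + (b + be) by rewrite /be; tlinear.
have comm : u * h - h * u = tbr (a + al) (b + be).
  by rewrite -[LHS]/(tbr u h) uE hE [LHS]tbrDl tbr1l add0r [LHS]tbrDr tbr1r add0r.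
have q1 : u * h * u' * h' - 1 = (u * h - h * u) * (u' * h').
  rewrite mulrBl !mulrA; congr (_ - _).
  by rewrite -[h * u * u']mulrA uu mulr1 hh.
rewrite q1 comm.
have -> : tbr (a + al) (b + be) * (u' * h') - tbr a b =
    tbr (a + al) (b + be) * (u' * h' - 1) + (tbr a be + tbr al (b + be)).
  rewrite mulrBr mulr1; set z := tbr _ _ * _.
  by rewrite tbrDl [tbr a (b + be)]tbrDr; tlinear.
have aal : tord k (a + al) by apply: tordD => //; exact: tordW ua.
have bbe : tord n (b + be) by apply: tordD => //; exact: tordW hb.
apply: tordD.
  rewrite -addn1; apply: tordM; first exact: tord_tbr.
  by apply: tord_subr1; rewrite tcoefM_nil u'1 h'1 mulr1.
apply: tordD; first by rewrite -addnS; exact: tord_tbr.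
by rewrite -addSn; exact: tord_tbr.
Qed.

Lemma tord_lexp r i : tord 2 (lexp (r, i) - 1 - r *: tlet m i).
Proof.
have := @texp_add_ord _ _ m 1 0 (r *: tlet m i) isT (@tord_zero _ _ _ 1).
by rewrite add0r texp0; apply; apply/tordZ/tord_let.
Qed.

Lemma levl_nilE e : tcoef (levl e) [::] = 1.
Proof. by case: (levl_group_like e). Qed.

Definition lbrs (r : R) e s := foldl (fun e i => lcomm e [:: (r, i)]) e s.

(** Each group commutator with [exp(r i)] brackets the leading term with [r i] and raises its degree
    by one. *)
Lemma levl_brs r k a e s : (0 < k)%N -> tord k a -> tord k.+1 (levl e - 1 - a) ->
  tord (k + size s).+1 (levl (lbrs r e s) - 1 - r ^+ size s *: tbrs a s).
Proof.
elim: s k a e => [|i s IH] k a e k0 ak ea /=; first by rewrite addn0 expr0 scale1r.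
rewrite addnS -addSn.
have -> : r ^+ (size s).+1 *: tbrs (tbr a (tlet m i)) s =
    r ^+ size s *: tbrs (tbr a (r *: tlet m i)) s.
  rewrite exprSr -scalerA; congr (_ *: _).
  by rewrite -tbrsZ /tbr -scalerAl -scalerAr scalerBr.
have l1 : tord 1 (r *: tlet m i) by exact/tordZ/tord_let.
apply: IH => //.
  by rewrite -addn1; exact: tord_tbr.
rewrite /lcomm !levl_cat !mulrA -addn1.
apply: tord_comm => //; [exact: (levl_inv _).1|exact: (levl_inv _).1|
  exact: levl_nilE|exact: levl_nilE|rewrite levl_seq1; exact: tord_lexp].
Qed.

(** A commutator with a letter takes [llen e + |r|] to [2 llen e + 3 |r|], which is at most four
    times as much. *)
Lemma llen_brs r e s : llen (lbrs r e s) <= 4 ^+ size s * (llen e + `|r|).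
Proof.
elim: s e => [|i s IH] e /=; first by rewrite expr0 mul1r lerDl.
apply: le_trans (IH _) _; rewrite exprSr -mulrA ler_pM2l ?exprn_gt0//.
rewrite llen_comm /llen big_seq1/= -/(llen e).
by have := llen_ge0 e; have := normr_ge0 r; lra.
Qed.

(** All letters get the same size [t = |c| ^ (1 / |s|)], so their nested commutator has leading
    coefficient of modulus [t ^ |s| = |c|], while its length is proportional to [t <= r]. *)
Lemma word_letters (c r : R) s : (0 < size s)%N -> 0 <= r -> `|c| <= r ^+ size s ->
  exists2 e, tord (size s).+1 (levl e - 1 - c *: dynkin_word m s) &
    llen e <= 4 ^+ size s * (r + r).
Proof.
move=> s0 r0 cr; have sR : (size s)%:R != 0 :> R by rewrite pnatr_eq0 -lt0n.
have [t [t0 tr tc]] : exists t, [/\ 0 <= t, t <= r & t ^+ size s = `|c|].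
  exists (`|c| `^ (size s)%:R^-1); split; first exact: powR_ge0.
    have E : (r ^+ size s) `^ (size s)%:R^-1 = r.
      by rewrite -powR_mulrn// -powRrM divff// powRr1.
    rewrite -[leRHS]E; apply: ge0_ler_powR => //; rewrite ?invr_ge0 ?nnegrE ?exprn_ge0//.
  by rewrite -powR_mulrn ?powR_ge0// -powRrM mulVf// powRr1.
case: s s0 cr sR tc => // i s _ _ _ tc.
(* The sign of [c] is carried by the first letter. *)
exists (lbrs t [:: (Num.sg c * t, i)] s).
  have -> : c *: dynkin_word m (i :: s) =
      t ^+ size s *: tbrs ((Num.sg c * t) *: tlet m i) s.
    rewrite /= tbrsZ scalerA; congr (_ *: _).
    by rewrite [LHS]numEsg -tc [size _]/= exprSr; ring.
  apply: (@levl_brs t 1) => //; first exact/tordZ/tord_let.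
  by rewrite levl_seq1; exact: tord_lexp.
apply: le_trans (llen_brs _ _ _) _; apply: ler_pM; rewrite ?exprn_ge0//.
- by rewrite addr_ge0// llen_ge0.
- by rewrite exprS ler_peMl ?exprn_ge0// ler1n.
- rewrite /llen big_seq1/= normrM (ger0_norm t0) lerD//.
  by rewrite (le_trans _ tr)// ler_piMl// normr_sg lern1 leq_b1.
Qed.

(** To leading order products are sums: the cross term [(x - 1) * (y - 1)] has order at least
    [k + 1]. *)
Lemma tord_prod k (J : Type) (q : seq J) (e : J -> seq (R * I)) (a : J -> T) :
  (0 < k)%N -> (forall j, tord k (a j)) ->
  (forall j, tord k.+1 (levl (e j) - 1 - a j)) ->
  tord k.+1 (levl (flatten [seq e j | j <- q]) - 1 - \sum_(j <- q) a j).
Proof.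
move=> k0 ak ea; elim: q => [|j q IH] /=.
  by rewrite levl_nil big_nil subrr subr0; exact: tord_zero.
rewrite levl_cat big_cons; set x := levl (e j); set y := levl _; set z := \sum_(i <- q) a i.
have zk : tord k z by apply: tord_sum.
have -> : x * y - 1 - (a j + z) = (x - 1 - a j) + (y - 1 - z) + (x - 1) * (y - 1).
  rewrite mulrBl !mulrBr !mul1r !mulr1; tlinear.
apply: tordD; first by apply: tordD; [exact: ea|exact: IH].
have xk : tord k (x - 1).
  by rewrite -[x - 1](subrK (a j)); apply: tordD => //; exact: tordW (ea j).
apply: (@tordW _ _ _ _ (k + 1)); first by rewrite addn1.
by apply: tordM => //; exact/tord_subr1/levl_nilE.
Qed.

(** Descending induction on [k]. Let [q] be a product of commutators with the same leading term as
    [g], one for each word of length [k], so that [llen q <= M r]. Then [g q^-1] starts in degree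
    [k + 1] and has gauge at most [r + llen q <= (1 + M) r], whence the constant [C (1 + M) + M]. *)
Lemma group_like_letters_ord k : (0 < k)%N -> exists2 C : R, 0 <= C &
  forall g r, group_like g -> tord k (g - 1) -> 0 <= r -> tsize r g ->
    exists2 e, g = levl e & llen e <= C * r.
Proof.
move=> k0; have [n] := ubnP (m.+1 - k); elim: n k k0 => // n IH k k0; rewrite ltnS => kn.
have [mk|km] := ltnP m k.
  exists 0 => // g r _ gk _ _; exists [::]; last by rewrite /llen big_nil mul0r.
  by rewrite levl_nil; apply/eqP; rewrite -subr_eq0; apply/eqP; exact: tord_eq0 gk.
have [C C0 HC] : exists2 C : R, 0 <= C &
    forall g r, group_like g -> tord k.+1 (g - 1) -> 0 <= r -> tsize r g ->
    exists2 e, g = levl e & llen e <= C * r.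
  by apply: IH => //; rewrite (leq_trans _ kn)// subSS subSn.
pose M : R := #|{: word V m}|%:R * (4 ^+ k * 2).
have M0 : 0 <= M by rewrite !mulr_ge0// exprn_ge0.
exists (C * (1 + M) + M); first by rewrite addr_ge0// mulr_ge0// addr_ge0.
move=> g r gG gk r0 gr; have [g1 _ _] := gG.
have /choice[e eP] (w : word V m) : exists e : seq (R * I),
    tord k.+1 (levl e - 1 - (if size w == k then (k%:R^-1 * g w) *: dynkin_word m w else 0)) /\
    llen e <= 4 ^+ k * (r + r).
  have [wk|wk] := eqVneq (size w) k; last first.
    exists [::]; rewrite levl_nil subrr subr0 /llen big_nil; split; first exact: tord_zero.
    by rewrite mulr_ge0 ?exprn_ge0// addr_ge0.
  have [||e e1 e2] := @word_letters (k%:R^-1 * g w) r w _ r0.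
  - by rewrite wk.
  - rewrite wk normrM -wk -tcoefE; apply: le_trans (gr w).
    by rewrite ler_piMl// normfV normr_nat invf_le1 ?ler1n ?ltr0n wk.
  - by rewrite wk in e1 e2; exists e.
pose q := flatten [seq e w | w <- enum {: word V m}].
have qk : tord k.+1 (levl q - 1 - group_like_lead k g).
  rewrite /group_like_lead big_mkcond/= -big_enum/=.
  apply: tord_prod => // [w|w]; last exact: (eP w).1.
  case: eqP => [wk|_]; last exact: tord_zero.
  by apply: tordZ; rewrite -{1}wk; exact: tord_dynkin_word.
have qlen : llen q <= M * r.
  rewrite /q /M cardE; elim: (enum _) => [|w ws IHw] /=.
    by rewrite /llen big_nil !mul0r.
  rewrite llen_cat -natr1 mulrDl mul1r [leRHS]mulrDl addrC; apply: lerD => //.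
  have -> : 4 ^+ k * 2 * r = 4 ^+ k * (r + r) by ring.
  exact: (eP w).2.
have qr : 0 <= llen q := llen_ge0 q.
have [qq1 qq2] := levl_inv q.
have [||||e' e'E e'len] := HC (g * levl (linv q)) (r + llen q).
- by apply: group_likeM => //; exact: levl_group_like.
- have -> : g * levl (linv q) - 1 = (g - levl q) * levl (linv q) by rewrite mulrBl qq1.
  rewrite -[k.+1]addn0; apply: tordM; last exact: tord_ge0.
  have -> : g - levl q = (g - 1 - group_like_lead k g) - (levl q - 1 - group_like_lead k g).
    by tlinear.
  by apply: tordB => //; exact: group_like_leadP.
- by rewrite addr_ge0.
- apply: tsizeM => //; rewrite -llen_inv; exact: tsize_levl.
exists (e' ++ q); first by rewrite levl_cat -e'E -mulrA qq2 mulr1.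
rewrite llen_cat; apply: le_trans (lerD e'len qlen) _.
rewrite [leRHS]mulrDl lerD2r -mulrA ler_wpM2l// mulrDl mul1r lerD2l//.
Qed.

Lemma group_like_letters : exists2 C : R, 0 <= C &
  forall g r, group_like g -> 0 <= r -> tsize r g ->
    exists2 e, g = levl e & llen e <= C * r.
Proof.
have [C C0 H] := group_like_letters_ord (ltn0Sn 0).
exists C => // g r gG r0 gr; apply: H => //.
by apply: tord_subr1; case: gG.
Qed.

End LetterProducts.

(** * Equivalence of homogeneous norms *)

Section Dilation.
Variables (R : realType) (V : normedVectType R) (m : nat).
Local Notation I := 'I_(\dim {:V}).
Local Notation T := (talg V m).
Local Notation lie := (@free_nilpotent_lie_algebra R V m).
Local Notation group := (@free_nilpotent_group R V m).
Implicit Types (a b c g h l : T) (k : nat) (s : seq I) (t : R).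

Definition tdil t a : T := dilation t a.

Lemma tcoef_dil t a s : tcoef (tdil t a) s = t ^+ size s * tcoef a s.
Proof.
by rewrite /tcoef; case: ifP => sm; rewrite ?mulr0// ffunE val_insub_bseq.
Qed.

Fact tdil_is_linear t : linear (tdil t).
Proof.
by move=> r a b; apply: tcoefP => s _; rewrite !(tcoefD,tcoefZ,tcoef_dil) mulrDr mulrCA.
Qed.

HB.instance Definition _ t := GRing.isLinear.Build R T T _ (tdil t) (tdil_is_linear t).

Fact tdil_is_monoid_morphism t : monoid_morphism (tdil t).
Proof.
split=> [|a b]; apply: tcoefP => s sm.
  by rewrite tcoef_dil !tcoef1; case: s {sm} => [|i s]; rewrite ?mul1r ?mulr0.
rewrite tcoef_dil !tcoefM// mulr_sumr; apply: eq_bigr => k _.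
have ks : (k <= size s)%N by rewrite -ltnS.
rewrite !tcoef_dil size_drop size_takel// -{1}(subnKC ks) exprD; ring.
Qed.

HB.instance Definition _ t :=
  GRing.isMonoidMorphism.Build T T (tdil t) (tdil_is_monoid_morphism t).

Lemma tdil_tbr t a b : tdil t (tbr a b) = tbr (tdil t a) (tdil t b).
Proof. by rewrite /tbr rmorphB !rmorphM. Qed.

Lemma tdil_tvec t v : tdil t (tvec m v) = tvec m (t *: v).
Proof.
apply/ffunP => w; rewrite !ffunE; case: (bseqval w) => [|i [|j s]].
- by rewrite mulr0.
- by rewrite linearZ.
- by rewrite mulr0.
Qed.

Lemma lie_dil t l : lie l -> lie (tdil t l).
Proof.
move=> /(_ (fun a : tensor V m => lie (tdil t a))); apply; split; last first.
  by move=> _ [v _ <-]; rewrite tdil_tvec; exact: lie_tvec.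
split.
- by rewrite linear0; exact: lie0.
- by move=> r a b la lb; rewrite linearP; exact: lieP.
- by move=> a b la lb; rewrite tdil_tbr; exact: lie_br.
Qed.

Lemma tdil_texp t l : tdil t (texpT l) = texpT (tdil t l).
Proof.
rewrite !texpE linear_sum; apply: eq_bigr => k _.
by rewrite linearZ/= rmorphXn.
Qed.

Lemma group_dil t g : group g -> group (tdil t g).
Proof. by move=> [l ll <-]; exists (tdil t l); [exact: lie_dil|exact/esym/tdil_texp]. Qed.

Lemma tdil_let t i : tdil t (tlet m i) = t *: tlet m i.
Proof.
apply: tcoefP => s _; rewrite tcoef_dil tcoefZ tcoef_delta.
by have [->|] := eqVneq s [:: i]; rewrite ?expr1// andbF !mulr0.
Qed.

Lemma group1 : group (1 : T).
Proof. exact/free_nilpotent_groupP/group_like1. Qed.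

Lemma groupM g h : group g -> group h -> group (g * h).
Proof.
move=> /free_nilpotent_groupP gG /free_nilpotent_groupP hG.
exact/free_nilpotent_groupP/group_likeM.
Qed.

Lemma groupV g : group g -> group (tinv g).
Proof. by move=> /free_nilpotent_groupP gG; exact/free_nilpotent_groupP/group_likeV. Qed.

Lemma group_nil g : group g -> tcoef g [::] = 1.
Proof. by case/free_nilpotent_groupP. Qed.

Lemma group_mulV g : group g -> g * (tinv g : T) = 1.
Proof. by move/group_nil/tmulV. Qed.

Lemma group_mulVl g : group g -> (tinv g : T) * g = 1.
Proof. by move/group_nil/tmulVl. Qed.

Lemma group_levl e : group (levl m e).
Proof. exact/free_nilpotent_groupP/levl_group_like. Qed.

Lemma tinvM g h : group g -> group h -> tinv (g * h) = (tinv h : T) * (tinv g : T).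
Proof.
move=> gG hG; apply: tinv_unique; first exact/group_nil/groupM.
by rewrite -mulrA [h * _]mulrA group_mulV// mul1r group_mulV.
Qed.

Lemma tinvK g : group g -> tinv (tinv g) = g.
Proof.
move=> gG; apply: tinv_unique; last exact: group_mulVl.
exact/group_nil/groupV.
Qed.

Lemma tinv1 : tinv (1 : T) = 1 :> T.
Proof. by apply: tinv_unique; rewrite ?mulr1 ?tcoef1_nil. Qed.

Lemma group_cvg (S : Type) (F : set_system S) (f : S -> T) a :
  ProperFilter F -> tcvg F f a -> (\forall u \near F, group (f u)) -> group a.
Proof.
move=> FF fa fG; apply/free_nilpotent_groupP; apply: (group_like_cvg FF fa).
by apply: filterS fG => u /free_nilpotent_groupP.
Qed.

End Dilation.

Section HomogeneousNorm.
Variables (R : realType) (V : normedVectType R) (m : nat).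
Local Notation I := 'I_(\dim {:V}).
Local Notation T := (talg V m).
Local Notation group := (@free_nilpotent_group R V m).
Variable N : tensor V m -> R.
Hypothesis hN : homogeneous_norm N.
Implicit Types (a b c g h l : T) (k : nat) (s : seq I) (t r : R).

Lemma hnorm1 : N (1 : T) = 0.
Proof. by apply/(hnorm_eq0 hN) => //; exact: group1. Qed.

(** The exponential of [c] times a letter is the dilation by [c] of the exponential of the letter,
    also for negative [c]. *)
Lemma hnorm_lexp p : N (lexp m p) = `|p.1| * N (lexp m (1, p.2)).
Proof.
case: p => c i /=; have gl := group_levl m [:: (1, i)]; rewrite levl_seq1 in gl.
rewrite -(hnorm_dilation hN)//; congr N.
by rewrite -[RHS]/(tdil c (texpT (1 *: tlet m i))) tdil_texp linearZ/= tdil_let scale1r.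
Qed.

Definition letter_norm : R := \sum_(i : I) N (lexp m (1, i)).

Lemma letter_norm_ge0 : 0 <= letter_norm.
Proof.
by apply: sumr_ge0 => i _; apply: (hnorm_ge0 hN); rewrite -levl_seq1; exact: group_levl.
Qed.

Lemma hnorm_lexp_le p : N (lexp m p) <= letter_norm * `|p.1|.
Proof.
rewrite hnorm_lexp mulrC ler_wpM2r// /letter_norm (bigD1 p.2)//= lerDl.
by apply: sumr_ge0 => i _; apply: (hnorm_ge0 hN); rewrite -levl_seq1; exact: group_levl.
Qed.

Lemma hnorm_levl e : N (levl m e) <= letter_norm * llen e.
Proof.
elim: e => [|p e IH]; first by rewrite levl_nil hnorm1 /llen big_nil mulr0.
rewrite /levl /llen !big_cons mulrDr.
apply: le_trans (lerD (hnorm_lexp_le p) IH); apply: (hnorm_mul hN).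
  by rewrite -levl_seq1; exact: group_levl.
exact: group_levl.
Qed.

(** Upper half of the equivalence with the gauge: [N] is subadditive along a decomposition into
    letters, whose total length is at most a multiple of the gauge. *)
Lemma hnorm_le_tsize : exists2 C : R, 0 <= C &
  forall g r, group g -> 0 <= r -> tsize r g -> N g <= C * r.
Proof.
have [C C0 H] := group_like_letters V m.
exists (letter_norm * C); first by rewrite mulr_ge0// letter_norm_ge0.
move=> g r /free_nilpotent_groupP gG r0 gr; have [e -> el] := H g r gG r0 gr.
by apply: le_trans (hnorm_levl e) _; rewrite -mulrA ler_wpM2l// letter_norm_ge0.
Qed.

Lemma tsize_small g r : tcoef g [::] = 1 -> 0 <= r -> r <= 1 ->
  (forall s, `|tcoef g s - tcoef (1 : T) s| <= r ^+ m) -> tsize r g.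
Proof.
move=> g1 r0 r1 gr s; have [sm|/tcoef_gt->] := leqP (size s) m; last first.
  by rewrite normr0 exprn_ge0.
case: s sm => [|i s] sm; first by rewrite g1 expr0 normr1.
have := gr (i :: s); rewrite tcoef1 subr0 => /le_trans; apply.
by apply: ler_wiXn2l.
Qed.

(** Continuity of [N] at the unit, which is not among the axioms. For [r <= 1] and [|s| <= m] a
    deviation of at most [r ^ m] is at most [r ^ |s|], so the gauge is at most [r]. *)
Lemma hnorm_small (e : R) : 0 < e -> exists2 d : R, 0 < d &
  forall g, group g -> (forall s, `|tcoef g s - tcoef (1 : T) s| <= d) -> N g <= e.
Proof.
move=> e0; have [C C0 H] := hnorm_le_tsize.
pose r := Num.min 1 (e / (C + 1)).
have C1 : 0 < C + 1 by rewrite ltr_wpDl.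
have r0 : 0 < r by rewrite lt_min ltr01 divr_gt0.
exists (r ^+ m); first exact: exprn_gt0.
move=> g gG gr; apply: le_trans (H g r gG (ltW r0) _) _.
  by apply: tsize_small => //; [exact: group_nil|exact: ltW|rewrite ge_min lexx].
apply: (@le_trans _ _ ((C + 1) * r)); first by rewrite ler_wpM2r ?lerDl// ltW.
by rewrite mulrC -ler_pdivlMr// ge_min lexx orbT.
Qed.

Lemma tcvg_near (S : Type) (F : set_system S) (f : S -> T) a (d : R) :
  Filter F -> tcvg F f a -> 0 < d ->
  \forall u \near F, forall s, `|tcoef (f u) s - tcoef a s| <= d.
Proof.
move=> FF fa d0.
have : \forall u \near F, forall w : word V m, `|tcoef (f u) w - tcoef a w| <= d.
  apply: filter_forall => w; have /cvgrPdist_le/(_ d d0) := fa w.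
  by apply: filterS => u; rewrite distrC.
apply: filterS => u H s; have [sm|sm] := leqP (size s) m; last first.
  by rewrite !tcoef_gt// subrr normr0 ltW.
by have := H (insub_bseq m s); rewrite val_insub_bseq.
Qed.

Lemma hnorm_dist g h : group g -> group h -> `|N g - N h| <= N ((tinv h : T) * g).
Proof.
move=> gG hG; have hV := groupV hG; have gV := groupV gG.
rewrite ler_distl; apply/andP; split.
  rewrite lerBlDr; have : N ((tinv g : T) * h) = N ((tinv h : T) * g).
    by rewrite -(hnorm_inv hN) ?tinvM ?tinvK//; exact: groupM.
  move=> <-.
  apply: le_trans (hnorm_mul hN gG (groupM gV hG)).
  by rewrite -[tmul _ _]/(g * (_ * _)) mulrA group_mulV// mul1r.
apply: le_trans (hnorm_mul hN hG (groupM hV gG)).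
by rewrite -[tmul _ _]/(h * (_ * _)) mulrA group_mulV// mul1r.
Qed.

Lemma hnorm_cvg (S : Type) (F : set_system S) (f : S -> T) a :
  ProperFilter F -> tcvg F f a -> (\forall u \near F, group (f u)) ->
  N (f u) @[u --> F] --> N a.
Proof.
move=> FF fa fG; have aG := group_cvg FF fa fG.
apply/cvgrPdist_le => e e0; have [d d0 H] := hnorm_small e0.
have fV : tcvg F (fun u => (tinv a : T) * f u) 1.
  by rewrite -(group_mulVl aG); apply: tcvgM => //; exact: tcvg_cst.
near=> u; rewrite distrC; apply: le_trans (hnorm_dist _ aG) _; first by near: u.
apply: H; first by apply: groupM; [exact: groupV|near: u].
by near: u; exact: tcvg_near.
Unshelve. all: by end_near. Qed.

(** Compactness: were there no bound, elements with [N] tending to [0] would have a limit [a] in the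
    group with [N a = 0] and [|a_w| = 1]. But then [a = 1], whose coefficient at the nonempty word
    [w] is [0]. *)
Lemma hnorm_sphere (w : word V m) : (0 < size w)%N -> exists2 c : R, 0 < c &
  forall g, group g -> (forall w' : word V m, `|g w'| <= 1) -> `|g w| = 1 -> c <= N g.
Proof.
move=> w0; apply: contrapT => H.
have /choice[u uP] (n : nat) : exists g, [/\ group g, forall w' : word V m, `|g w'| <= 1,
    `|g w| = 1 & N g <= n.+1%:R^-1].
  apply: contrapT => nP; apply: H; exists n.+1%:R^-1; first by rewrite invr_gt0.
  move=> g gG g1 gw; rewrite leNgt; apply/negP => Ng; apply: nP.
  by exists g; split => //; exact: ltW.
have [G PG [oG Gb]] := ultrafilter_nat R.
have /choice[b bP] (w' : word V m) : exists l : R, u n w' @[n --> G] --> l.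
  by apply: (Gb _ 1) => n; case: (uP n).
pose a : T := [ffun w' => b w'].
have Ga : tcvg G u a.
  move=> s; have [sm|sm] := leqP (size s) m; last first.
    by rewrite tcoef_gt//; under eq_fun do rewrite tcoef_gt//; exact: cvg_cst.
  by rewrite /tcoef sm ffunE; exact: bP.
have GG : \forall n \near G, group (u n) by apply: oG; exists 0%N => // n _; case: (uP n).
have aG := group_cvg PG Ga GG.
have aw : `|a w| = 1.
  have G1 : (`|tcoef (u n) w| @[n --> G] --> (1 : R)).
    apply: cvg_near_cst; apply: oG; exists 0%N => // n _.
    by rewrite /= tcoefE; case: (uP n).
  have G2 : `|tcoef (u n) w| @[n --> G] --> `|a w|.
    by rewrite -tcoefE; apply: cvg_norm; exact: Ga.
  exact: cvg_unique G2 G1.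
have Na : N a = 0.
  have NG := hnorm_cvg PG Ga GG.
  have N0 : N (u n) @[n --> G] --> (0 : R).
    apply/cvgrPdist_le => e e0; have := oG _ (near_infty_natSinv_lt (PosNum e0)).
    apply: filterS => n /= ne; have [gG _ _ Nn] := uP n.
    rewrite sub0r normrN ger0_norm; last exact: (hnorm_ge0 hN).
    by apply: le_trans Nn _; exact: ltW.
  exact: cvg_unique NG N0.
have := (hnorm_eq0 hN aG).1 Na => a1; move: aw; rewrite a1 ffunE eqn0Ngt w0.
by rewrite normr0 => /eqP; rewrite eq_sym oner_eq0.
Qed.

(** Lower half of the equivalence. With [r] the maximum of [|g_w| ^ (1 / |w|)] over nonempty words,
    the dilation of [g] by [r^-1] has coefficients at most [1], with equality at a maximising word.
    The sphere bound for that word and homogeneity give [r <= C N g]. *)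
Lemma tsize_hnorm : exists2 C : R, 0 <= C & forall g, group g -> tsize (C * N g) g.
Proof.
have /choice[c cP] (w : word V m) : exists c : R, 0 < c /\ ((0 < size w)%N ->
    forall g, group g -> (forall w' : word V m, `|g w'| <= 1) -> `|g w| = 1 -> c <= N g).
  have [w0|_] := ltnP 0 (size w); last by exists 1.
  by have [c c0 H] := hnorm_sphere w0; exists c.
pose C := \sum_(w : word V m) (c w)^-1.
have cC w : (c w)^-1 <= C.
  rewrite /C (bigD1 w)//= lerDl; apply: sumr_ge0 => w' _.
  by rewrite invr_ge0 ltW; case: (cP w').
have C0 : 0 <= C by apply: sumr_ge0 => w _; rewrite invr_ge0 ltW; case: (cP w).
exists C => // g gG.
(* The case [g = 1] is set apart, as [r] would be [0] and could not be divided out. *)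
have [g1|/existsNP[w0 /not_implyP[w00 gw0]]] :=
    pselect (forall w : word V m, (0 < size w)%N -> g w = 0).
  have -> : g = 1.
    apply/ffunP => w; rewrite -[RHS](tcoefE (1 : T)) tcoef1 -(tcoefE g).
    case wE : (bseqval w) => [|i s] /=; first exact: group_nil.
    by rewrite -wE tcoefE g1// wE.
  by rewrite hnorm1 mulr0; exact: tsize1.
pose q (w : word V m) := `|g w| `^ (size w)%:R^-1.
have [w1 w10 w1P] : exists2 w1 : word V m, (0 < size w1)%N &
    forall w : word V m, (0 < size w)%N -> q w <= q w1.
  have [w1 w10 w1P] := @arg_maxP _ R (word V m) w0 (fun w => 0 < size w)%N q w00.
  by exists w1.
set r := q w1 in w1P.
have sR (w : word V m) : (0 < size w)%N -> (size w)%:R != 0 :> R.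
  by rewrite pnatr_eq0 -lt0n.
have qX (w : word V m) : (0 < size w)%N -> q w ^+ size w = `|g w|.
  by move=> w_0; rewrite -powR_mulrn ?powR_ge0// -powRrM mulVf ?sR// powRr1.
have r0 : 0 < r.
  by apply: lt_le_trans (w1P _ w00); rewrite powR_gt0// normr_gt0; exact/eqP.
have gr (w : word V m) : `|g w| <= r ^+ size w.
  case w_0 : (size w) => [|k].
    by rewrite expr0 -tcoefE; move/size0nil: w_0 => ->; rewrite group_nil// normr1.
  rewrite -qX ?w_0//; apply: lerXn2r; rewrite ?nnegrE ?powR_ge0//.
  by apply: w1P; rewrite w_0.
have hE (w : word V m) : tdil r^-1 g w = r ^- size w * g w.
  by rewrite ffunE exprVn.
have c1 := (cP w1).2 w10 (tdil r^-1 g) (group_dil _ gG).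
have Nr : c w1 <= r^-1 * N g.
  have := hnorm_dilation hN r^-1 gG; rewrite (ger0_norm (_ : 0 <= r^-1)); last first.
    by rewrite invr_ge0 ltW.
  move=> <-; apply: c1 => [w'|].
    rewrite hE normrM normfV normrX (gtr0_norm r0) mulrC ler_pdivrMr ?exprn_gt0//.
    by rewrite mul1r.
  rewrite hE normrM normfV normrX (gtr0_norm r0) -qX// mulVf//.
  by rewrite expf_neq0// gt_eqF.
have rC : r <= C * N g.
  have : r <= (c w1)^-1 * N g.
    by have [cw _] := cP w1; rewrite ler_pdivlMl// mulrC -ler_pdivlMl.
  by move=> /le_trans; apply; rewrite ler_wpM2r//; exact: (hnorm_ge0 hN).
apply: (@tsize_le _ _ _ r) => //; first exact: ltW.
move=> s; have [sm|/tcoef_gt->] := leqP (size s) m; last first.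
  by rewrite normr0 exprn_ge0// ltW.
by have := gr (insub_bseq m s); rewrite -tcoefE val_insub_bseq.
Qed.

End HomogeneousNorm.

(** * A flat smooth step *)

Section SmoothStep.
Variable R : realType.
Implicit Types (f g : R -> R) (t x : R) (k : nat).

Lemma is_derive1P (W : normedModType R) (f : R -> W) t d :
  is_derive t 1 f d <-> h^-1 *: (f (t + h) - f t) @[h --> 0^'] --> d.
Proof.
have E : (fun h : R => h^-1 *: ((f \o shift t) (h *: 1) - f t)) =
    (fun h => h^-1 *: (f (t + h) - f t)).
  by apply/funext => h /=; rewrite [h%:A]mulr1 [h + t]addrC.
split=> [[fd <-]|fd].
  by rewrite /derive E; move: fd; rewrite /derivable E.
by split; [rewrite /derivable E; apply: cvgP fd|rewrite /derive E; exact: cvg_lim].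
Qed.

(** The powers [x ^- k] are included because differentiating [exp(- 1 / x)] produces them; the span
    of this family is closed under derivatives. *)
Definition flat k x := if 0 < x then x ^- k * expR (- x^-1) else 0.

(** The term of degree [k + 1] of the exponential series at [1 / x] is a lower bound for
    [exp(1 / x)]. *)
Lemma flat_le k x : `|flat k x| <= k.+1`!%:R * `|x|.
Proof.
rewrite /flat; case: ifPn => [x0|_]; last by rewrite normr0 mulr_ge0.
have xk0 : 0 < x ^+ k by exact: exprn_gt0.
rewrite ger0_norm ?mulr_ge0 ?expR_ge0 ?invr_ge0 ?(ltW xk0)// (gtr0_norm x0).
have C0 : 0 < k.+1`!%:R :> R by rewrite ltr0n fact_gt0.
have xV : 0 <= x^-1 by rewrite invr_ge0 ltW.
have E : x^-1 ^+ k.+1 / k.+1`!%:R <= expR x^-1.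
  by apply: le_trans (expR_ge1Dxn k xV); rewrite lerDr.
rewrite expRN -invfM -[leLHS]mul1r ler_pdivrMr ?mulr_gt0 ?expR_gt0// mulrA.
have D0 : 0 <= k.+1`!%:R * x * x ^+ k by rewrite !mulr_ge0 ?ltW.
apply: le_trans (ler_wpM2l D0 E); rewrite le_eqVlt; apply/orP; left; apply/eqP.
by rewrite exprVn exprS; field; rewrite !gt_eqF.
Qed.

Lemma flat_cvg0 k : flat k x @[x --> 0^'] --> 0.
Proof.
apply/cvgrPdist_le => e e0; near=> x; rewrite sub0r normrN.
apply: le_trans (flat_le k x) _; rewrite mulrC -ler_pdivlMr ?ltr0n ?fact_gt0//.
near: x; apply: dnbhs0_le; rewrite divr_gt0// ltr0n fact_gt0//.
Unshelve. all: by end_near. Qed.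

Lemma is_derive_flat k x : is_derive x 1 (flat k) (flat k.+2 x - k%:R * flat k.+1 x).
Proof.
have [x0|x0|->] := ltrgt0P x.
- apply: (@near_eq_is_derive _ _ _ (fun x => x ^- k * expR (- x^-1))).
    near=> y; rewrite /flat ifT//; near: y; exact: lt_nbhsr.
  rewrite /flat x0.
  have x_neq0 : x != 0 by rewrite gt_eqF.
  have d1 : is_derive x 1 (fun y : R => y ^+ k) (k%:R * x ^+ k.-1 * 1).
    exact: (is_deriveXn k (is_derive_id x 1)).
  have d2 := @is_deriveV R (fun y => y ^+ k) x _ 1 (expf_neq0 k x_neq0) d1.
  have d3 := @is_deriveV R id x _ 1 x_neq0 (is_derive_id x 1).
  have d4 := is_derive1_comp (is_derive_expR _) (is_deriveN d3).
  apply: (is_derive_eq (is_deriveM d2 d4)).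
  rewrite /= -![_ *: _]/(_ * _) /=; set E := expR _.
  case: k {d1 d2} => [|k]; first by rewrite /=; field.
  by rewrite /= !exprS; field; rewrite x_neq0 expf_neq0.
- apply: (@near_eq_is_derive _ _ _ (cst 0)).
    near=> y; rewrite /flat ifF//; apply/negbTE; rewrite -leNgt; apply: ltW; near: y.
    exact: lt_nbhsl.
  by rewrite /flat !ltNge (ltW x0)/= mulr0 subrr; exact: is_derive_cst.
(* At [0] the difference quotient is [flat k.+1] itself, which tends to [0]. *)
- have -> : flat k.+2 0 - k%:R * flat k.+1 0 = 0 :> R by rewrite /flat ltxx mulr0 subrr.
  apply/is_derive1P; apply: cvg_trans (flat_cvg0 k.+1).
  apply: near_eq_cvg; apply: nearW => h; rewrite add0r.
  rewrite /flat ltxx subr0; case: ifP => h0; last by rewrite scaler0.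
  by rewrite -[_ *: _]/(_ * _) exprS invfM mulrA.
Unshelve. all: by end_near. Qed.

(* This class is closed under differentiation, so its members are smooth: this
   avoids computing the iterated derivatives of the smooth step. *)
Inductive elementary : (R -> R) -> Prop :=
| elementary_flat k (r q : R) : elementary (fun t => flat k (r * t + q))
| elementary_scale (r : R) f : elementary f -> elementary (fun t => r * f t)
| elementary_add f g : elementary f -> elementary g -> elementary (fun t => f t + g t)
| elementary_mul f g : elementary f -> elementary g -> elementary (fun t => f t * g t)
| elementary_inv f : elementary f -> (forall t, f t != 0) ->
    elementary (fun t => (f t)^-1).

Lemma elementary_derive f : elementary f ->
  exists2 g, elementary g & forall t, is_derive t 1 f (g t).
Proof.
elim=> {f} [k r q|r f _ [f' f'E fd]|f g _ [f' f'E fd] _ [g' g'E gd]|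
    f g fE [f' f'E fd] gE [g' g'E gd]|f fE [f' f'E fd] f0].
- exists (fun t => r * (flat k.+2 (r * t + q) + - k%:R * flat k.+1 (r * t + q))).
    apply/elementary_scale/elementary_add; first exact: elementary_flat.
    exact/elementary_scale/elementary_flat.
  move=> t; have rd : is_derive t 1 (fun t => r * t + q) r.
    have := is_deriveD (is_deriveZ r (is_derive_id t 1)) (is_derive_cst q t 1).
    by rewrite addr0 [_ *: _]mulr1.
  by apply: (is_derive_eq (is_derive1_comp (is_derive_flat _ _) rd)); ring.
- exists (fun t => r * f' t); first exact: elementary_scale.
  by move=> t; exact: (is_deriveZ r (fd t)).
- exists (fun t => f' t + g' t); first exact: elementary_add.
  by move=> t; exact: (is_deriveD (fd t) (gd t)).
- exists (fun t => f t * g' t + g t * f' t).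
    by apply: elementary_add; exact: elementary_mul.
  by move=> t; exact: (is_deriveM (fd t) (gd t)).
- exists (fun t => - 1 * ((f t * f t)^-1 * f' t)).
    apply/elementary_scale/elementary_mul => //; apply: elementary_inv.
      exact: elementary_mul.
    by move=> t; rewrite mulf_neq0.
  move=> t; apply: (is_derive_eq (is_deriveV (f0 t) (fd t))).
  by rewrite -[_ *: _]/(_ * _); rewrite mulN1r mulNr.
Qed.

Lemma elementary_smooth f : elementary f -> exists D : nat -> R -> R, D 0%N = f /\
  forall k t, is_derive t 1 (D k) (D k.+1 t).
Proof.
move=> fE; have /choice[next nextP] (g : {g | elementary g}) :
    exists g' : {g | elementary g}, forall t, is_derive t 1 (sval g) (sval g' t).
  by case: g => g gE; have [g' g'E gd] := elementary_derive gE; exists (exist _ g' g'E).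
by exists (fun k => sval (iter k next (exist _ f fE))).
Qed.

Lemma flat0_homo : {homo flat 0 : x y / x <= y}.
Proof.
move=> x y xy; rewrite /flat; case: ifPn => x0; case: ifPn => y0 //.
- by rewrite !invr1 !mul1r ler_expR lerN2 lef_pV2.
- by have := lt_le_trans x0 xy; rewrite (negbTE y0).
- by rewrite invr1 mul1r expR_ge0.
Qed.

Lemma flat0_gt0 x : (0 < flat 0 x) = (0 < x).
Proof. by rewrite /flat; case: ifP => x0; rewrite ?ltxx// invr1 mul1r expR_gt0. Qed.

(** The quotient [f / (f + g)], with [f] flat up to [a] and [g] flat from [b] on; since [a < b], one
    of the two is positive at every point. *)
Lemma smooth_step (a b : R) : a < b -> exists phi : R -> R, exists D : nat -> R -> R,
  [/\ D 0%N = phi, forall k t, is_derive t 1 (D k) (D k.+1 t),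
    {homo phi : s t / s <= t},
    forall t, t <= a -> phi t = 0 /\ D 1%N t = 0 &
    forall t, b <= t -> phi t = 1 /\ D 1%N t = 0].
Proof.
move=> ab.
pose f t := flat 0 (1 * t + - a); pose g t := flat 0 (-1 * t + b).
have f0 t : 0 <= f t by rewrite /f /flat; case: ifP => _ //; rewrite invr1 mul1r expR_ge0.
have g0 t : 0 <= g t by rewrite /g /flat; case: ifP => _ //; rewrite invr1 mul1r expR_ge0.
have fg0 t : 0 < f t + g t.
  have [ta|ta] := ltP a t.
    by rewrite ltr_wpDr// /f flat0_gt0 mul1r subr_gt0.
  by rewrite ltr_wpDl// /g flat0_gt0 mulN1r addrC subr_gt0 (le_lt_trans ta).
pose phi t := f t * (f t + g t)^-1.
have phiE : elementary phi.
  apply: elementary_mul; first exact: elementary_flat.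
  apply: elementary_inv; first by apply: elementary_add; exact: elementary_flat.
  by move=> t; rewrite gt_eqF.
have [D [D0 Dd]] := elementary_smooth phiE.
have fa t : t <= a -> f t = 0.
  by move=> ta; rewrite /f /flat ifF//; apply/negbTE; rewrite -leNgt mul1r subr_le0.
have gb t : b <= t -> g t = 0.
  by move=> bt; rewrite /g /flat ifF//; apply/negbTE; rewrite -leNgt mulN1r addrC subr_le0.
have phi_ge0 t : 0 <= phi t by rewrite mulr_ge0// invr_ge0 ltW.
have phi_le1 t : phi t <= 1 by rewrite ler_pdivrMr// mul1r lerDl.
have phia t : t <= a -> phi t = 0 by move=> ta; rewrite /phi fa// mul0r.
have phib t : b <= t -> phi t = 1.
  move=> bt; rewrite /phi gb// addr0 divff// gt_eqF//.
  by have := fg0 t; rewrite gb// addr0.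
have phid t u : t \in `]t - 1, t + 1[ -> u \in `]t - 1, t + 1[ -> derivable phi u 1.
  by move=> _ _; have := Dd 0%N u; rewrite D0 => -[].
have tt t : t \in `]t - 1, t + 1[ by rewrite in_itv/= ltrBlDr ltrDl ltr01.
have t11 t : t - 1 <= t + 1 by rewrite lerD2l; lra.
exists phi, D; split=> //.
(* Cross-multiplication reduces monotonicity to [f s * g t <= f t * g s]. *)
- move=> s t st; rewrite /phi ler_pdivrMr// mulrAC ler_pdivlMr//.
  have fst : f s <= f t by apply: flat0_homo; rewrite lerD2r !mul1r.
  have gst : g t <= g s by apply: flat0_homo; rewrite lerD2r !mulN1r lerN2.
  rewrite !mulrDr [f t * f s]mulrC lerD2l; apply: ler_pM => //.
- move=> t ta; split; first exact: phia.
  (* [phi] attains its minimum at [t], so its derivative vanishes there, also at [t = a] where [phi]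
     is not locally constant. *)
  have H := derive1_at_min (t11 t) (fun u => phid t u (tt t)) (tt t).
  have [|_ d0] := H; first by move=> u _; rewrite (phia t ta).
  have := Dd 0%N t; rewrite D0 => -[_ <-]; exact: d0.
- move=> t bt; split; first exact: phib.
  have H := derive1_at_max (t11 t) (fun u => phid t u (tt t)) (tt t).
  have [|_ d0] := H; first by move=> u _; rewrite (phib t bt).
  have := Dd 0%N t; rewrite D0 => -[_ <-]; exact: d0.
Qed.

End SmoothStep.

(** * Smooth paths reaching a given group element *)

Section Blocks.
Variables (R : realType) (V : normedVectType R) (m : nat).
Local Notation I := 'I_(\dim {:V}).
Local Notation T := (talg V m).
Local Notation group := (@free_nilpotent_group R V m).
Variable N : tensor V m -> R.
Hypothesis hN : homogeneous_norm N.
Implicit Types (a b c s t : R) (D : nat -> R -> V) (x : R -> T) (l : R -> R).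

Lemma tvecP r (u v : V) : tvec m (r *: u + v) = r *: (tvec m u : T) + tvec m v.
Proof.
apply/ffunP => w; rewrite !ffunE; case: (bseqval w) => [|i [|j s]].
- by rewrite scaler0 addr0.
- by rewrite linearP.
- by rewrite scaler0 addr0.
Qed.

Lemma tvecD (u v : V) : tvec m (u + v) = (tvec m u : T) + tvec m v.
Proof. by rewrite -[u in LHS]scale1r tvecP scale1r. Qed.

Lemma tvec0 : tvec m 0 = 0 :> T.
Proof. by have := tvecP (-1) 0 0; rewrite scaler0 addr0 scaleN1r addNr. Qed.

Lemma tvecZ r (v : V) : tvec m (r *: v) = r *: (tvec m v : T).
Proof. by rewrite -[r *: v]addr0 tvecP tvec0 addr0. Qed.

Lemma tord_tvec (v : V) : tord 1 (tvec m v : T).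
Proof. by apply: lie_tord; exact: lie_tvec. Qed.

Lemma is_derive_mulr (f : R -> R) t d c : is_derive t 1 f d ->
  is_derive t 1 (fun u => f u * c) (d * c).
Proof.
move=> fd; have -> : (fun u => f u * c) = c \*: f.
  by apply/funext => u; exact: mulrC.
by rewrite mulrC; exact: is_deriveZ.
Qed.

Lemma is_derive_scale (phi : R -> R) t d (v : V) : is_derive t 1 phi d ->
  is_derive t 1 (fun u => phi u *: v) (d *: v).
Proof.
move=> /is_derive1P pd; apply/is_derive1P.
under eq_fun do rewrite -scalerBl scalerA.
apply: cvgZ; last exact: cvg_cst.
exact: pd.
Qed.

(* [x] is the signature of the smooth path [D 0], which moves only on [[a, b]],
   and [l] is its running length. *)
Record block a b D x l : Prop := Block {
  block_smooth : forall k t, is_derive t 1 (D k) (D k.+1 t) ;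
  block_out : forall t, t <= a \/ b <= t -> D 1%N t = 0 ;
  block_derive : forall t, tderive x t (x t * tvec m (D 1%N t)) ;
  block_start : forall t, t <= a -> x t = 1 ;
  block_end : forall t, b <= t -> x t = x b ;
  block_group : forall t, group (x t) ;
  block_len_start : forall t, t <= a -> l t = 0 ;
  block_len_end : forall t, b <= t -> l t = l b ;
  block_len : forall s t, s <= t -> N ((tinv (x s) : T) * x t) <= l t - l s }.

Lemma block_len_homo a b D x l : block a b D x l -> {homo l : s t / s <= t}.
Proof.
move=> B s t st; rewrite -subr_ge0; apply: le_trans (block_len B st).
by apply: (hnorm_ge0 hN); apply: groupM; [apply: groupV|]; exact: block_group B _.
Qed.

Lemma block_cst a b : block a b (fun _ => cst 0) (cst 1) (cst 0).
Proof.
split=> //.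
- by move=> k t; exact: is_derive_cst.
- by move=> t; rewrite tvec0 mulr0; exact: tderive_cst.
- by move=> t; exact: group1.
- by move=> s t _ /=; rewrite tinv1 mulr1 (hnorm1 hN) subrr.
Qed.

(** Concatenation becomes a pointwise sum of paths and a pointwise product of signatures. The
    product rule asks [x'] to commute with the velocity of the first block: before [b] one has
    [x' = 1], and after [b] that velocity is [0]. *)
Lemma block_cat a b c D D' x x' l l' : a <= b -> b <= c ->
  block a b D x l -> block b c D' x' l' ->
  block a c (fun k t => D k t + D' k t) (fun t => x t * x' t) (fun t => l t + l' t).
Proof.
move=> ab bc B B'; have [Bs Bo Bd B1 Be Bg Bl1 Ble Bl] := B.
have [Bs' Bo' Bd' B1' Be' Bg' Bl1' Ble' Bl'] := B'.
split.
- by move=> k t; exact: is_deriveD (Bs k t) (Bs' k t).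
- move=> t [ta|ct]; rewrite Bo ?Bo' ?addr0//.
  + by left; exact: le_trans ab.
  + by left.
  + by right.
  + by right; exact: le_trans ct.
- move=> t; have -> : x t * x' t * tvec m (D 1%N t + D' 1%N t) =
      x t * tvec m (D 1%N t) * x' t + x t * (x' t * tvec m (D' 1%N t)).
    rewrite tvecD mulrDr -!mulrA; congr (_ + _).
    have [tb|/ltW bt] := leP t b; first by rewrite B1'// mul1r mulr1.
    by rewrite Bo ?tvec0 ?mul0r ?mulr0//; right.
  exact: tderiveM.
- by move=> t ta; rewrite B1// B1' ?mul1r// (le_trans ta).
- by move=> t ct; rewrite Be ?(le_trans bc)// [x c]Be// Be'.
- by move=> t; exact: groupM.
- by move=> t ta; rewrite Bl1// Bl1' ?addr0// (le_trans ta).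
- by move=> t ct; rewrite Ble ?(le_trans bc)// [l c]Ble// Ble'.
- move=> s t st; have gV := fun u => groupV (Bg u).
  have [tb|bt] := leP t b.
    rewrite B1' ?mulr1 ?(le_trans st)// B1'// mulr1 !Bl1' ?addr0 ?(le_trans st)//.
    exact: Bl.
  have [sb|bs] := leP s b; last first.
    rewrite [x s]Be ?(ltW bs)// [x t]Be ?(ltW bt)// [l s]Ble ?(ltW bs)// [l t]Ble ?(ltW bt)//.
    rewrite tinvM// mulrA -[_ * _ * x b]mulrA group_mulVl// mulr1.
    have -> : l b + l' t - (l b + l' s) = l' t - l' s by ring.
    exact: Bl'.
  rewrite [x' s]B1'// mulr1 [x t]Be ?(ltW bt)// [l' s]Bl1'// addr0 mulrA.
  have -> : l t + l' t - l s = (l b - l s) + (l' t - l' b).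
    by rewrite [l t]Ble ?(ltW bt)// [l' b]Bl1'//; ring.
  apply: le_trans (hnorm_mul hN (groupM (gV s) (Bg b)) (Bg' t)) _.
  apply: lerD; first exact: Bl.
  have := Bl' _ _ (ltW bt).
  by rewrite [x' b]B1'// tinv1 mul1r.
Qed.

(** The segment [c e_i] run with the clock [phi]. Its signature stays in a one-parameter subgroup
    and [phi] is monotone, so a multiple of [phi] serves as running length. *)
Lemma block_lexp a b (p : R * I) : a < b -> exists D x l,
  [/\ block a b D x l, x b = lexp m p & l b = letter_norm N * `|p.1|].
Proof.
case: p => c i ab; have [phi [D [D0 Dd ph pha phb]]] := smooth_step ab.
have l1 : tord 1 (tlet m i : T) by exact: tord_let.
have lE t : texpT ((phi t * c) *: tlet m i) = lexp m (phi t * c, i) by [].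
have lG r : group (lexp m (r, i) : T) by rewrite -levl_seq1; exact: group_levl.
exists (fun k t => (D k t * c) *: (vbasis {:V})`_i).
exists (fun t => texpT ((phi t * c) *: tlet m i)).
exists (fun t => letter_norm N * `|c| * phi t).
split; last 2 first.
- by have [-> _] := phb b (lexx b); rewrite mul1r.
- by have [-> _] := phb b (lexx b); rewrite mulr1.
split.
- by move=> k t; apply: is_derive_scale; exact: is_derive_mulr.
- by move=> t [/pha[_ ->]|/phb[_ ->]]; rewrite mul0r scale0r.
- move=> t; rewrite tvecZ tvec_basis; apply: tderive_texp => //.
  by apply: is_derive_mulr; rewrite -D0.
- by move=> t /pha[-> _]; rewrite mul0r scale0r texp0.
- by move=> t /phb[-> _]; have [-> _] := phb b (lexx b).
- by move=> t; rewrite lE.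
- by move=> t /pha[-> _]; rewrite mulr0.
- by move=> t /phb[-> _]; have [-> _] := phb b (lexx b).
- move=> s t st; have -> : (tinv (texpT ((phi s * c) *: tlet m i)) : T) =
      texpT ((- (phi s * c)) *: tlet m i).
    apply: tinv_unique; first by rewrite lE; exact: group_nil.
    by rewrite -texpD// subrr scale0r texp0.
  rewrite -texpD//; apply: le_trans (hnorm_lexp_le hN (_, i)) _.
  rewrite -[(_, i).1]/(- (phi s * c) + phi t * c).
  rewrite -mulrBr -mulrA ler_wpM2l ?letter_norm_ge0//.
  have -> : - (phi s * c) + phi t * c = c * (phi t - phi s) by ring.
  by rewrite normrM [X in _ * X]ger0_norm// subr_ge0 ph.
Qed.

Lemma block_levl a b (e : seq (R * I)) : a < b -> exists D x l,
  [/\ block a b D x l, x b = levl m e & l b = letter_norm N * llen e].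
Proof.
elim: e a => [|p e IH] a ab.
  exists (fun _ => cst 0), (cst 1), (cst 0); split; first exact: block_cst.
    by rewrite levl_nil.
  by rewrite /llen big_nil mulr0.
(* Each letter uses the first half of the interval that is left. *)
have [am mb] := midf_lt ab.
have [D [x [l [B xb lb]]]] := block_lexp p am.
have [D' [x' [l' [B' xb' lb']]]] := IH _ mb.
exists (fun k t => D k t + D' k t), (fun t => x t * x' t), (fun t => l t + l' t).
split; first by apply: block_cat B B'; exact: ltW.
- by rewrite (block_end B (ltW mb)) xb xb' /levl big_cons.
- by rewrite (block_len_end B (ltW mb)) lb lb' /llen big_cons mulrDr.
Qed.

End Blocks.

(** * Variation and control functions *)

Section PartitionSums.
Variable R : realType.
Implicit Types (f g : R -> R -> R) (W : R -> R) (s : seq R) (a b t : R).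

Fixpoint psum f a s : R := if s is b :: s' then f a b + psum f b s' else 0.

Lemma psumE f a z s : psum f a s =
  \sum_(0 <= i < size s) f (nth z (a :: s) i) (nth z (a :: s) i.+1).
Proof.
elim: s a => [|b s IH] a /=; first by rewrite big_nil.
by rewrite big_nat_recl//= IH.
Qed.

Lemma psum_rcons f a s b : psum f a (rcons s b) = psum f a s + f (last a s) b.
Proof. by elim: s a => [|c s IH] a /=; rewrite ?add0r ?addr0// IH addrA. Qed.

Lemma psum_le f g a s : (forall b c, a <= b -> b <= c -> c <= last a s -> f b c <= g b c) ->
  path <%R a s -> psum f a s <= psum g a s.
Proof.
elim: s a => //= b s IH a fg /andP[ab bs].
have bl : b <= last b s.
  have H : itv_partition b (last b s) s by split.
  exact: itv_partition_le H.
apply: lerD; first by apply: fg => //; exact: ltW.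
by apply: IH => // c d bc; apply: fg; rewrite (le_trans (ltW ab)).
Qed.

Lemma psum_telescope W a s : psum (fun b c => W c - W b) a s = W (last a s) - W a.
Proof. by elim: s a => [|b s IH] a /=; rewrite ?subrr// IH; ring. Qed.

Lemma psum_control f W s : (forall a b, 0 <= a -> a <= b -> b <= 1 -> f a b <= W b - W a) ->
  itv_partition 0 1 s -> psum f 0 s <= W 1 - W 0.
Proof.
move=> fW [ps /eqP l1]; rewrite -[in W 1]l1 -psum_telescope; apply: psum_le => //.
by move=> b c b0 bc; rewrite l1; exact: fW.
Qed.

(* [W t] is the supremum of the sums of [f] along partitions of [[0, t]]; with
   [f] the [p]-th power of the increments it turns finite [p]-variation into a
   bound by the increments of a function of one variable. *)
Lemma psum_control_exists f (M : R) :
  (forall a b, 0 <= a -> a <= b -> b <= 1 -> 0 <= f a b) ->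
  (forall a, 0 <= a -> a <= 1 -> f a a = 0) ->
  (forall s, itv_partition 0 1 s -> psum f 0 s <= M) ->
  exists W, [/\ forall a b, 0 <= a -> a <= b -> b <= 1 -> f a b <= W b - W a,
    W 0 = 0 & W 1 <= M].
Proof.
move=> f0 ff fM.
pose S t := [set psum f 0 s | s in itv_partition 0 t].
have S_nonempty t : 0 <= t -> S t !=set0.
  rewrite le_eqVlt => /predU1P[<-|t0]; first by exists 0, [::].
  by exists (psum f 0 [:: t]), [:: t] => //; exact: itv_partition1.
have SM t : 0 <= t -> t <= 1 -> ubound (S t) M.
  move=> t0 t1 _ [s [ps /eqP ls] <-]; have [tE|tne] := eqVneq t 1.
    by apply: fM; split => //; rewrite ls tE.
  (* A partition of [[0, t]] becomes one of [[0, 1]] by adding the point [1], which can only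
     increase the sum. *)
  have {}t1 : t < 1 by rewrite lt_neqAle tne.
  apply: le_trans (fM (rcons s 1) _).
    by rewrite psum_rcons lerDl ls; apply: f0 => //; exact: ltW.
  by split; rewrite ?rcons_path ?ps ?ls ?last_rcons.
have S_sup t : 0 <= t -> t <= 1 -> has_sup (S t).
  by move=> t0 t1; split; [exact: S_nonempty|exists M; exact: SM].
exists (fun t => sup (S t)); split.
- move=> a b a0; rewrite le_eqVlt => /predU1P[<-|ab] b1; first by rewrite subrr ff.
  have a1 : a <= 1 by rewrite (le_trans (ltW ab)).
  rewrite lerBrDr addrC -lerBrDr; apply: ge_sup; first exact: S_nonempty.
  move=> _ [s [ps /eqP ls] <-]; rewrite lerBrDr; apply: ub_le_sup.
    by exists M; apply: SM => //; rewrite (le_trans a0)// ltW.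
  exists (rcons s b); first by split; rewrite ?rcons_path ?ps ?ls ?last_rcons.
  by rewrite psum_rcons ls.
- have -> : S 0 = [set 0]; last exact: sup1.
  apply/seteqP; split => [_ [s /itv_partitionxx -> <-]//|_ ->].
  by exists [::].
- by apply: ge_sup; [exact: S_nonempty|exact: SM].
Qed.

End PartitionSums.

Section Variation.
Variables (R : realType) (V : normedVectType R) (m : nat).
Local Notation T := (talg V m).
Local Notation group := (@free_nilpotent_group R V m).
Variable N : tensor V m -> R.
Hypothesis hN : homogeneous_norm N.
Implicit Types (x y : R -> T) (r : R) (W : R -> R).

Definition group_valued x := forall t, 0 <= t -> t <= 1 -> group (x t).

Definition tincr x (s t : R) : T := (tinv (x s) : T) * x t.

Lemma group_incr x s t : group_valued x -> 0 <= s -> s <= 1 -> 0 <= t -> t <= 1 ->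
  group (tincr x s t).
Proof.
by move=> xG s0 s1 t0 t1; apply: groupM; [apply: groupV|]; exact: xG.
Qed.

Lemma hdist1 g : group g -> hdist N g (1 : T) = N g.
Proof.
move=> gG; rewrite /hdist -[tmul _ _]/((tinv g : T) * 1) mulr1.
exact: (hnorm_inv hN).
Qed.

Lemma var_dist_le x y r W : 0 < r ->
  (forall s t, 0 <= s -> s <= t -> t <= 1 ->
    hdist N (tincr x s t) (tincr y s t) `^ r <= W t - W s) ->
  (var_dist N r x y <= ((W 1 - W 0) `^ r^-1)%:E)%E.
Proof.
move=> r0 H; apply: ge_ereal_sup => _ [s ps <-]; rewrite lee_fin.
have := psum_control H ps; set S := psum _ _ _ => SW.
rewrite /= (_ : \sum_(0 <= i < size s) _ = S); last by rewrite /S (psumE _ _ 1).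
have S0 : 0 <= S.
  rewrite /S (psumE _ _ 1); apply: sumr_ge0 => i _; exact: powR_ge0.
by apply: ge0_ler_powR => //; rewrite ?invr_ge0 ?nnegrE ?(ltW r0)// (le_trans S0).
Qed.

Lemma hnorm_incr_one x s t : group_valued x -> 0 <= s -> s <= 1 -> 0 <= t -> t <= 1 ->
  hdist N (tincr x s t) (tincr (cst (1 : T)) s t) = N (tincr x s t).
Proof.
move=> xG s0 s1 t0 t1; rewrite {2}/tincr /= tinv1 mulr1 hdist1//.
exact: group_incr.
Qed.

Lemma var_norm_le x r W : 0 < r -> group_valued x ->
  (forall s t, 0 <= s -> s <= t -> t <= 1 -> N (tincr x s t) `^ r <= W t - W s) ->
  (var_norm N r x <= ((W 1 - W 0) `^ r^-1)%:E)%E.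
Proof.
move=> r0 xG H; apply: var_dist_le => // s t s0 st t1.
rewrite (hnorm_incr_one xG)//; first exact: H.
- exact: le_trans t1.
- exact: le_trans st.
Qed.

Lemma incr_xx x t : group_valued x -> 0 <= t -> t <= 1 -> tincr x t t = 1.
Proof. by move=> xG t0 t1; rewrite /tincr group_mulVl//; exact: xG. Qed.

Lemma var_norm_psum x r s : group_valued x -> itv_partition 0 1 s -> 0 < r ->
  (((psum (fun a b => N (tincr x a b) `^ r) 0 s) `^ r^-1)%:E <= var_norm N r x)%E.
Proof.
move=> xG ps r0; apply: ereal_sup_ubound; exists s => //.
congr (_ `^ _)%:E; rewrite (psumE _ _ 1); apply: eq_big_nat => i /andP[_ si].
have ge0 j : (j < (size s).+1)%N -> 0 <= nth 1 (0 :: s) j.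
  by move=> js; exact: (itv_partition_nth_ge js ps).
have le1 j : (j < (size s).+1)%N -> nth 1 (0 :: s) j <= 1.
  by move=> js; exact: (itv_partition_nth_le js ps).
by rewrite -(hnorm_incr_one xG)//; [apply: ge0|apply: le1|apply: ge0|apply: le1];
  rewrite ltnS// ltnW.
Qed.

Lemma var_norm_control x r : 0 < r -> group_valued x -> (var_norm N r x < +oo)%E ->
  exists W, (forall s t, 0 <= s -> s <= t -> t <= 1 -> N (tincr x s t) `^ r <= W t - W s) /\
    W 0 = 0.
Proof.
move=> r0 xG xfin.
pose v := fine (var_norm N r x).
have vE : (var_norm N r x <= v%:E)%E.
  move: xfin; rewrite /v; case: (var_norm N r x) => [z||] //= _; exact: leNye.
have [|||W [WH W0 _]] := @psum_control_exists R (fun a b => N (tincr x a b) `^ r) (v `^ r).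
- by move=> a b *; exact: powR_ge0.
- by move=> a a0 a1; rewrite incr_xx// (hnorm1 hN) powR0// gt_eqF.
- move=> s ps; have := le_trans (var_norm_psum xG ps r0) vE; rewrite lee_fin.
  set S := psum _ _ _ => Sv; have S0 : 0 <= S.
    rewrite /S (psumE _ _ 1); apply: sumr_ge0 => i _; exact: powR_ge0.
  have -> : S = (S `^ r^-1) `^ r by rewrite -powRrM mulVf ?powRr1// gt_eqF.
  apply: ge0_ler_powR => //; rewrite ?nnegrE ?powR_ge0 ?(ltW r0)//.
  by apply: le_trans Sv; exact: powR_ge0.
by exists W.
Qed.

End Variation.

(** * Smooth approximation along a grid *)

Section Approximation.
Variables (R : realType) (V : normedVectType R) (m : nat).
Local Notation I := 'I_(\dim {:V}).
Local Notation T := (talg V m).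
Local Notation group := (@free_nilpotent_group R V m).
Variable N : tensor V m -> R.
Hypothesis hN : homogeneous_norm N.

Lemma powR_pred (r p : R) : 0 <= r -> 1 <= p -> r `^ (p - 1) * r = r `^ p.
Proof.
move=> r0 p1; have p0 : p != 0 by rewrite gt_eqF// (lt_le_trans ltr01).
move: r0; rewrite le_eqVlt => /predU1P[<-|r0]; first by rewrite mulr0 powR0.
rewrite -[X in _ * X](powRr1 (ltW r0)) -powRD ?subrK//.
by apply/implyP => _; rewrite gt_eqF.
Qed.

(** Three terms, for an interval cut at two grid points. Each of them is at most the maximum, which
    explains the factor [3 ^ p]. *)
Lemma powR_sum3 (a b c p : R) : 0 <= a -> 0 <= b -> 0 <= c -> 0 <= p ->
  (a + b + c) `^ p <= 3 `^ p * (a `^ p + b `^ p + c `^ p).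
Proof.
move=> a0 b0 c0 p0; pose M := Num.max a (Num.max b c).
have M0 : 0 <= M by rewrite le_max a0.
apply: (@le_trans _ _ ((3 * M) `^ p)).
  apply: ge0_ler_powR; rewrite ?nnegrE ?addr_ge0 ?mulr_ge0//.
  have aM : a <= M by rewrite le_max lexx.
  have bM : b <= M by rewrite !le_max lexx orbT.
  have cM : c <= M by rewrite !le_max lexx !orbT.
  lra.
rewrite powRM// ler_wpM2l ?powR_ge0// /M.
have ap := powR_ge0 a p; have bp := powR_ge0 b p; have cp := powR_ge0 c p.
by case: (leP a) => _; [case: (leP b) => _|]; lra.
Qed.

Lemma group_letters_hnorm : exists2 K : R, 0 <= K & forall g : T, group g ->
  exists2 e, g = levl m e & letter_norm N * llen e <= K * N g.
Proof.
have [C C0 HC] := group_like_letters V m; have [C' C'0 HC'] := tsize_hnorm hN.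
exists (letter_norm N * C * C'); first by rewrite !mulr_ge0// letter_norm_ge0.
move=> g gG; have [|e ge el] := HC _ _ ((free_nilpotent_groupP g).1 gG) _ (HC' g gG).
  by rewrite mulr_ge0// (hnorm_ge0 hN).
by exists e => //; rewrite -!mulrA ler_wpM2l// letter_norm_ge0.
Qed.

(** The constant is chosen before the interval and the group element; this makes the later bounds
    independent of the mesh. *)
Lemma block_group_element : exists2 K : R, 0 <= K &
  forall (a b : R) (g : T), a < b -> group g -> exists D x l,
    [/\ block N a b D x l, x b = g & l b <= K * N g].
Proof.
have [K K0 HK] := group_letters_hnorm; exists K => // a b g ab gG.
have [e -> el] := HK g gG; have [D [x [l [B xb lb]]]] := block_levl hN e ab.
by exists D, x, l; split=> //; rewrite lb.
Qed.

Variables (n : nat) (K : R).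
Hypothesis K0 : 0 <= K.
Hypothesis HK : forall (a b : R) (g : T), a < b -> group g -> exists D x l,
  [/\ block N a b D x l, x b = g & l b <= K * N g].
Variables (p : R) (Y : R -> T).
Hypothesis p1 : 1 <= p.
Hypothesis Y0 : Y 0 = 1.
Hypothesis YG : group_valued Y.

Let p0 : 0 <= p. Proof. exact: le_trans ler01 p1. Qed.

Definition grid (i : nat) : R := i%:R / n.+1%:R.

Lemma grid0 : grid 0 = 0. Proof. exact: mul0r. Qed.

Lemma grid_last : grid n.+1 = 1. Proof. by rewrite /grid divff. Qed.

Lemma grid_ge0 i : 0 <= grid i. Proof. by rewrite divr_ge0. Qed.

Lemma le_grid i j : (i <= j)%N -> grid i <= grid j.
Proof. by move=> ij; rewrite ler_pM2r ?invr_gt0// ler_nat. Qed.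

Lemma lt_grid i : grid i < grid i.+1.
Proof. by rewrite ltr_pM2r ?invr_gt0// ltr_nat. Qed.

Lemma grid_le1 i : (i <= n.+1)%N -> grid i <= 1.
Proof. by move=> /le_grid; rewrite grid_last. Qed.

Let dY i := tincr Y (grid i) (grid i.+1).

Lemma group_grid_incr i : (i < n.+1)%N -> group (dY i).
Proof.
move=> ni; apply: group_incr => //; rewrite ?grid_ge0 ?grid_le1//.
exact: ltnW.
Qed.

(** [E] controls the [p]-variation inside cells. If the block of cell [i] has length [l_i], then [(l
    t - l s) ^ p <= l_i ^ (p - 1) (l t - l s)], because [p >= 1]; so [E] adds up the running lengths
    with weights [l_i ^ (p - 1)], and its total is the sum of the [l_i ^ p]. *)
Lemma approx_path : exists D x l E,
  [/\ block N 0 1 D x l,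
      forall j, (j <= n.+1)%N -> x (grid j) = Y (grid j),
      forall j t, (j < n.+1)%N -> grid j <= t -> t <= grid j.+1 ->
        N ((tinv (Y (grid j)) : T) * x t) <= K * N (dY j),
      {homo E : s t / s <= t} /\ E 1 - E 0 <= \sum_(0 <= i < n.+1) (K * N (dY i)) `^ p &
      forall j s t, (j < n.+1)%N -> grid j <= s -> s <= t -> t <= grid j.+1 ->
        N (tincr x s t) `^ p <= E t - E s].
Proof.
have /choice[z zP] (i : nat) : exists z : (nat -> R -> V) * (R -> T) * (R -> R),
    (i < n.+1)%N -> [/\ block N (grid i) (grid i.+1) z.1.1 z.1.2 z.2,
      z.1.2 (grid i.+1) = dY i & z.2 (grid i.+1) <= K * N (dY i)].
  have [ni|//] := ltnP i n.+1; last by exists (fun _ => cst 0, cst 1, cst 0).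
  have [D [x [l H]]] := HK (lt_grid i) (group_grid_incr ni).
  by exists (D, x, l).
pose D i := (z i).1.1; pose x i := (z i).1.2; pose l i := (z i).2.
have zB i : (i < n.+1)%N -> block N (grid i) (grid i.+1) (D i) (x i) (l i) by move=> /zP[].
have zx i t : (i < n.+1)%N -> grid i.+1 <= t -> x i t = dY i.
  by move=> ni it; rewrite (block_end (zB i ni) it); case: (zP i ni).
pose X k t := \prod_(0 <= i < k) x i t.
pose DD k j t := \sum_(0 <= i < k) D i j t.
pose L k t := \sum_(0 <= i < k) l i t.
have XB k : (k <= n.+1)%N -> block N 0 (grid k) (DD k) (X k) (L k).
  elim: k => [_|k IH kn].
    rewrite grid0 (_ : DD 0%N = (fun _ => cst 0)); last first.
      by apply/funext => j; apply/funext => t; rewrite /DD big_geq.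
    rewrite (_ : X 0%N = cst 1); last by apply/funext => t; rewrite /X big_geq.
    rewrite (_ : L 0%N = cst 0); last by apply/funext => t; rewrite /L big_geq.
    exact: block_cst.
  have := block_cat hN (grid_ge0 k) (ltW (lt_grid k)) (IH (ltnW kn)) (zB k kn).
  congr (block N 0 (grid k.+1) _ _ _).
  - by apply/funext => j; apply/funext => t; rewrite /DD big_nat_recr.
  - by apply/funext => t; rewrite /X big_nat_recr.
  - by apply/funext => t; rewrite /L big_nat_recr.
(* Past [grid k] the first [k] blocks are complete, and the product of the increments of [Y]
   telescopes. *)
have XY k t : (k <= n.+1)%N -> grid k <= t -> X k t = Y (grid k).
  elim: k => [|k IH] kn kt; first by rewrite /X big_geq// grid0 Y0.
  have kt' : grid k <= t by rewrite (le_trans _ kt)// ltW// lt_grid.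
  rewrite /X big_nat_recr//= -/(X k t) IH ?(ltnW kn)// zx// /dY /tincr mulrA.
  by rewrite group_mulV ?mul1r//; apply: YG; rewrite ?grid_ge0 ?grid_le1// ltnW.
have Xj j t : (j < n.+1)%N -> grid j <= t -> t <= grid j.+1 ->
    X n.+1 t = Y (grid j) * x j t.
  move=> jn jt tj; rewrite /X (big_cat_nat (n := j)) ?(ltnW jn)//=.
  rewrite -/(X j t) XY ?(ltnW jn)// [X in _ * X]big_ltn// [X in _ * (_ * X)]big1_seq ?mulr1//.
  move=> i; rewrite mem_index_iota => /andP[_ /andP[ji i_n]].
  by apply: (block_start (zB i i_n)); rewrite (le_trans tj)// le_grid.
have YGj j : (j < n.+1)%N -> group (Y (grid j)).
  by move=> jn; apply: YG; rewrite ?grid_ge0 ?grid_le1// ltnW.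
have L_ge0 i : (i < n.+1)%N -> 0 <= l i (grid i.+1).
  move=> i_n; rewrite -(block_len_start (zB i i_n) (lexx _)).
  by apply: (block_len_homo hN (zB i i_n)); rewrite ltW ?lt_grid.
pose E t := \sum_(0 <= i < n.+1) l i (grid i.+1) `^ (p - 1) * l i t.
have XBn := XB n.+1 (leqnn _); rewrite grid_last in XBn.
exists (DD n.+1), (X n.+1), (L n.+1), E; split.
- exact: XBn.
- case=> [_|j jn]; first by rewrite grid0 (block_start XBn)// Y0.
  rewrite (Xj j)// ?(ltW (lt_grid j))// zx// /dY /tincr mulrA group_mulV ?mul1r//.
  exact: YGj.
- move=> j t jn jt tj; rewrite (Xj j)// mulrA group_mulVl ?mul1r; last exact: YGj.
  have [B _ lK] := zP j jn; apply: le_trans lK.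
  have := block_len B jt; rewrite (block_start B (lexx _)) tinv1 mul1r.
  rewrite (block_len_start B (lexx _)) subr0 => /le_trans; apply.
  exact: (block_len_homo hN B).
- split.
    move=> s t st; apply: ler_sum_nat => i /andP[_ i_n]; rewrite ler_wpM2l ?powR_ge0//.
    exact: (block_len_homo hN (zB i i_n)).
  rewrite /E -sumrB; apply: ler_sum_nat => i /andP[_ i_n].
  have B := zB i i_n; have [_ _ lK] := zP i i_n.
  rewrite (block_len_end B (grid_le1 i_n)) (block_len_start B (grid_ge0 i)) mulr0 subr0.
  rewrite powR_pred ?L_ge0//; apply: ge0_ler_powR; rewrite ?nnegrE ?L_ge0//.
  exact: le_trans (L_ge0 i i_n) lK.
- move=> j s t jn js st tj; have B := zB j jn.
  have H := block_len_homo hN.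
  apply: (@le_trans _ _ (l j (grid j.+1) `^ (p - 1) * (l j t - l j s))).
    have ls0 : 0 <= l j t - l j s by rewrite subr_ge0; exact: H B _ _ st.
    have -> : tincr (X n.+1) s t = (tinv (x j s) : T) * x j t.
      rewrite /tincr (Xj j s)// ?(le_trans st)// (Xj j t)// ?(le_trans js)//.
      rewrite tinvM; [|exact: YGj|exact: block_group B _].
      by rewrite mulrA -[_ * _ * Y _]mulrA group_mulVl ?mulr1//; exact: YGj.
    apply: (@le_trans _ _ ((l j t - l j s) `^ p)).
      have NB := block_len B st.
      have N0 : 0 <= N ((tinv (x j s) : T) * x j t).
        by apply: (hnorm_ge0 hN); apply: groupM; [apply: groupV|]; exact: block_group B _.
      by apply: ge0_ler_powR; rewrite ?nnegrE.
    rewrite -powR_pred// ler_wpM2r//; apply: ge0_ler_powR; rewrite ?nnegrE ?subr_ge0 ?L_ge0//.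
      exact: H B _ _ st.
    rewrite -[leRHS]subr0; apply: lerB; first exact: H B _ _ tj.
    by rewrite -(block_len_start B (lexx _)); exact: H B _ _ js.
  rewrite /E -sumrB (big_cat_nat (n := j)) ?(ltnW jn)//= [X in _ <= _ + X]big_ltn//.
  rewrite mulrBr -[leLHS]add0r -[leLHS]addr0 -addrA; apply: lerD; [|rewrite lerD2l];
    rewrite big_nat_cond; apply: sumr_ge0 => i /andP[/andP[ji i_n] _];
    rewrite subr_ge0 ler_wpM2l ?powR_ge0//; apply: (H _ _ _ _ _ (zB i _)) => //.
  exact: ltn_trans jn.
Qed.

Variable W : R -> R.
Hypothesis YW : forall s t, 0 <= s -> s <= t -> t <= 1 -> N (tincr Y s t) `^ p <= W t - W s.

(** An interval meeting several cells is cut at the first grid point [u] after [s] and the last one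
    [v] before [t]. The outer pieces are controlled by [E], the middle one by [W], as [x] and [Y]
    agree on the grid. The step function [W (grid (idx t))] increases by at least [W v - W u], so
    [3 ^ p] times its sum with [E] is a control. *)
Lemma approx_path_control : exists D x l W',
  [/\ block N 0 1 D x l,
      forall j t, (j < n.+1)%N -> grid j <= t -> t <= grid j.+1 ->
        N ((tinv (Y (grid j)) : T) * x t) <= K * N (dY j),
      forall s t, 0 <= s -> s <= t -> t <= 1 -> N (tincr x s t) `^ p <= W' t - W' s &
      W' 1 - W' 0 <= 3 `^ p * (K `^ p + 1) * (W 1 - W 0)].
Proof.
have [D [x [l [E [B xY xj [Eh E1] Ej]]]]] := approx_path.
exists D, x, l.
have Wh s t : 0 <= s -> s <= t -> t <= 1 -> W s <= W t.
  by move=> s0 st t1; rewrite -subr_ge0; apply: le_trans (YW s0 st t1); exact: powR_ge0.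
pose idx (t : R) := Num.truncn (t * n.+1%:R).
have idxP t : 0 <= t -> grid (idx t) <= t /\ t < grid (idx t).+1.
  move=> t0; have t0n : 0 <= t * n.+1%:R by rewrite mulr_ge0.
  have /andP[] := truncn_itv t0n.
  by rewrite /grid ler_pdivrMr// ltr_pdivlMr.
have idx_le t : t <= 1 -> (idx t <= n.+1)%N.
  move=> t1; rewrite /idx -[leqRHS](@natrK R) //; apply: le_truncn.
  by rewrite ler_piMl.
have idx_homo s t : s <= t -> (idx s <= idx t)%N.
  by move=> st; apply: le_truncn; rewrite ler_wpM2r.
have xG t : group (x t) by exact: block_group B t.
exists (fun t => 3 `^ p * (E t + W (grid (idx t)))); split=> //.
- move=> s t s0 st t1.
  have t0 : 0 <= t by exact: le_trans st.
  have s1 : s <= 1 by exact: le_trans t1.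
  have [is1 is2] := idxP s s0; have [it1 it2] := idxP t t0.
  have ilt := idx_le t t1; have ij := idx_homo s t st.
  have WW : W (grid (idx s)) <= W (grid (idx t)).
    by apply: Wh; rewrite ?grid_ge0 ?le_grid ?grid_le1.
  have tp : 1 `^ p <= 3 `^ p by apply: ge0_ler_powR; rewrite ?nnegrE ?ler1n.
  rewrite powR1 in tp.
  have [ijE|ijne] := eqVneq (idx s) (idx t).
    rewrite ijE; have [jn|jn] := ltnP (idx t) n.+1.
      have := Ej _ s t jn; rewrite -{1}ijE is1 st (ltW it2) => /(_ isT isT isT) H.
      rewrite -mulrBr; apply: le_trans H _.
      have -> : E t + W (grid (idx t)) - (E s + W (grid (idx t))) = E t - E s by ring.
      by rewrite ler_peMl// subr_ge0 Eh.
    (* Index [n.+1] is reached only at time [1], so the interval is a single point. *)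
    have jE : idx t = n.+1 by apply/eqP; rewrite eqn_leq ilt.
    have sE : s = 1 by apply: le_anti; rewrite s1 -grid_last -jE -ijE is1.
    have tE : t = 1 by apply: le_anti; rewrite t1 -grid_last -jE it1.
    rewrite sE tE /tincr group_mulVl// (hnorm1 hN) powR0 ?subrr//.
    by rewrite gt_eqF// (lt_le_trans ltr01).
  have ijlt : (idx s < idx t)%N by rewrite ltn_neqAle ijne.
  have isn : (idx s < n.+1)%N by exact: leq_trans ijlt ilt.
  set u := grid (idx s).+1; set v := grid (idx t).
  have uv : u <= v by exact: le_grid.
  have H1 : N (tincr x s u) `^ p <= E u - E s by apply: (Ej (idx s)) => //; exact: ltW.
  have H2 : N (tincr x u v) `^ p <= W v - W u.
    rewrite /tincr !xY//.
    by apply: YW; rewrite ?grid_ge0 ?grid_le1.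
  have H3 : N (tincr x v t) `^ p <= E t - E v.
    have [jn|jn] := ltnP (idx t) n.+1; first by apply: (Ej (idx t)) => //; exact: ltW.
    have jE : idx t = n.+1 by apply/eqP; rewrite eqn_leq ilt.
    have tE : t = v by apply: le_anti; rewrite it1 /v jE grid_last t1.
    rewrite -tE /tincr group_mulVl// (hnorm1 hN) powR0 ?subrr//.
    by rewrite gt_eqF// (lt_le_trans ltr01).
  have N0 s' t' : 0 <= N (tincr x s' t').
    by apply: (hnorm_ge0 hN); apply: groupM => //; exact: groupV.
  have xVG s' t' : group (tincr x s' t') by apply: groupM => //; exact: groupV.
  have tri : N (tincr x s t) <= N (tincr x s u) + N (tincr x u v) + N (tincr x v t).
    have cut a b c : tincr x a c = tincr x a b * tincr x b c.
      by rewrite /tincr mulrA -[_ * _ * (tinv (x b) : T)]mulrA group_mulV// mulr1.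
    rewrite (cut s v t) (cut s u v).
    apply: le_trans (hnorm_mul hN (groupM (xVG s u) (xVG u v)) (xVG v t)) _.
    by rewrite lerD2r; exact: (hnorm_mul hN).
  rewrite -mulrBr; apply: (@le_trans _ _ _ _ _ _ (ler_wpM2l (powR_ge0 3 p) (_ : _ <= _))).
    apply: le_trans (powR_sum3 (N0 s u) (N0 u v) (N0 v t) p0).
    by apply: ge0_ler_powR; rewrite ?nnegrE ?addr_ge0.
  have uW : W (grid (idx s)) <= W u.
    by apply: Wh; rewrite ?grid_ge0 ?grid_le1// ltW// lt_grid.
  have uE := Eh _ _ uv.
  by move: H1 H2 H3 uW; rewrite -/v; lra.
- have i0 : idx 0 = 0%N by rewrite /idx mul0r truncn0.
  have i1 : idx 1 = n.+1 by rewrite /idx mul1r natrK.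
  rewrite i0 i1 grid0 grid_last -mulrBr -mulrA ler_wpM2l ?powR_ge0// mulrDl mul1r.
  have -> : E 1 + W 1 - (E 0 + W 0) = (E 1 - E 0) + (W 1 - W 0) by ring.
  rewrite lerD2r; apply: le_trans E1 _.
  have -> : W 1 - W 0 = \sum_(0 <= i < n.+1) (W (grid i.+1) - W (grid i)).
    by rewrite (telescope_sumr (fun i => W (grid i)))// grid0 grid_last.
  rewrite mulr_sumr.
  apply: ler_sum_nat => i /andP[_ i_n]; rewrite powRM//; last first.
    by apply: (hnorm_ge0 hN); exact: group_grid_incr.
  rewrite ler_wpM2l ?powR_ge0//; apply: YW; rewrite ?grid_ge0 ?grid_le1//.
  by rewrite ltW// lt_grid.
Qed.

End Approximation.

(** * The signature as a differential equation *)

Section Coordinates.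
Variables (R : realType) (V : normedVectType R).
Local Notation I := 'I_(\dim {:V}).
Local Notation e_ i := ((vbasis {:V})`_i).
Local Notation crd := (coord (vbasis {:V})).

Lemma crd_sum (v : V) : v = \sum_(i : I) crd i v *: e_ i.
Proof. by apply: coord_vbasis; rewrite memvf. Qed.

(** The compactness argument of [hnorm_sphere] for the norm of [V]. It leads to continuity of the
    coordinates, through which derivatives taken in [V] enter the iterated integrals. *)
Lemma crd_sphere (i : I) : exists2 c : R, 0 < c &
  forall v : V, (forall j, `|crd j v| <= 1) -> `|crd i v| = 1 -> c <= `|v|.
Proof.
apply: contrapT => H.
have /choice[u uP] (n : nat) : exists v : V, [/\ forall j, `|crd j v| <= 1,
    `|crd i v| = 1 & `|v| <= n.+1%:R^-1].
  apply: contrapT => nP; apply: H; exists n.+1%:R^-1; first by rewrite invr_gt0.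
  move=> v v1 vi; rewrite leNgt; apply/negP => vn; apply: nP.
  by exists v; split => //; exact: ltW.
have [G PG [oG Gb]] := ultrafilter_nat R.
have /choice[b bP] (j : I) : exists l : R, crd j (u n) @[n --> G] --> l.
  by apply: (Gb _ 1) => n; case: (uP n).
pose v : V := \sum_j b j *: e_ j.
have uv : u n @[n --> G] --> v.
  under eq_fun do rewrite [u _]crd_sum.
  by apply: cvg_bigsum => j _; apply: cvgZ; [exact: bP|exact: cvg_cst].
have v0 : v = 0.
  have u0 : u n @[n --> G] --> (0 : V).
    apply/cvgrPdist_le => r r0; have := oG _ (near_infty_natSinv_lt (PosNum r0)).
    apply: filterS => n /= nr; have [_ _ un] := uP n; rewrite sub0r normrN.
    by apply: le_trans un _; exact: ltW.
  exact: (cvg_unique _ uv u0).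
have bi : `|b i| = 1.
  have G1 : (`|crd i (u n)| @[n --> G] --> (1 : R)).
    by apply: cvg_near_cst; apply: oG; exists 0%N => // n _; case: (uP n).
  have G2 : `|crd i (u n)| @[n --> G] --> `|b i| by apply: cvg_norm; exact: bP.
  exact: cvg_unique G2 G1.
have := congr1 (crd i) v0; rewrite linear0 /v linear_sum (bigD1 i)//= big1 => [|j ji].
  rewrite addr0 linearZ/= coord_free ?(basis_free (vbasisP _))// eqxx.
  by rewrite [_ * _]mulr1 => bi0; move: bi; rewrite bi0 normr0 => /eqP; rewrite eq_sym oner_eq0.
by rewrite linearZ/= coord_free ?(basis_free (vbasisP _))// (negbTE ji) [_ * _]mulr0.
Qed.

Lemma crd_bounded : exists2 C : R, 0 <= C & forall (i : I) (v : V), `|crd i v| <= C * `|v|.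
Proof.
have /choice[c cP] (i : I) : exists c : R, 0 < c /\
    forall v : V, (forall j, `|crd j v| <= 1) -> `|crd i v| = 1 -> c <= `|v|.
  by have [c c0 H] := crd_sphere i; exists c.
have C0 : 0 <= \sum_(i : I) (c i)^-1.
  by apply: sumr_ge0 => i _; rewrite invr_ge0 ltW; case: (cP i).
exists (\sum_(i : I) (c i)^-1) => // i v.
have [j _ jmax] := @arg_maxP _ R I i xpredT (fun j => `|crd j v|) isT.
apply: le_trans (jmax i isT) _.
have [j0|j0] := eqVneq (crd j v) 0; first by rewrite j0 normr0 mulr_ge0.
have nj : 0 < `|crd j v| by rewrite normr_gt0.
have [cj0 Hj] := cP j; have := Hj (`|crd j v|^-1 *: v).
have nE k : `|crd k (`|crd j v|^-1 *: v)| = `|crd j v|^-1 * `|crd k v|.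
  by rewrite linearZ/= normrM gtr0_norm ?invr_gt0.
rewrite nE mulVf ?gt_eqF// normrZ gtr0_norm ?invr_gt0// => /(_ _ erefl) cv.
have {}cv : c j <= `|crd j v|^-1 * `|v|.
  by apply: cv => k; rewrite nE ler_pdivrMl// mulr1; exact: jmax.
apply: (@le_trans _ _ ((c j)^-1 * `|v|)).
  by rewrite ler_pdivlMl// mulrC -ler_pdivlMl.
rewrite ler_wpM2r// (bigD1 j)//= lerDl; apply: sumr_ge0 => k _.
by rewrite invr_ge0 ltW; case: (cP k).
Qed.

Lemma crd_cvg (i : I) (S : Type) (F : set_system S) (f : S -> V) (v : V) : Filter F ->
  f u @[u --> F] --> v -> crd i (f u) @[u --> F] --> crd i v.
Proof.
move=> FF /cvgrPdist_le fv; have [C C0 HC] := crd_bounded.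
have C1 : 0 < C + 1 by rewrite ltr_wpDl.
apply/cvgrPdist_le => r r0; have := fv (r / (C + 1)) (divr_gt0 r0 C1).
apply: filterS => u fu; rewrite -linearB; apply: le_trans (HC i _) _.
apply: (@le_trans _ _ ((C + 1) * `|v - f u|)); first by rewrite ler_wpM2r// lerDl.
by rewrite mulrC -ler_pdivlMr.
Qed.

End Coordinates.

Section Signature.
Variables (R : realType) (V : normedVectType R) (m : nat).
Local Notation I := 'I_(\dim {:V}).
Local Notation T := (talg V m).
Local Notation crd := (coord (vbasis {:V})).
Local Notation mu := (@lebesgue_measure R).
Implicit Types (y : R -> V) (t : R).

Lemma tcoef_tvec (v : V) (s : seq I) : tcoef (tvec m v : T) s =
  if (size s <= m)%N then (if s is [:: i] then crd i v else 0) else 0.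
Proof. by rewrite /tcoef; case: ifP => // sm; rewrite ffunE val_insub_bseq. Qed.

Lemma tcoef_mul_tvec (a : T) (v : V) (s : seq I) (i : I) : (size s < m)%N ->
  tcoef (a * tvec m v) (rcons s i) = tcoef a s * crd i v.
Proof.
move=> sm; have sm' : (size (rcons s i) <= m)%N by rewrite size_rcons.
rewrite tcoefM//; have sz : (size s < (size (rcons s i)).+1)%N by rewrite size_rcons ltnS.
rewrite (bigD1 (Ordinal sz))//= big1 ?addr0.
  rewrite -cats1 take_size_cat// drop_size_cat// tcoef_tvec/=.
  by rewrite ifT// (leq_ltn_trans _ sm).
case=> k kl; rewrite -val_eqE/= => ks; rewrite tcoef_tvec.
case: ifP => _; last exact: mulr0.
case dk : (drop k (rcons s i)) => [|j [|? ?]]; rewrite ?mulr0//.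
have kE : k = size s.
  have := congr1 size dk; rewrite size_drop => /= szk.
  move: kl; rewrite ltnS => /subnK; rewrite szk size_rcons add1n => -[].
  by [].
by rewrite kE eqxx in ks.
Qed.

(** At [0] and [1] the two-sided derivative [derive1 y] depends on values of [y] outside [[0, 1]].
    The one-sided derivative [z] replaces it on the closed interval, where its coordinates are
    continuous because it is differentiable in turn. *)
Lemma smooth_path_derive y : smooth_path y -> exists z : R -> V,
  (forall t, t \in `]0, 1[ -> derive1 y t = z t) /\
  forall i, {within `[0, 1], continuous (fun t => crd i (z t))}.
Proof.
move=> [D [D0 Dd]]; exists (D 1%N); split=> [t t01|i].
  have tt : t \in `[0, 1] by exact: subset_itv_oo_cc t01.
  have := Dd 0%N t tt; rewrite D0 /derive1 => H.
  have {}H : h^-1 *: (y (h + t) - y t) @[h --> 0^'] --> D 1%N t.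
    under eq_fun do rewrite [_ + t]addrC.
    apply: cvg_trans H => A /=; rewrite /nbhs/= => HA.
    have nt : \forall h \near 0^', t + h \in `[0, 1].
      move: t01; rewrite in_itv/= => /andP[t0 t1].
      have d0 : 0 < Num.min t (1 - t) by rewrite lt_min t0 subr_gt0.
      have := @dnbhs0_le R R _ d0; apply: filterS => h.
      rewrite le_min => /andP[h1 h2]; rewrite in_itv/=.
      by move: h1 h2 => /ler_normlP[h1 h1'] /ler_normlP[h2 h2']; apply/andP; split; lra.
    have HA' : \forall h \near 0^', t + h \in `[0, 1] -> A (h^-1 *: (y (t + h) - y t)) := HA.
    by move: HA' nt; apply: filterS2 => h Ah th; exact: Ah.
  exact: cvg_lim H.
apply/subspace_continuousP => t /= t01; apply: crd_cvg.
have Hd := Dd 1%N t t01.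
have H0 : D 1%N (t + h) @[h --> within [set h | t + h \in `[0, 1]] 0^'] --> D 1%N t.
  (* Differentiability gives continuity: [D 1 (t + h)] is [h] times the difference quotient plus
     [D 1 t]. *)
  have -> : D 1%N t = 0 *: D 2%N t + D 1%N t by rewrite scale0r add0r.
  apply: cvg_trans (_ : (fun h => h *: (h^-1 *: (D 1%N (t + h) - D 1%N t)) + D 1%N t) @
    within [set h | t + h \in `[0, 1]] 0^' --> _).
    apply: near_eq_cvg; apply: cvg_within; near=> h.
    have h0 : h != 0 by near: h; exact: nbhs_dnbhs_neq.
    by rewrite scalerA divff// scale1r subrK.
  apply: cvgD; last exact: cvg_cst.
  apply: cvgZ; last exact: Hd.
  by apply: cvg_trans (_ : h @[h --> 0^'] --> 0); [exact: cvg_within|exact: nbhs_dnbhs].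
apply/cvgrPdist_le => r r0; move/cvgrPdist_le : H0 => /(_ r r0).
rewrite !near_withinE => /nbhs_ballP[d /= d0 Hd0].
apply/nbhs_ballP; exists d => //= u tu u01.
have [->|ut] := eqVneq u t; first by rewrite subrr normr0 ltW.
have := Hd0 (u - t); rewrite subrKC; apply => //.
  by rewrite /ball/= sub0r normrN distrC.
by rewrite subr_eq0.
Unshelve. all: by end_near. Qed.

(** Replacing [derive1 y] by its continuous version changes no integral over the open interval. The
    fundamental theorem of calculus then gives the derivative, and continuity of the integral in its
    upper bound carries the induction on the word. *)
Lemma iterated_integral_continuous_derive y (rw : seq I) : smooth_path y ->
  {within `[0, 1], continuous (iterated_integral y rw 0)} /\
  (if rw is i :: rw' then iterated_integral y rw 0 0 = 0 /\
    forall t, t \in `]0, 1[ -> is_derive t 1 (iterated_integral y rw 0)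
       (iterated_integral y rw' 0 t * crd i (derive1 y t)) else True).
Proof.
move=> yS; have [z [zE zc]] := smooth_path_derive yS.
elim: rw => [|i rw [IH _]]; first by split=> // t; exact: cvg_cst.
set X := iterated_integral y rw 0 in IH *.
pose g t := X t * crd i (z t).
have gc : {within `[0, 1], continuous g}.
  by move=> t; apply: cvgM; [exact: IH|exact: zc].
have gi a : a \in `[0, 1] -> mu.-integrable `[0, a] (EFin \o g).
  rewrite in_itv/= => /andP[a0 a1].
  apply: continuous_compact_integrable; first exact: segment_compact.
  by apply: continuous_subspaceW gc; apply: subset_itvl; rewrite bnd_simp.
have XE t : t \in `[0, 1] -> iterated_integral y (i :: rw) 0 t =
    parameterized_integral mu 0 t g.
  move=> t01; have /andP[t0 t1] : (0 <= t) && (t <= 1) by move: t01; rewrite in_itv.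
  rewrite /= /parameterized_integral.
  transitivity (\int[mu]_(u in `]0, t[) g u).
    apply: eq_Rintegral => u; rewrite inE/= in_itv/= => /andP[u0 ut].
    by rewrite zE// in_itv/= u0 (lt_le_trans ut).
  have gi' : mu.-integrable `]0, t] (EFin \o g).
    by apply: integrableS (gi t t01) => //; apply: subset_itvr; rewrite bnd_simp.
  rewrite Rintegral_itv_bndo_bndc; last first.
    by apply: integrableS gi' => //; apply: subset_itvl; rewrite bnd_simp.
  by rewrite Rintegral_itv_obnd_cbnd.
have one01 : (1 : R) \in `[0, 1] by rewrite in_itv/= ler01 lexx.
have zero01 : (0 : R) \in `[0, 1] by rewrite in_itv/= ler01 lexx.
have Pc := parameterized_integral_continuous ler01 (gi 1 one01).
split.
  by apply: subspace_eq_continuous Pc => t; rewrite inE => t01; exact/esym/XE.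
split; first by rewrite XE// /parameterized_integral set_itv1 Rintegral_set1.
move=> t t01; have /andP[t0 t1] : (0 < t) && (t < 1) by move: t01; rewrite in_itv.
have gt : {for t, continuous g}.
  have := (continuous_within_itvP _ ltr01).1 gc => -[+ _ _].
  by apply; rewrite inE.
have [d1 d2] := continuous_FTC1_closed t1 (gi 1 one01) t0 gt.
apply: (@near_eq_is_derive _ _ _ (fun t => \int[mu]_(u in `[0, t]) g u)).
  near=> u; rewrite XE// in_itv/=; apply/andP; split; apply: ltW; near: u.
    exact: lt_nbhsr.
  exact: lt_nbhsl.
rewrite (zE t t01); rewrite derive1E in d2; exact: (DeriveDef d1 d2).
Unshelve. all: by end_near. Qed.

(** The last letter of a word belongs to the outermost variable, so differentiating in the upper
    bound strips it off; this is right multiplication by [tvec] of the velocity. *)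
Lemma signature_tode y : smooth_path y ->
  tode (signature_path m y) (fun t => tvec m (derive1 y t) : T).
Proof.
move=> yS.
have E t s : tcoef (signature_path m y t : T) s =
    if (size s <= m)%N then iterated_integral y (rev s) 0 t else 0.
  by rewrite /tcoef; case: ifP => // sm; rewrite ffunE val_insub_bseq.
split.
- apply: tcoefP => s sm; rewrite E sm tcoef1; case/lastP: s sm => [//|s i] sm.
  rewrite rev_rcons size_rcons; have [_ [-> _]] :=
    iterated_integral_continuous_derive (i :: rev s) yS; done.
- move=> s; rewrite (_ : (fun t => _) =
      fun t => if (size s <= m)%N then iterated_integral y (rev s) 0 t else 0); last first.
    by apply/funext => t; exact: E.
  case: (size s <= m)%N; last by move=> t; exact: cvg_cst.
  by have [] := iterated_integral_continuous_derive (rev s) yS.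
- move=> t t01 s; rewrite (_ : (fun t => _) =
      fun t => if (size s <= m)%N then iterated_integral y (rev s) 0 t else 0); last first.
    by apply/funext => u; exact: E.
  have [sm|sm] := leqP (size s) m; last first.
    by rewrite tcoef_gt//; exact: is_derive_cst.
  case/lastP: s sm => [|s i] sm.
    rewrite tcoefM_nil tcoef_tvec/= mulr0; exact: is_derive_cst.
  rewrite size_rcons in sm; rewrite tcoef_mul_tvec// rev_rcons E (ltnW sm).
  have [_ [_ H]] := iterated_integral_continuous_derive (i :: rev s) yS.
  exact: H.
Qed.

End Signature.

(** * Convergence *)

Section SignaturePaths.
Variables (R : realType) (V : normedVectType R) (m : nat).
Local Notation I := 'I_(\dim {:V}).
Local Notation T := (talg V m).
Local Notation group := (@free_nilpotent_group R V m).
Variable N : tensor V m -> R.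
Hypothesis hN : homogeneous_norm N.
Implicit Types (t s r : R).

Lemma group_signature (y : R -> V) : smooth_path y -> group_valued (signature_path m y).
Proof.
move=> yS t t0 t1; apply/free_nilpotent_groupP.
apply: (tode_group_like _ (signature_tode m yS)); last by rewrite in_itv/= t0 t1.
by move=> u _; exact: lie_tvec.
Qed.

Lemma block_smooth_path a b D x l : block N a b D x l -> smooth_path (D 0%N).
Proof.
move=> B; exists D; split=> // k t _; apply: cvg_trans ((is_derive1P _ _ _).1 (block_smooth B k t)).
by apply: cvg_app; exact: cvg_within.
Qed.

(** Both sides solve the same linear equation with value [1] at [0]. *)
Lemma block_signature b D x l t : block N 0 b D x l -> t \in `[0, 1] ->
  signature_path m (D 0%N) t = x t.
Proof.
move=> B; apply: (tode_unique _ (signature_tode m (block_smooth_path B))).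
  by move=> u _; exact: tord_tvec.
split; first exact: (block_start B (lexx 0)).
  apply: (@tderive_tcont _ _ _ _ (fun t => x t * tvec m (D 1%N t))) => u.
  exact: block_derive B u.
move=> u _; have := block_derive B u; rewrite derive1E.
by have [_ ->] := block_smooth B 0%N u.
Qed.

Lemma path_cvg (Y : R -> T) (S : Type) (F : set_system S) (u : S -> R) t : Filter F ->
  tcont `[0, 1] Y -> t \in `[0, 1] -> (forall k, u k \in `[0, 1]) ->
  u k @[k --> F] --> t -> tcvg F (fun k => Y (u k)) (Y t).
Proof.
move=> FF Yc t01 u01 ut w.
have := (subspace_continuousP _ _).1 (Yc w) t t01 => H.
apply: (cvg_trans _ H) => A; rewrite /nbhs/= => HA.
have := ut _ HA; rewrite /nbhs/=; apply: filterS => k /=; apply.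
exact: u01.
Qed.

Lemma tcvg_hnorm0 (S : Type) (F : set_system S) (f : S -> T) : ProperFilter F ->
  (forall u, group (f u)) -> N (f u) @[u --> F] --> 0 -> tcvg F f 1.
Proof.
move=> FF fG fN; have [C C0 HC] := tsize_hnorm hN.
move=> [|i s].
  rewrite tcoef1; under eq_fun do rewrite (group_nil (fG _)).
  exact: cvg_cst.
rewrite tcoef1/=; have CN : C * N (f u) @[u --> F] --> (0 : R).
  by rewrite -(mulr0 C); apply: cvgM fN; exact: cvg_cst.
apply/cvgrPdist_le => e e0.
(* A value of [C * N] at most [1] dominates all its positive powers, hence the coefficients of every
   degree. *)
have m0 : 0 < Num.min 1 e by rewrite lt_min ltr01.
move/cvgrPdist_le : CN => /(_ _ m0); apply: filterS => u; rewrite !sub0r !normrN.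
have N0 : 0 <= C * N (f u) by rewrite mulr_ge0// (hnorm_ge0 hN).
rewrite ger0_norm// le_min => /andP[N1 Ne]; apply: le_trans (HC _ (fG u) (i :: s)) _.
by apply: le_trans Ne; rewrite exprS ler_piMr// exprn_ile1.
Qed.

Lemma grid_cover n t : 0 <= t -> t <= 1 -> exists j : nat,
  [/\ (j < n.+1)%N, grid R n j <= t & t <= grid R n j.+1].
Proof.
move=> t0; rewrite le_eqVlt => /predU1P[->|t1].
  by exists n; rewrite grid_last grid_le1.
have t0n : 0 <= t * n.+1%:R by rewrite mulr_ge0.
have /andP[j1 j2] := truncn_itv t0n.
exists (Num.truncn (t * n.+1%:R)); split.
- by rewrite -(ltr_nat R) (le_lt_trans j1)// gtr_pMl.
- by rewrite /grid ler_pdivrMr.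
- by rewrite /grid ler_pdivlMr// ltW.
Qed.

(** The index [nu k] and the time [u k] move together, so the statement covers pointwise convergence
    as well as the contradiction argument for uniform convergence. If [a k] is the grid point to the
    left of [u k], then [Y (a k)] tends to [Y t], and the rest of the path from there has norm at
    most [K] times that of an increment of [Y] over a shrinking cell. *)
Lemma approx_cvg (Y : R -> T) (K : R) (x : nat -> R -> T) (S : Type)
    (F : set_system S) (nu : S -> nat) (u : S -> R) t :
  ProperFilter F -> Y 0 = 1 -> group_valued Y -> tcont `[0, 1] Y -> 0 <= K ->
  (forall n t, group (x n t)) ->
  (forall n j t, (j < n.+1)%N -> grid R n j <= t -> t <= grid R n j.+1 ->
    N ((tinv (Y (grid R n j)) : T) * x n t) <=
      K * N (tincr Y (grid R n j) (grid R n j.+1))) ->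
  t \in `[0, 1] -> (forall k, u k \in `[0, 1]) -> u k @[k --> F] --> t ->
  nu k @[k --> F] --> \oo -> tcvg F (fun k => x (nu k) (u k)) (Y t).
Proof.
move=> FF Y0 YG Yc K0 xG xY t01 u01 ut nuoo.
have /choice[j jP] k : exists j : nat,
    [/\ (j < (nu k).+1)%N, grid R (nu k) j <= u k & u k <= grid R (nu k) j.+1].
  by apply: grid_cover; have := u01 k; rewrite in_itv/= => /andP[].
pose a k := grid R (nu k) (j k); pose b k := grid R (nu k) (j k).+1.
have jn k : (j k < (nu k).+1)%N by case: (jP k).
have a01 k : a k \in `[0, 1] by rewrite in_itv/= grid_ge0 grid_le1// ltnW.
have b01 k : b k \in `[0, 1] by rewrite in_itv/= grid_ge0 grid_le1.
have step k : b k - a k = (nu k).+1%:R^-1.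
  by rewrite /a /b /grid -mulrBl -natrB// subSnn mul1r.
have small : (nu k).+1%:R^-1 @[k --> F] --> (0 : R).
  apply/cvgrPdist_le => e e0.
  have : \forall k \near F, (nu k).+1%:R^-1 < e := nuoo _ (near_infty_natSinv_lt (PosNum e0)).
  apply: filterS => k ke; rewrite sub0r normrN ger0_norm ?invr_ge0//.
  exact: ltW.
have near_t (v : S -> R) : (forall k, `|u k - v k| <= (nu k).+1%:R^-1) -> v k @[k --> F] --> t.
  move=> uv; have uv0 : u k - v k @[k --> F] --> (0 : R).
    apply/cvgrPdist_le => e e0; move/cvgrPdist_le : small => /(_ e e0).
    apply: filterS => k; rewrite !sub0r !normrN => ke.
    by apply: le_trans (uv k) _; apply: le_trans ke; exact: ler_norm.
  rewrite (_ : v = u \- (fun k => u k - v k)).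
    by rewrite -(subr0 t); exact: (cvgB ut uv0).
  by apply/funext => k /=; rewrite subKr.
have Ya : tcvg F (fun k => Y (a k)) (Y t).
  apply: path_cvg => //; apply: near_t => k; have [_ k1 k2] := jP k.
  by rewrite -step ger0_norm ?subr_ge0// lerD2r.
have Yb : tcvg F (fun k => Y (b k)) (Y t).
  apply: path_cvg => //; apply: near_t => k; have [_ k1 k2] := jP k.
  by rewrite -step distrC ger0_norm ?subr_ge0// lerD2l lerN2.
have Yg k : k \in `[0, 1] -> group (Y k) by rewrite in_itv/= => /andP[]; exact: YG.
have hN0 : N ((tinv (Y (a k)) : T) * x (nu k) (u k)) @[k --> F] --> (0 : R).
  have KN : K * N (tincr Y (a k) (b k)) @[k --> F] --> (0 : R).
    rewrite -(mulr0 K) -(hnorm1 hN); apply: cvgM; first exact: cvg_cst.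
    apply: (hnorm_cvg hN) => //.
      rewrite -(group_mulVl (Yg t t01)); apply: tcvgM => //; exact: tcvg_inv.
    by apply: nearW => k; apply: groupM; [apply: groupV|]; exact: Yg.
  apply/cvgrPdist_le => e e0; move/cvgrPdist_le : KN => /(_ e e0).
  apply: filterS => k; rewrite !sub0r !normrN => ke.
  have [_ k1 k2] := jP k; have := xY _ _ _ (jn k) k1 k2 => H.
  rewrite ger0_norm; first by apply: le_trans H _; apply: le_trans ke; exact: ler_norm.
  by apply: (hnorm_ge0 hN); apply: groupM => //; apply: groupV; exact: Yg.
have h1 := tcvg_hnorm0 FF _ hN0.
have {}h1 : tcvg F (fun k => (tinv (Y (a k)) : T) * x (nu k) (u k)) 1.
  by apply: h1 => k; apply: groupM => //; apply: groupV; exact: Yg.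
rewrite (_ : (fun k => _) = fun k => (Y (a k) : T) * ((tinv (Y (a k)) : T) * x (nu k) (u k))).
  by rewrite -(mulr1 (Y t)); exact: tcvgM.
by apply/funext => k; rewrite mulrA group_mulV ?mul1r//; exact: Yg.
Qed.

Lemma hdist_cvg0 (S : Type) (F : set_system S) (f g : S -> T) a : ProperFilter F ->
  (forall u, group (f u)) -> (forall u, group (g u)) -> tcvg F f a -> tcvg F g a ->
  hdist N (f u) (g u) @[u --> F] --> (0 : R).
Proof.
move=> FF fG gG fa ga; have aG : group a.
  by apply: (group_cvg FF fa); apply: nearW.
rewrite -(hnorm1 hN); apply: (hnorm_cvg hN) => //.
  by rewrite -(group_mulVl aG); apply: tcvgM => //; exact: tcvg_inv.
by apply: nearW => u; apply: groupM => //; exact: groupV.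
Qed.

(** Failing pairs of times for arbitrarily large indices have limits along the ultrafilter; there
    both increments converge to the same increment of [Y], so their distance tends to [0]. *)
Lemma approx_hdist_uniform (Y : R -> T) (K : R) (x : nat -> R -> T) :
  Y 0 = 1 -> group_valued Y -> tcont `[0, 1] Y -> 0 <= K ->
  (forall n t, group (x n t)) ->
  (forall n j t, (j < n.+1)%N -> grid R n j <= t -> t <= grid R n j.+1 ->
    N ((tinv (Y (grid R n j)) : T) * x n t) <=
      K * N (tincr Y (grid R n j) (grid R n j.+1))) ->
  forall d : R, 0 < d -> \forall n \near \oo, forall s t, s \in `[0, 1] -> t \in `[0, 1] ->
    hdist N (tincr (x n) s t) (tincr Y s t) <= d.
Proof.
move=> Y0 YG Yc K0 xG xY d d0; apply: contrapT => H.
have /choice[z zP] (k : nat) : exists z : nat * (R * R), [/\ (k <= z.1)%N,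
    z.2.1 \in `[0, 1], z.2.2 \in `[0, 1] &
    d < hdist N (tincr (x z.1) z.2.1 z.2.2) (tincr Y z.2.1 z.2.2)].
  apply: contrapT => Hk; apply: H; exists k => // n /= kn s t s01 t01.
  rewrite leNgt; apply/negP => dlt; apply: Hk; by exists (n, (s, t)).
pose nu k := (z k).1; pose s k := (z k).2.1; pose t k := (z k).2.2.
have [G PG [oG Gb]] := ultrafilter_nat R.
have lim01 (u : nat -> R) : (forall k, u k \in `[0, 1]) ->
    exists2 l : R, l \in `[0, 1] & u k @[k --> G] --> l.
  move=> u01; have [|l ul] := Gb u 1.
    by move=> k; have := u01 k; rewrite in_itv/= => /andP[u0 u1]; rewrite ger0_norm.
  exists l => //; have <- := cvg_lim (@Rhausdorff R) ul.
  have lc : cvg (u k @[k --> G]) by apply/cvg_ex; exists l.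
  by rewrite in_itv/=; apply/andP; split; [apply: limr_ge|apply: limr_le] => //;
    apply: nearW => k; have := u01 k; rewrite in_itv/= => /andP[].
have s01 k : s k \in `[0, 1] by case: (zP k).
have t01 k : t k \in `[0, 1] by case: (zP k).
have [sl sl01 ssl] := lim01 s s01; have [tl tl01 ttl] := lim01 t t01.
have nuoo : nu k @[k --> G] --> \oo.
  move=> A [M _ MA]; apply: oG; exists M => // k /= Mk; apply: MA => /=.
  by have [kz _ _ _] := zP k; exact: leq_trans kz.
have Yg k : k \in `[0, 1] -> group (Y k) by rewrite in_itv/= => /andP[]; exact: YG.
have xs := approx_cvg PG Y0 YG Yc K0 xG xY sl01 s01 ssl nuoo.
have xt := approx_cvg PG Y0 YG Yc K0 xG xY tl01 t01 ttl nuoo.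
have Ys := path_cvg _ Yc sl01 s01 ssl; have Yt := path_cvg _ Yc tl01 t01 ttl.
have hd : hdist N (tincr (x (nu k)) (s k) (t k)) (tincr Y (s k) (t k)) @[k --> G] --> (0 : R).
  apply: (@hdist_cvg0 _ G _ _ ((tinv (Y sl) : T) * Y tl)).
  - by move=> k; apply: groupM => //; exact: groupV.
  - by move=> k; apply: groupM; [apply: groupV|]; exact: Yg.
  - by apply: tcvgM xt; exact: tcvg_inv.
  - by apply: tcvgM; [apply: tcvg_inv; exact: Ys|exact: Yt].
move/cvgrPdist_lt : hd => /(_ d d0) hd.
have [k] := filter_ex hd; rewrite sub0r normrN => /(le_lt_trans (ler_norm _)).
have [_ _ _ dk] := zP k.
by rewrite ltNge (ltW dk).
Qed.

Lemma hdist_powR_le g h (p : R) : group g -> group h -> 1 <= p ->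
  hdist N g h `^ p <= 3 `^ p * (N g `^ p + N h `^ p).
Proof.
move=> gG hG p1; have p0 : 0 <= p by exact: le_trans p1.
have := powR_sum3 (hnorm_ge0 hN gG) (hnorm_ge0 hN hG) (lexx 0) p0.
rewrite !addr0 powR0 ?addr0; last by rewrite gt_eqF// (lt_le_trans ltr01).
apply: le_trans; apply: ge0_ler_powR => //.
- by rewrite nnegrE; apply: (hnorm_ge0 hN); apply: groupM => //; exact: groupV.
- by rewrite nnegrE addr_ge0// (hnorm_ge0 hN).
- by rewrite -(hnorm_inv hN gG); apply: (hnorm_mul hN) => //; exact: groupV.
Qed.

(** A partition involves finitely many increments, so one index [n] works for all of them, up to a
    factor [th < 1]; letting [th] approach [1] gives the bound. *)
Lemma var_norm_lsc (p C : R) (x : nat -> R -> T) (Y : R -> T) : 1 <= p ->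
  (forall n, group_valued (x n)) -> group_valued Y ->
  (forall t, t \in `[0, 1] -> tcvg \oo (fun n => x n t) (Y t)) ->
  (forall n, var_norm N p (x n) <= C%:E)%E -> (var_norm N p Y <= C%:E)%E.
Proof.
move=> p1 xG YG xY xC; have p0 : 0 < p by exact: lt_le_trans p1.
apply: ge_ereal_sup => _ [s ps <-]; rewrite lee_fin /=.
have nth01 j : (j < (size s).+1)%N -> 0 <= nth 1 (0 :: s) j <= 1.
  by move=> js; rewrite (itv_partition_nth_ge js ps) (itv_partition_nth_le js ps).
pose q := nth 1 (0 :: s).
have Yi i : (i < size s)%N ->
    hdist N (incr Y (q i) (q i.+1)) (incr (cst (tone V m)) (q i) (q i.+1)) =
    N (tincr Y (q i) (q i.+1)).
  move=> si; have /andP[i0 i1] := nth01 i (ltnW si : (i < (size s).+1)%N).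
  by have /andP[j0 j1] := nth01 i.+1 si; exact: (hnorm_incr_one hN YG).
under eq_big_nat => i /andP[_ si] do rewrite -/q Yi//.
set S := \sum_(0 <= i < size s) _.
have S0 : 0 <= S by apply: sumr_ge0 => i _; exact: powR_ge0.
have qG i : (i < size s)%N -> group (tincr Y (q i) (q i.+1)).
  move=> si; have /andP[i0 i1] := nth01 i (ltnW si : (i < (size s).+1)%N).
  by have /andP[j0 j1] := nth01 i.+1 si; exact: group_incr.
suff H th : 0 < th -> th < 1 -> th * S `^ p^-1 <= C.
  rewrite leNgt; apply/negP => CS.
  have C0 : 0 <= C.
    have := H (2^-1); rewrite invr_gt0 ltr0n invf_lt1// => /(_ isT); rewrite ltr1n => /(_ isT).
    by apply: le_trans; rewrite mulr_ge0// ?powR_ge0// invr_ge0.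
  have Sp : 0 < S `^ p^-1 by exact: le_lt_trans CS.
  (* This factor brings the sum down to the midpoint between [C] and its assumed larger value. *)
  pose th := ((C + S `^ p^-1) / 2) / S `^ p^-1.
  have := H th; rewrite divr_gt0 ?divr_gt0//; last by rewrite ltr_wpDl.
  rewrite ltr_pdivrMr// mul1r => /(_ isT) H1.
  have {}H1 : th * S `^ p^-1 <= C by apply: H1; lra.
  by move: H1; rewrite /th divfK ?gt_eqF//; lra.
move=> th0 th1.
have near_n : \forall n \near \oo, forall i : 'I_(size s),
    th * N (tincr Y (q i) (q i.+1)) <= N (tincr (x n) (q i) (q i.+1)).
  apply: filter_forall => i; have si := ltn_ord i.
  have /andP[i0 i1] := nth01 i (ltnW si : (i < (size s).+1)%N).
  have /andP[j0 j1] := nth01 i.+1 si.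
  (* A vanishing increment leaves no margin [(1 - th) * N], but its inequality is trivial. *)
  have [N0|N0] := eqVneq (N (tincr Y (q i) (q i.+1))) 0.
    apply: nearW => n; rewrite N0 mulr0; apply: (hnorm_ge0 hN); exact: group_incr.
  have Np : 0 < N (tincr Y (q i) (q i.+1)) by rewrite lt_neqAle eq_sym N0 (hnorm_ge0 hN (qG i si)).
  have cv : N (tincr (x n) (q i) (q i.+1)) @[n --> \oo] --> N (tincr Y (q i) (q i.+1)).
    apply: (hnorm_cvg hN).
      apply: tcvgM; last by apply: xY; rewrite in_itv/= j0 j1.
      by apply: tcvg_inv; apply: xY; rewrite in_itv/= i0 i1.
    by apply: nearW => n; exact: group_incr.
  have e0 : 0 < (1 - th) * N (tincr Y (q i) (q i.+1)) by rewrite mulr_gt0// subr_gt0.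
  move/cvgrPdist_le : cv => /(_ _ e0); apply: filterS => n /ler_normlP[_].
  by rewrite mulrBl mul1r; lra.
have [n nP] := filter_ex near_n.
have xn := le_trans (var_norm_psum hN (xG n) ps p0) (xC n).
rewrite lee_fin in xn; apply: le_trans xn.
have -> : th * S `^ p^-1 = (th `^ p * S) `^ p^-1.
  by rewrite powRM ?powR_ge0// -powRrM divff ?gt_eqF// powRr1// ltW.
apply: ge0_ler_powR; rewrite ?invr_ge0 ?nnegrE ?mulr_ge0 ?powR_ge0 ?(ltW p0)//.
  by rewrite (psumE _ _ 1); apply: sumr_ge0 => i _; exact: powR_ge0.
rewrite (psumE _ _ 1) /S mulr_sumr; apply: ler_sum_nat => i /andP[_ si].
have Ni := hnorm_ge0 hN (qG i si).
rewrite -powRM ?(ltW th0)//; have := nP (Ordinal si) => /= H.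
apply: ge0_ler_powR; rewrite ?nnegrE ?mulr_ge0 ?(ltW p0) ?(ltW th0)//.
by apply: le_trans H; rewrite mulr_ge0// ltW.
Qed.

Lemma var_dist_ge0 (r : R) (x y : R -> T) : (0 <= var_dist N r x y)%E.
Proof.
have H : itv_partition (0 : R) 1 [:: 1] := itv_partition1 ltr01.
apply: le_trans (ereal_sup_ubound (imageP _ H)).
by rewrite lee_fin; exact: powR_ge0.
Qed.

End SignaturePaths.

(** * Equivalence with smooth approximation, and convergence in variation *)

Theorem theorem17 (R : realType) (V : normedVectType R) (m : nat) (hm : (1 <= m)%N)
    (N : tensor V m -> R) (hN : homogeneous_norm N)
    (p : R) (hp : 1 <= p) (Y : R -> tensor V m) (hY : group_path Y) :
  let approximates (y : nat -> R -> V) :=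
    [/\ forall n, smooth_path (y n),
        exists C : R, forall n, (var_norm N p (signature_path m (y n)) <= C%:E)%E &
        forall t : R, t \in `[0, 1] -> forall w : word V m,
          signature_path m (y n) t w @[n --> \oo] --> Y t w] in
  (var_paths N p Y <-> exists y, approximates y) /\
  (var_paths N p Y -> exists y, approximates y /\
     forall q : R, p < q ->
       var_dist N q (signature_path m (y n)) Y @[n --> \oo] --> 0%E).
Proof.
move=> approximates.
have p0 : 0 < p by exact: lt_le_trans hp.
have [Y0 Yg Yw] := hY.
have YG : group_valued (Y : R -> talg V m).
  by move=> t t0 t1; apply: Yg; rewrite in_itv/= t0 t1.
have Yc : tcont `[0, 1] (Y : R -> talg V m).
  move=> s; have [sm|sm] := leqP (size s) m; last first.
    rewrite (_ : (fun t => _) = fun=> 0); first by move=> t; exact: cvg_cst.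
    by apply/funext => t; rewrite tcoef_gt.
  rewrite (_ : (fun t => _) = fun t => Y t (insub_bseq m s)); first exact: Yw.
  by apply/funext => t; rewrite /tcoef sm.
suff main : var_paths N p Y -> exists y, approximates y /\
     forall q : R, p < q -> var_dist N q (signature_path m (y n)) Y @[n --> \oo] --> 0%E.
  split=> //; split=> [/main[y [yA _]]|[y [yS [C yC] yY]]]; first by exists y.
  split=> //; apply: le_lt_trans (ltry C).
  apply: (@var_norm_lsc _ _ _ _ hN p C (fun n => signature_path m (y n))) => //.
    by move=> n; exact: group_signature.
  move=> t t01 s; have [sm|sm] := leqP (size s) m; last first.
    by rewrite tcoef_gt//; under eq_fun do rewrite tcoef_gt//; exact: cvg_cst.
  by rewrite /tcoef sm; exact: yY.
move=> [_ Yfin]; have [W [WY W0]] := var_norm_control hN p0 YG Yfin.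
have [K K0 HK] := block_group_element hN.
have /choice[z zP] (n : nat) : exists z : (nat -> R -> V) * (R -> talg V m) * (R -> R) * (R -> R),
    [/\ block N 0 1 z.1.1.1 z.1.1.2 z.1.2,
      forall j t, (j < n.+1)%N -> grid R n j <= t -> t <= grid R n j.+1 ->
        N ((tinv (Y (grid R n j)) : talg V m) * z.1.1.2 t) <=
          K * N (tincr Y (grid R n j) (grid R n j.+1)),
      forall s t, 0 <= s -> s <= t -> t <= 1 -> N (tincr z.1.1.2 s t) `^ p <= z.2 t - z.2 s &
      z.2 1 - z.2 0 <= 3 `^ p * (K `^ p + 1) * (W 1 - W 0)].
  have [D [x [l [W' H]]]] := approx_path_control hN n K0 HK hp Y0 YG WY.
  by exists (D, x, l, W').
pose x n := (z n).1.1.2; pose y n := (z n).1.1.1 0%N; pose W' n := (z n).2.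
have zB n : block N 0 1 (z n).1.1.1 (x n) (z n).1.2 by case: (zP n).
have xE n t : t \in `[0, 1] -> signature_path m (y n) t = x n t.
  exact: (block_signature (zB n)).
have xG n t : free_nilpotent_group (x n t) by exact: block_group (zB n) t.
have xY n j t : (j < n.+1)%N -> grid R n j <= t -> t <= grid R n j.+1 ->
    N ((tinv (Y (grid R n j)) : talg V m) * x n t) <=
      K * N (tincr Y (grid R n j) (grid R n j.+1)).
  by case: (zP n) => _ + _ _; exact.
have xW n s t : 0 <= s -> s <= t -> t <= 1 -> N (tincr (x n) s t) `^ p <= W' n t - W' n s.
  by case: (zP n) => _ _ + _; exact.
have W'1 n : W' n 1 - W' n 0 <= 3 `^ p * (K `^ p + 1) * (W 1 - W 0) by case: (zP n).
have sigE n s t : 0 <= s -> s <= t -> t <= 1 ->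
    tincr (signature_path m (y n)) s t = tincr (x n) s t.
  by move=> s0 st t1; rewrite /tincr !xE// in_itv/= ?s0 ?t1 ?(le_trans st) ?(le_trans s0).
exists y; split.
  split.
  - by move=> n; exact: block_smooth_path (zB n).
  - exists ((3 `^ p * (K `^ p + 1) * (W 1 - W 0)) `^ p^-1) => n.
    apply: (@le_trans _ _ (((W' n 1 - W' n 0) `^ p^-1)%:E)).
      apply: (var_norm_le hN) => //.
        by move=> t t0 t1; rewrite xE// in_itv/= t0 t1.
      by move=> s t s0 st t1; rewrite sigE//; exact: xW.
    have W'0 : 0 <= W' n 1 - W' n 0 by apply: le_trans (xW n 0 1 _ _ _) => //; exact: powR_ge0.
    rewrite lee_fin; apply: ge0_ler_powR; rewrite ?invr_ge0 ?nnegrE ?(ltW p0)//.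
    exact: le_trans (W'1 n).
  - move=> t t01 w; have := @approx_cvg _ _ _ _ hN Y K x nat \oo id (fun=> t) t.
    move=> /(_ _ Y0 YG Yc K0 xG xY t01 (fun=> t01) (cvg_cst _) cvg_id w).
    by rewrite tcoefE; under eq_fun do rewrite tcoefE -xE//.
move=> q pq; have q0 : 0 < q by exact: lt_trans pq.
(* A bound, uniform in [n], for the sums over a partition of the [p]-th powers of the distances
   between increments of [x n] and [Y]. *)
pose M := 3 `^ p * (3 `^ p * (K `^ p + 1) * (W 1 - W 0) + (W 1 - W 0)).
have W10 : 0 <= W 1 - W 0 by apply: le_trans (WY 0 1 _ _ _) => //; exact: powR_ge0.
have M0 : 0 <= M.
  apply: mulr_ge0; first exact: powR_ge0.
  apply: addr_ge0 => //; apply: mulr_ge0 => //; apply: mulr_ge0; first exact: powR_ge0.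
  by apply: addr_ge0 => //; exact: powR_ge0.
have small e : 0 < e -> \forall n \near \oo, (var_dist N q (signature_path m (y n)) Y <= e%:E)%E.
  (* Chosen so that [d ^ (q - p) * M <= e ^ q]; the [1] added to [M] keeps the denominator
     positive. *)
  move=> e0; pose d := (e `^ q / (M + 1)) `^ (q - p)^-1.
  have qp : 0 < q - p by rewrite subr_gt0.
  have M1 : 0 < M + 1 by rewrite ltr_wpDl.
  have eq0 : 0 < e `^ q / (M + 1) by rewrite divr_gt0// powR_gt0.
  have d0 : 0 < d by rewrite powR_gt0.
  have dq : d `^ (q - p) = e `^ q / (M + 1).
    by rewrite /d -powRrM mulVf ?gt_eqF// powRr1// ltW.
  have := approx_hdist_uniform hN Y0 YG Yc K0 xG xY d0; apply: filterS => n nd.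
  (* A control for the [q]-th powers: one factor of exponent [q - p] is bounded uniformly by [d],
     the remaining [p]-th power by the controls of [x n] and [Y]. *)
  pose W'' t := d `^ (q - p) * (3 `^ p * (W' n t + W t)).
  apply: (@le_trans _ _ (((W'' 1 - W'' 0) `^ q^-1)%:E)).
    apply: var_dist_le => // s t s0 st t1; rewrite sigE//.
    have s01 : s \in `[0, 1] by rewrite in_itv/= s0 (le_trans st).
    have t01 : t \in `[0, 1] by rewrite in_itv/= t1 (le_trans s0).
    have xiG : free_nilpotent_group (tincr (x n) s t).
      by apply: groupM => //; exact: groupV.
    have YiG : free_nilpotent_group (tincr (Y : R -> talg V m) s t).
      by apply: group_incr => //; [exact: le_trans t1|exact: le_trans st].
    have h0 : 0 <= hdist N (tincr (x n) s t) (tincr Y s t).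
      by apply: (hnorm_ge0 hN); apply: groupM => //; exact: groupV.
    have -> : hdist N (tincr (x n) s t) (tincr Y s t) `^ q =
        hdist N (tincr (x n) s t) (tincr Y s t) `^ (q - p) *
        hdist N (tincr (x n) s t) (tincr Y s t) `^ p.
      by rewrite -powRD ?subrK// gt_eqF.
    rewrite /W'' -mulrBr -mulrBr; apply: ler_pM; rewrite ?powR_ge0//.
      by apply: ge0_ler_powR; rewrite ?nnegrE ?(ltW qp) ?(ltW d0)// nd.
    apply: le_trans (hdist_powR_le hN xiG YiG hp) _; rewrite ler_wpM2l ?powR_ge0//.
    have := xW n s t s0 st t1; have := WY s t s0 st t1; lra.
  have W''M : W'' 1 - W'' 0 <= e `^ q.
    rewrite /W'' -mulrBr -mulrBr dq; apply: (@le_trans _ _ (e `^ q / (M + 1) * M)).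
      rewrite ler_wpM2l ?(ltW eq0)// /M ler_wpM2l ?powR_ge0//.
      by have := W'1 n; lra.
    by rewrite mulrAC ler_pdivrMr// ler_wpM2l ?powR_ge0// lerDl.
  rewrite lee_fin; have -> : e = (e `^ q) `^ q^-1.
    by rewrite -powRrM divff ?gt_eqF// powRr1// ltW.
  have [W''0|W''0] := leP 0 (W'' 1 - W'' 0).
    by apply: ge0_ler_powR; rewrite ?invr_ge0 ?nnegrE ?powR_ge0 ?(ltW q0).
  have := xW n 0 1 (lexx _) ler01 (lexx _); have := WY 0 1 (lexx _) ler01 (lexx _).
  have := powR_ge0 (N (tincr (x n) 0 1)) p; have := powR_ge0 (N (tincr Y 0 1)) p => a1 a2 a3 a4.
  have : 0 <= W'' 1 - W'' 0.
    rewrite /W'' -mulrBr -mulrBr !mulr_ge0 ?powR_ge0//; lra.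
  by rewrite leNgt W''0.
(* [var_dist] takes extended real values, so it must be shown to be finite eventually before real
   limits can be taken. *)
apply/fine_cvgP; split.
  have := small 1 ltr01; apply: filterS => n n1.
  rewrite ge0_fin_numE; last exact: var_dist_ge0.
  exact: le_lt_trans n1 (ltry _).
apply/cvgrPdist_le => e e0; have := small e e0; apply: filterS => n ne.
rewrite sub0r normrN /=; move: ne (var_dist_ge0 N q (signature_path m (y n)) Y).
case: (var_dist _ _ _ _) => [v||//]; last by rewrite leye_eq.
by rewrite !lee_fin => ve v0; rewrite ger0_norm.
Qed.
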